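(* Let $k\ge2$ and let $(\prod_{j=1}^k \Omega_i^{(j)},\mathbf{P}_i)$, $1 \le i \le n$, be a sequence of finite probability spaces such that for all $i$ the minimum probability of any atom in $\prod_{j=1}^k \Omega_i^{(j)}$ is at least $\alpha>0$, and assume that $\rho(\Omega^{(1)}_i,\dots,\Omega^{(k)}_i; \mathbf{P}_i) \le \rho$ for all $i$, where $0 \le \rho < 1$. Let $\epsilon>0$. Then there exists $\tau > 0$, depending only on $k,\epsilon,\alpha,\rho$ (in particular not on $n$), such that for all functions $f_j : \prod_{i=1}^n \Omega_i^{(j)} \to [0,1]$, $1 \le j \le k$: (1) Suppose $k=2$, and let $\underline{\rho}\in[0,1]$ be such that $\rho(\Omega_i^{(1)},\Omega_i^{(2)};\mathbf{P}_i)\le\underline{\rho}$ for all $i$. If $$\max_{i} \min(\mathrm{Inf}_i(f_1),\mathrm{Inf}_i(f_2)) \le \tau,$$ then $$\underline{\Gamma}_{\underline{\rho}}(\mathbf{E}[f_1],\mathbf{E}[f_2]) - \epsilon \le \mathbf{E}[f_1 f_2] \le \overline{\Gamma}_{\underline{\rho}}(\mathbf{E}[f_1],\mathbf{E}[f_2]) + \epsilon .$$ (2) Suppose that $\rho(\Omega_i^{(j)},\Omega_i^{(j')};\mathbf{P}_i)=0$ for all $i$ and $j\ne j'$, and that for each $i$ the spaces $\Omega_i^{(1)},\dots,\Omega_i^{(k)}$ are $s$-wise independent. If for all $i$ $$|\{ j : \mathrm{Inf}_i(f_j) > \tau\}| \le s,$$ then $$\prod_{j=1}^k \mathbf{E}[f_j]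 - \epsilon \le \mathbf{E}\Big[\prod_{j=1}^k f_j\Big] \le \prod_{j=1}^k \mathbf{E}[f_j] + \epsilon .$$
   Context: Expectations are with respect to the product measure $\prod_{i=1}^n \mathbf{P}_i$ on $\prod_{i=1}^n\prod_{j=1}^k \Omega_i^{(j)}$, where $f_j$ is evaluated at the coordinates $(\omega_i^{(j)})_{i=1}^n$. An atom is a point of positive probability. Correlation: let $\mathbf{P}$ be a probability measure on $\prod_{j=1}^k \Omega^{(j)}$ and for $S\subset[k]$ write $\Omega^{(S)} = \prod_{j \in S} \Omega^{(j)}$. For $S,S' \subset [k]$, $\rho(\Omega^{(S)},\Omega^{(S')};\mathbf{P}) = \sup\{\mathrm{Cov}[f,g]: f \in L^2(\Omega^{(S)},\mathbf{P}),\ g \in L^2(\Omega^{(S')},\mathbf{P}),\ \mathrm{Var}[f]=\mathrm{Var}[g]=1\}$ (functions of the coordinates in $S$, respectively $S'$), and $\rho(\Omega^{(1)},\dots,\Omega^{(k)};\mathbf{P}) = \max_{1 \le i \le k} \rho(\prod_{j \ne i} \Omega^{(j)}, \Omega^{(i)};\mathbf{P})$. The spaces $\Omega^{(1)},\dots,\Omega^{(k)}$ are $s$-wise independent if for all $S \subset [k]$ with $|S| \le s$ and all $A_i\subset\Omega^{(i)}$, $i\in S$, $\mathbf{P}[\omega_i\in A_i\ \forall i\in S] = \prod_{i \in S} \mathbf{P}[\omega_i\in A_i]$. Influence: $\mathrm{Inf}_i(f) = \mathbf{E}[\mathrm{Var}[f(X_1,\dots,X_n) \mid X_{l},\ l \ne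 i]]$, where $X_1,\dots,X_n$ are independent coordinates of the product space on which $f$ is defined (for $f_j$, $X_i\in\Omega_i^{(j)}$ has the marginal law of $\mathbf{P}_i$). Gaussian stability: let $\Phi$ be the standard Gaussian distribution function (with $\Phi^{-1}(0)=-\infty$, $\Phi^{-1}(1)=+\infty$). For $(X,Y)$ a centered two-dimensional Gaussian vector with unit variances and covariance $\rho$, $\overline{\Gamma}_\rho(\mu,\nu) = \mathbf{P}[X \le \Phi^{-1}(\mu), Y \le \Phi^{-1}(\nu)]$ and $\underline{\Gamma}_\rho(\mu,\nu) = \mathbf{P}[X \le \Phi^{-1}(\mu), Y \ge \Phi^{-1}(1-\nu)]$. *)

(* Defs.v *)
(* Mathematical Components, with MathComp-Analysis for the Gaussian part *)
From HB Require Import structures.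
From mathcomp Require Import all_boot all_order all_algebra.
From mathcomp Require Import all_classical all_reals all_analysis.

Set Implicit Arguments.
Unset Strict Implicit.
Unset Printing Implicit Defensive.

Import Order.TTheory GRing.Theory Num.Theory.
Local Open Scope ring_scope.

Section FiniteProbability.
Context {R : realType} {T : finType}.
Implicit Types (P : T -> R) (f g : T -> R) (A : pred T).

Definition is_prob P : Prop := (forall x, 0 <= P x) /\ \sum_x P x = 1.

Definition Pr P A : R := \sum_(x | A x) P x.

Definition Ex P f : R := \sum_x P x * f x.

Definition Cov P f g : R := Ex P (fun x => (f x - Ex P f) * (g x - Ex P g)).

Definition Var P f : R := Cov P f f.

(* Conditioning on an event. When [Pr P A = 0] the value is 0, as [x / 0 = 0]. *)
Definition cond_Ex P f A : R := (\sum_(x | A x) P x * f x) / Pr P A.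

Definition cond_Var P f A : R :=
  cond_Ex P (fun x => (f x - cond_Ex P f A) ^+ 2) A.

End FiniteProbability.

Section ProductSpaces.
Context {R : realType} {I : finType} {T : I -> finType}.

Definition prod_prob (P : forall i, T i -> R) (x : {dffun forall i, T i}) : R :=
  \prod_i P i (x i).

Definition marginal (P : {dffun forall i, T i} -> R) (i : I) (a : T i) : R :=
  Pr P (fun x => x i == a).

(* The inner term is Var[f(X) | X_l, l != i] at the point X = x; the points x
   of probability zero, where it is a junk value, do not contribute to the
   outer expectation. *)
Definition influence (P : forall i, T i -> R) (i : I)
    (f : {dffun forall i, T i} -> R) : R :=
  Ex (prod_prob P) (fun x =>
    cond_Var (prod_prob P) f (fun y => [forall l, (l != i) ==> (y l == x l)])).

(* The coordinates of x in S, as a point of the subproduct over S *)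
Definition restrict (S : {set I}) (x : {dffun forall i, T i}) :
    {dffun forall i : {i : I | i \in S}, T (val i)} :=
  @finfun _ (fun i : {i : I | i \in S} => T (val i)) (fun i => x (val i)).

(* On a finite space every function is in L^2. The supremum is over a set
   bounded by 1 and symmetric under negation; it is 0 when the set is empty,
   i.e. when one of the two subproducts carries only constants. *)
Definition correlation2 (P : {dffun forall i, T i} -> R) (S S' : {set I}) : R :=
  sup (fun c : R =>
    exists (f : {dffun forall i : {i : I | i \in S}, T (val i)} -> R)
           (g : {dffun forall i : {i : I | i \in S'}, T (val i)} -> R),
      [/\ Var P (f \o restrict S) = 1,
          Var P (g \o restrict S') = 1
        & c = Cov P (f \o restrict S) (g \o restrict S')]).

(* Each [correlation2] is nonnegative, so starting the maximum at 0 is harmless. *)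
Definition correlation (P : {dffun forall i, T i} -> R) : R :=
  \big[Num.max/0]_(i : I) correlation2 P (~: [set i]) [set i].

Definition wise_independent (P : {dffun forall i, T i} -> R) (s : nat) : Prop :=
  forall S : {set I}, (#|S| <= s)%N -> forall A : (forall i, {set T i}),
    Pr P (fun x => [forall i in S, x i \in A i]) =
    \prod_(i in S) Pr P (fun x => x i \in A i).

End ProductSpaces.

Arguments marginal {R I T} P i a.

(* From a point w_i^(j) of the full product, the sequence (w_i^(j))_i, j fixed *)
Definition coordinates (n k : nat) (Omega : 'I_n -> 'I_k -> finType) (j : 'I_k)
    (w : {dffun forall i : 'I_n, {dffun forall j : 'I_k, Omega i j}}) :
    {dffun forall i : 'I_n, Omega i j} :=
  @finfun _ (fun i : 'I_n => Omega i j) (fun i => w i j).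

Section Gaussian.
Context {R : realType}.
Local Open Scope classical_set_scope.
Local Open Scope ereal_scope.
Implicit Types (rho mu nu : R).

Definition Phi (x : \bar R) : R :=
  fine (normal_prob (0 : R) 1 [set y : R | y%:E <= x]).

(* [Phi] is a strictly increasing bijection from [-oo, +oo] onto [0, 1]; this is
   its inverse, so that [Phi_inv 0 = -oo] and [Phi_inv 1 = +oo]. *)
Definition Phi_inv mu : \bar R := xget -oo [set x | Phi x = mu].

(* Law of (X, Y) = (Z1, rho Z1 + sqrt (1 - rho^2) Z2) for Z1, Z2 independent
   standard Gaussians: for |rho| <= 1, the centered Gaussian law on the plane
   with unit variances and covariance rho (degenerate when |rho| = 1). *)
Definition gaussian2 rho : set (R * R) -> \bar R :=
  pushforward (normal_prob (0 : R) 1 \x normal_prob (0 : R) 1)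
    (fun z : R * R => (z.1, rho * z.1 + Num.sqrt (1 - rho ^+ 2) * z.2)%R).

Definition Gamma_upper rho mu nu : R :=
  fine (gaussian2 rho
    [set xy | xy.1%:E <= Phi_inv mu /\ xy.2%:E <= Phi_inv nu]).

Definition Gamma_lower rho mu nu : R :=
  fine (gaussian2 rho
    [set xy | xy.1%:E <= Phi_inv mu /\ Phi_inv (1 - nu)%R <= xy.2%:E]).

End Gaussian.

(* Main.v *)
(* Work on the product of the spaces W_i = prod_j Omega_i^(j). Replacing each
   f_j by a noisy version T f_j hardly changes the expectation of the product,
   because conditioning on the other coordinates contracts at least as much as
   the noise does when the correlations are at most rho < 1.

   The coordinates are then averaged out one at a time. In (2), averaging the
   i-th one changes E[prod_j f_j] only by products of at least three differences
   D_i f_j = f_j - Av_i f_j, one of them of small influence. In (1), one follows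
   E[Gamma(f_1, f_2)] for the Gaussian stability Gamma, starting from
   x y <= Gamma(x, y): the second-order part of Gamma is nonpositive in mean on
   increments of correlation at most that of Gamma, so that averaging the i-th
   coordinate costs only a third-order Taylor remainder. If one of the two
   influences is large, concavity in one variable and the Lipschitz property in
   the other bound the cost by the root of the small influence instead; there
   are few such i, since the total influence of a noisy function is bounded.

   The third-order terms are summable: hypercontractivity of the noise gives
   E[|g| (D_i T f)^2] <= |g|_2 M_i + H_i with sum_i M_i bounded and sum_i H_i
   arbitrarily small. Neither Borell's theorem nor the invariance principle is
   used. For correlations close to 1, Gamma(x, y) is close to min(x, y) and the
   upper bound is trivial; the lower bound in (1) is the upper one for
   (f_1, 1 - f_2). *)
Require Import Defs.
From HB Require Import structures.
From mathcomp Require Import all_boot all_order all_algebra.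
From mathcomp Require Import all_classical all_reals all_analysis.
From mathcomp Require Import measurable_realfun ring lra.

Set Implicit Arguments.
Unset Strict Implicit.
Unset Printing Implicit Defensive.

Import Order.TTheory GRing.Theory Num.Theory.
Local Open Scope ring_scope.

(** The noise must be weak, of rate b close to 1 with rho at most a high power of b: only then is it
    hidden by correlations up to rho. At such a rate it need not contract L^2 into L^4. Hence f is
    split, by a truncated Neumann series, into the image of a much stronger noise (a high power of
    the weak one) and a remainder that becomes small under the weak noise; hypercontractivity treats
    the first part only, and total influence is bounded for both. The spectral estimates all come
    from the inequality |B h|^2 <= <B h, h>, which says that B has its spectrum in [0, 1] and which
    noise operators satisfy.

    For Gamma the natural variables are x = Phi a and y = Phi b. In them Gamma_xx and Gamma_yy are
    nonpositive, Gamma_xy is nonnegative and Gamma_xx Gamma_yy = rho^2 Gamma_xy^2: exactly the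
    degeneracy under which increments of correlation at most rho have a second-order part of
    nonpositive mean. The Taylor constants blow up when x or y tends to 0 or 1, so values are first
    squeezed into [d, 1 - d], at a cost proportional to d; they also blow up when rho tends to 1,
    which is why that range is set apart. *)

Section PositiveFunctional.
Context {R : realType} {X : Type}.
Implicit Types (L : (X -> R) -> R) (f g h : X -> R) (c : R).

(** The common interface of [Ex Q] and of [Av P i], [avs P s] evaluated at a point: one proof of
    Cauchy-Schwarz serves expectations and partial averages alike. *)
Definition pos_functional L : Prop :=
  [/\ forall f g, L (fun x => f x + g x) = L f + L g,
      forall c f, L (fun x => c * f x) = c * L f
    & forall f, (forall x, 0 <= f x) -> 0 <= L f].

Section Theory.
Variable L : (X -> R) -> R.
Hypothesis posL : pos_functional L.

Lemma posfD f g : L (fun x => f x + g x) = L f + L g.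
Proof. by case: posL. Qed.

Lemma posfZ c f : L (fun x => c * f x) = c * L f.
Proof. by case: posL. Qed.

Lemma posf_ge0 f : (forall x, 0 <= f x) -> 0 <= L f.
Proof. by case: posL => _ _; apply. Qed.

Lemma posfN f : L (fun x => - f x) = - L f.
Proof. by rewrite -mulN1r -posfZ; congr L; apply/funext => x; rewrite mulN1r. Qed.

Lemma posfB f g : L (fun x => f x - g x) = L f - L g.
Proof. by rewrite posfD posfN. Qed.

Lemma posf0 : L (fun=> 0) = 0.
Proof.
by rewrite -[RHS](mul0r (L (fun=> 0))) -posfZ; congr L; apply/funext => x; rewrite mul0r.
Qed.

Lemma posf_sum (J : Type) (r : seq J) (Q : pred J) (F : J -> X -> R) :
  L (fun x => \sum_(j <- r | Q j) F j x) = \sum_(j <- r | Q j) L (F j).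
Proof.
elim: r => [|j r IH].
  by rewrite big_nil -[RHS]posf0; congr L; apply/funext => x; rewrite big_nil.
rewrite big_cons -IH; case: ifP => Qj.
  by rewrite -posfD; congr L; apply/funext => x; rewrite big_cons Qj.
by congr L; apply/funext => x; rewrite big_cons Qj.
Qed.

Lemma posf_le f g : (forall x, f x <= g x) -> L f <= L g.
Proof. by move=> fg; rewrite -subr_ge0 -posfB posf_ge0// => x; rewrite subr_ge0. Qed.

Lemma posf_norm f : `|L f| <= L (fun x => `|f x|).
Proof.
rewrite ler_norml -posfN; apply/andP; split; apply: posf_le => x; last exact: ler_norm.
by rewrite lerNl -normrN ler_norm.
Qed.

Lemma posf_sqr_ge0 f : 0 <= L (fun x => f x ^+ 2).
Proof. by apply: posf_ge0 => x; exact: sqr_ge0. Qed.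

Lemma posf_CS f g :
  L (fun x => f x * g x) ^+ 2 <= L (fun x => f x ^+ 2) * L (fun x => g x ^+ 2).
Proof.
set a := L (fun x => f x ^+ 2); set b := L (fun x => g x ^+ 2).
set c := L _.
have a0 : 0 <= a by exact: posf_sqr_ge0.
have b0 : 0 <= b by exact: posf_sqr_ge0.
have H s t : 0 <= s ^+ 2 * a + s * t * 2 * c + t ^+ 2 * b.
  rewrite /a /b /c -!posfZ -!posfD; apply: posf_ge0 => x.
  by rewrite (_ : _ + _ = (s * f x + t * g x) ^+ 2) ?sqr_ge0//; ring.
(* For [a = 0] the form in [H] is linear in [s], and unless [c = 0] the values below bring it down
   to -4. Otherwise [s = - c] and [t = a] give [a (a b - c ^ 2)]. *)
have [a1|a1] := eqVneq a 0.
  have [c1|c1] := eqVneq c 0; first by rewrite a1 c1 expr0n mul0r.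
  have := H (- (b + 1) / c) 2; rewrite a1 mulr0 add0r.
  rewrite (_ : _ + _ = - 4); first by lra.
  by field.
have := H (- c) a; rewrite (_ : _ + _ = a * (a * b - c ^+ 2)); last by ring.
by rewrite pmulr_rge0 ?subr_ge0// lt_def a1.
Qed.

Lemma posf_CS_le f g A B : 0 <= A -> 0 <= B ->
  L (fun x => f x ^+ 2) <= A ^+ 2 -> L (fun x => g x ^+ 2) <= B ^+ 2 ->
  `|L (fun x => f x * g x)| <= A * B.
Proof.
move=> A0 B0 fA gB; rewrite -(@ler_pXn2r _ 2)// ?nnegrE ?mulr_ge0// real_normK ?num_real//.
by rewrite (le_trans (posf_CS _ _))// exprMn ler_pM// posf_sqr_ge0.
Qed.

End Theory.
End PositiveFunctional.

(** * Contractions with spectrum in [0, 1] *)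

Section SelfNoise.
Context {R : realType} {X : Type}.
Variable L : (X -> R) -> R.
Hypothesis posL : pos_functional L.
Implicit Types (f g h : X -> R) (B : (X -> R) -> X -> R).

Definition dotf f g : R := L (fun x => f x * g x).
Definition nrm2 f : R := L (fun x => f x ^+ 2).

Definition linear_op B : Prop :=
  forall a f g, B (fun x => a * f x + g x) = fun x => a * B f x + B g x.

(** For a self-adjoint [B] this is [B ^ 2 <= B], that is [0 <= B <= 1], expressed without adjoint or
    spectrum. The condition is symmetric under [B -> 1 - B]. *)
Definition damping B : Prop := linear_op B /\ forall h, nrm2 (B h) <= dotf (B h) h.

Definition co B h : X -> R := fun x => h x - B h x.

Lemma nrm2_ge0 f : 0 <= nrm2 f. Proof. exact: posf_sqr_ge0. Qed.

Lemma nrm2D_le f g : nrm2 (fun x => f x + g x) <= 2 * nrm2 f + 2 * nrm2 g.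
Proof.
rewrite /nrm2 -!(posfZ posL) -(posfD posL); apply: (posf_le posL) => x.
by have := sqr_ge0 (f x - g x); lra.
Qed.

Lemma linear_opD B f g : linear_op B -> B (fun x => f x + g x) = fun x => B f x + B g x.
Proof.
move=> linB; have := linB 1 f g; rewrite (_ : (fun x => 1 * f x + g x) = fun x => f x + g x).
  by move=> ->; apply/funext => x; rewrite mul1r.
by apply/funext => x; rewrite mul1r.
Qed.

Lemma linear_opB B f g : linear_op B -> B (fun x => f x - g x) = fun x => B f x - B g x.
Proof.
move=> linB; have := linB (-1) g f; rewrite (_ : (fun x => -1 * g x + f x) = fun x => f x - g x).
  by move=> ->; apply/funext => x; rewrite mulN1r addrC.
by apply/funext => x; rewrite mulN1r addrC.
Qed.

Lemma linear_op0 B : linear_op B -> B (fun=> 0) = fun=> 0.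
Proof.
move=> linB; rewrite -[in LHS](_ : (fun x : X => (0 : R) - 0) = fun=> 0); last first.
  by apply/funext => x; rewrite subr0.
by rewrite (@linear_opB _ (fun=> 0) (fun=> 0))//; apply/funext => x; rewrite subrr.
Qed.

Lemma linear_opZ B c f : linear_op B -> B (fun x => c * f x) = fun x => c * B f x.
Proof.
move=> linB; have := linB c f (fun=> 0); rewrite (linear_op0 linB) => h.
rewrite -(_ : (fun x => c * f x + 0) = fun x => c * f x) ?h.
  by apply/funext => x; rewrite addr0.
by apply/funext => x; rewrite addr0.
Qed.

Lemma linear_op_co B : linear_op B -> linear_op (co B).
Proof. by move=> lB a f g; apply/funext => x; rewrite /co lB; ring. Qed.

Lemma coK B h : linear_op B -> co (co B) h = B h.
Proof. by move=> linB; apply/funext => x; rewrite /co opprB addrC subrK. Qed.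

Lemma damping_co B : damping B -> damping (co B).
Proof.
move=> [linB dB]; split; first exact: linear_op_co.
move=> h; have H := dB h; rewrite /nrm2 /dotf -subr_ge0 -(posfB posL) in H.
by rewrite /nrm2 /dotf -subr_ge0 -(posfB posL); apply: le_trans H _; apply: (posf_le posL) => x; rewrite /co; lra.
Qed.

(** [|h - B h|^2 = |h|^2 - 2 <B h, h> + |B h|^2], and [<B h, h>] is at least [|B h|^2]. This is the
    summand of the telescoping in [damping_iter_co]. *)
Lemma damping_drop B h : damping B -> nrm2 (co B h) <= nrm2 h - nrm2 (B h).
Proof.
move=> [linB dB]; have H := dB h; rewrite /nrm2 /dotf -subr_ge0 -(posfB posL) in H.
rewrite /nrm2 -(posfB posL) -subr_ge0 -(posfB posL).
apply: le_trans (mulr_ge0 (ler0n _ 2) H) _.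
by rewrite -(posfZ posL); apply: (posf_le posL) => x; rewrite /co; lra.
Qed.

Lemma damping_contr B h : damping B -> nrm2 (B h) <= nrm2 h.
Proof.
by move=> dB; have := damping_drop h dB; have := nrm2_ge0 (co B h); lra.
Qed.

Lemma damping_iter_contr B m h : damping B -> nrm2 (iter m B h) <= nrm2 h.
Proof.
by move=> dB; elim: m => //= m; apply: le_trans; exact: damping_contr.
Qed.

Lemma co_iter B l f : linear_op B -> iter l B (co B f) = co B (iter l B f).
Proof. by move=> lB; elim: l => //= l ->; rewrite {1}/co linear_opB. Qed.

(* The spectral bound [x ^ l (1 - x) <= 1 / sqrt (l + 1)] on [0, 1], obtained by
   telescoping instead of diagonalizing. *)
Lemma damping_iter_co B l f : damping B -> l.+1%:R * nrm2 (iter l B (co B f)) <= nrm2 f.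
Proof.
move=> dB; have lB : linear_op B by case: dB.
suff H : l.+1%:R * nrm2 (co B (iter l B f)) <= nrm2 f - nrm2 (iter l.+1 B f).
  by rewrite co_iter//; have := nrm2_ge0 (iter l.+1 B f); lra.
elim: l => [|l IH]; first by rewrite mul1r; exact: damping_drop.
have h1 := damping_drop (iter l.+1 B f) dB.
have h2 : nrm2 (co B (iter l.+1 B f)) <= nrm2 (co B (iter l B f)).
  have /= := damping_contr (co B (iter l B f)) dB.
  by rewrite {1}/co linear_opB.
have h3 : l.+1%:R * nrm2 (co B (iter l.+1 B f)) <= l.+1%:R * nrm2 (co B (iter l B f)).
  by rewrite ler_wpM2l.
by rewrite -[l.+2%:R]natr1 mulrDl mul1r [iter l.+2 _ _]iterS; lra.
Qed.

(** The same spectral bound with [B] and [1 - B] exchanged: [x (1 - x) ^ m] instead of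
    [x ^ l (1 - x)]. *)
Lemma damping_co_iter B m f : damping B ->
  m.+1%:R * nrm2 (B (iter m (co B) f)) <= nrm2 f.
Proof.
move=> dB; have lB : linear_op B by case: dB.
have := damping_iter_co m f (damping_co dB).
by rewrite co_iter ?coK//; exact: linear_op_co.
Qed.

End SelfNoise.

(** * Averaging and noise operators *)

Section CoordinateOperators.
Context {R : realType} {I : finType} {W : I -> finType}.
Local Notation Om := ({dffun forall i, W i}).
Implicit Types (w : Om) (g h : Om -> R) (s : seq I).

Definition upd w (i : I) (a : W i) : Om := @finfun _ W (fun l => eqtype.dfwith w a l).
Arguments upd w {i} a.

Lemma updE w i (a : W i) l : upd w a l = eqtype.dfwith w a l.
Proof. by rewrite /upd ffunE. Qed.

Lemma upd_in w i (a : W i) : upd w a i = a.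
Proof. by rewrite updE eqtype.dfwith_in. Qed.

Lemma upd_out w i (a : W i) l : i != l -> upd w a l = w l.
Proof. by move=> il; rewrite updE eqtype.dfwith_out. Qed.

Lemma upd_id w i : upd w (w i) = w.
Proof.
apply/ffunP => l; have [<-|il] := eqVneq i l; first by rewrite upd_in.
by rewrite upd_out.
Qed.

Lemma upd_upd w i (a b : W i) : upd (upd w a) b = upd w b.
Proof.
apply/ffunP => l; have [<-|il] := eqVneq i l; first by rewrite !upd_in.
by rewrite !upd_out.
Qed.

Lemma upd_comm w i l (a : W i) (b : W l) : i != l ->
  upd (upd w a) b = upd (upd w b) a.
Proof.
move=> il; apply/ffunP => m; have [e|im] := eqVneq i m.
  by subst m; rewrite upd_in upd_out 1?eq_sym// upd_in.
have [e|lm] := eqVneq l m; last by rewrite !upd_out.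
by subst m; rewrite upd_in upd_out// upd_in.
Qed.

(** Averages, noise and conditional expectations in one coordinate all have this form, so one lemma
    gives commutation across different coordinates. *)
Definition kernel_op i (K : W i -> W i -> R) h : Om -> R :=
  fun w => \sum_a K (w i) a * h (upd w a).
Arguments kernel_op {i} K h.

Lemma kernel_op_linear i (K : W i -> W i -> R) : linear_op (kernel_op K).
Proof.
move=> c f g; apply/funext => w; rewrite /kernel_op mulr_sumr -big_split/=.
by apply: eq_bigr => a _; ring.
Qed.

Lemma kernel_op_comm i l (K : W i -> W i -> R) (K' : W l -> W l -> R) h :
  i != l -> kernel_op K (kernel_op K' h) = kernel_op K' (kernel_op K h).
Proof.
move=> il; apply/funext => w; rewrite /kernel_op.
under eq_bigr do rewrite mulr_sumr; rewrite exchange_big/=.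
apply: eq_bigr => b _; rewrite mulr_sumr; apply: eq_bigr => a _.
rewrite upd_out// upd_out 1?eq_sym// upd_comm//; ring.
Qed.

Variable P : forall i, W i -> R.
Arguments P : clear implicits.
Hypothesis probP : forall i, is_prob (P i).

Definition Av i h : Om -> R := fun w => Ex (P i) (fun a => h (upd w a)).

Definition Dif i h : Om -> R := co (Av i) h.

(** For [0 <= b <= 1]: the i-th coordinate is kept with probability [b] and resampled otherwise. *)
Definition Nz i (b : R) h : Om -> R := fun w => b * h w + (1 - b) * Av i h w.

Definition avs s h : Om -> R := foldr Av h s.

Definition noises b s h : Om -> R := foldr (fun i => Nz i b) h s.

Definition noise b : (Om -> R) -> Om -> R := noises b (enum I).

Local Notation Exp := (Ex (prod_prob P)).

Lemma Ex_pos (T : finType) (Q : T -> R) : (forall x, 0 <= Q x) -> pos_functional (Ex Q).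
Proof.
move=> Q0; split => [f g|c f|f f0]; rewrite /Ex.
- by rewrite -big_split; apply: eq_bigr => x _; rewrite mulrDr.
- by rewrite mulr_sumr; apply: eq_bigr => x _; ring.
- by apply: sumr_ge0 => x _; rewrite mulr_ge0.
Qed.

Lemma Ex_prob (T : finType) (Q : T -> R) : is_prob Q -> pos_functional (Ex Q).
Proof. by move=> [Q0 _]; exact: Ex_pos. Qed.

Lemma Ex_cst (T : finType) (Q : T -> R) c : is_prob Q -> Ex Q (fun=> c) = c.
Proof. by move=> [_ Q1]; rewrite /Ex -mulr_suml Q1 mul1r. Qed.

Lemma prod_prob_ge0 w : 0 <= prod_prob P w.
Proof. by apply: prodr_ge0 => i _; case: (probP i). Qed.

Lemma Exp_pos : pos_functional Exp.
Proof. exact/Ex_pos/prod_prob_ge0. Qed.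
Hint Resolve Exp_pos : core.

Lemma Av_pos i w : pos_functional (fun h => Av i h w).
Proof.
have [p1 p2 p3] := Ex_prob (probP i).
by split=> [f g|c f|f f0]; [exact: p1|exact: p2|apply: p3 => a].
Qed.

Lemma Av_kernel i : Av i = kernel_op (fun _ a => P i a).
Proof. by []. Qed.

Lemma Av_linear i : linear_op (Av i).
Proof. by rewrite Av_kernel; exact: kernel_op_linear. Qed.
Hint Resolve Av_linear : core.

Lemma Nz_kernel i b : Nz i b = kernel_op (fun x a => b * (a == x)%:R + (1 - b) * P i a).
Proof.
apply/funext => h; apply/funext => w; rewrite /Nz /kernel_op.
under [in RHS]eq_bigr do rewrite mulrDl; rewrite big_split/=; congr (_ + _).
  rewrite (bigD1 (w i))//= eqxx mulr1 upd_id big1 ?addr0// => a /negbTE ->.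
  by rewrite mulr0 mul0r.
by rewrite /Av /Ex mulr_sumr; apply: eq_bigr => a _; rewrite mulrA.
Qed.

Lemma Nz_linear i b : linear_op (Nz i b).
Proof. by rewrite Nz_kernel; exact: kernel_op_linear. Qed.
Hint Resolve Nz_linear : core.

Lemma Av_upd i h w (a : W i) : Av i h (upd w a) = Av i h w.
Proof. by rewrite /Av; congr (Ex _ _); apply/funext => b; rewrite upd_upd. Qed.

Lemma Av_mul i g h :
  (forall w (a : W i), g (upd w a) = g w) ->
  Av i (fun w => g w * h w) = fun w => g w * Av i h w.
Proof.
move=> gi; apply/funext => w; rewrite /Av -(posfZ (Ex_prob (probP i))).
by congr Ex; apply/funext => a; rewrite gi.
Qed.

Lemma Av_cst i c : Av i (fun=> c) = fun=> c.
Proof. by apply/funext => w; rewrite /Av Ex_cst. Qed.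

Lemma Av_invariant i g : (forall w (a : W i), g (upd w a) = g w) -> Av i g = g.
Proof.
move=> gi; have := Av_mul (fun=> 1) gi; rewrite Av_cst => e.
rewrite -[in LHS](_ : (fun w => g w * 1) = g) ?e; apply/funext => w; exact: mulr1.
Qed.

Lemma Av_Av i h : Av i (Av i h) = Av i h.
Proof. by apply: Av_invariant => w a; exact: Av_upd. Qed.

Lemma Av_comm i l h : Av i (Av l h) = Av l (Av i h).
Proof. by have [->//|il] := eqVneq i l; rewrite !Av_kernel kernel_op_comm. Qed.

Lemma Exp_Av i h : Exp (Av i h) = Exp h.
Proof.
pose Q w : R := \prod_(l | l != i) P l (w l).
have QE w : prod_prob P w = P i (w i) * Q w by rewrite /prod_prob (bigD1 i).
have Qu w (a : W i) : Q (upd w a) = Q w.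
  by apply: eq_bigr => l il; rewrite upd_out 1?eq_sym.
rewrite /Ex; under eq_bigr do rewrite /Av /Ex mulr_sumr.
rewrite pair_bigA/=.
(* Exchange the i-th coordinate with the independent copy [a]: an involution on pairs that preserves
   their joint weight. *)
rewrite (reindex_onto (fun p : Om * W i => (upd p.1 p.2, p.1 i))
  (fun p => (upd p.1 p.2, p.1 i)))/=; last first.
  by move=> [w a] _ /=; rewrite upd_upd upd_id upd_in.
under eq_bigl => p do rewrite upd_upd upd_id upd_in -surjective_pairing eqxx.
rewrite -(pair_bigA _ (fun w a => prod_prob P (upd w a) *
  (P i (w i) * h (upd (upd w a) (w i)))))/=.
apply: eq_bigr => w _.
under eq_bigr => a _ do rewrite upd_upd upd_id QE Qu upd_in -mulrA.
by rewrite -mulr_suml (proj2 (probP i)) mul1r QE; ring.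
Qed.

Lemma sum_prod_prob : \sum_w prod_prob P w = 1.
Proof.
transitivity (\prod_i \sum_a P i a); last by apply: big1 => i _; case: (probP i).
(* The types [W i] vary with [i], so distributivity is applied to sums over the tagged union and
   transported back through [fprod]. *)
under [RHS]eq_bigr => i _ do rewrite (big_tag P i).
rewrite bigA_distr_big_dep.
rewrite (reindex (@dffun_of_fprod I W)); last exact/onW_bij/dffun_of_fprod_bij.
rewrite /prod_prob.
transitivity (\sum_(t : fprod W) \prod_(i in I) ([ffun a => P i a] : {ffun W i -> R}) (t i)).
  by apply: eq_bigr => t _; apply: eq_bigr => i _; rewrite /dffun_of_fprod !ffunE.
rewrite big_fprod; apply: eq_bigr => g _; apply: eq_bigr => i _.
by congr (untag 0 _ _); apply/funext => a; rewrite ffunE.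
Qed.

Lemma prod_prob_is_prob : is_prob (prod_prob P).
Proof. by split; [exact: prod_prob_ge0|exact: sum_prod_prob]. Qed.

End CoordinateOperators.

Section NoiseOperators.
Context {R : realType} {I : finType} {W : I -> finType}.
Variable P : forall i, W i -> R.
Arguments P : clear implicits.
Hypothesis probP : forall i, is_prob (P i).
Local Notation Om := ({dffun forall i, W i}).
Implicit Types (w : Om) (g h f : Om -> R) (s : seq I) (b : R).
Local Notation Exp := (Ex (prod_prob P)).
Local Notation nrm := (nrm2 Exp).
Local Notation dot := (dotf Exp).
Let posE : pos_functional Exp := Exp_pos probP.
Let linA i : linear_op (Av P i) := Av_linear P i.
Let linN i b : linear_op (Nz P i b) := Nz_linear P i b.

Lemma Av_self i g h : dot (Av P i g) h = dot (Av P i g) (Av P i h).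
Proof.
rewrite /dotf -(Exp_Av probP i (fun w => _ * h w)) Av_mul// => w a.
by rewrite Av_upd.
Qed.

Lemma dotC g h : dot g h = dot h g.
Proof. by rewrite /dotf; congr Ex; apply/funext => w; rewrite mulrC. Qed.

Lemma Av_adj i g h : dot (Av P i g) h = dot g (Av P i h).
Proof. by rewrite Av_self dotC -Av_self dotC. Qed.

Lemma nrm_split i h : nrm h = nrm (Av P i h) + nrm (Dif P i h).
Proof.
have e : dot (Av P i h) h = nrm (Av P i h).
  by rewrite Av_self /dotf /nrm2; congr Ex; apply/funext => w; rewrite expr2.
rewrite /nrm2 /Dif /co -(posfD posE).
transitivity (Exp (fun w => h w ^+ 2) - 2 * (dot (Av P i h) h - nrm (Av P i h))).
  by rewrite e subrr mulr0 subr0.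
rewrite /dotf /nrm2 -(posfB posE) -(posfZ posE) -(posfB posE).
by congr Ex; apply/funext => w; ring.
Qed.

Lemma Nz_Av_comm i l b h : Nz P i b (Av P l h) = Av P l (Nz P i b h).
Proof.
by rewrite /Nz linear_opD// !linear_opZ// Av_comm.
Qed.

Lemma Av_Nz_same i b h : Av P i (Nz P i b h) = Av P i h.
Proof.
rewrite -Nz_Av_comm /Nz; apply/funext => w; rewrite Av_Av//; ring.
Qed.

Lemma Dif_Nz_same i b h : Dif P i (Nz P i b h) = fun w => b * Dif P i h w.
Proof. by rewrite /Dif /co Av_Nz_same /Nz; apply/funext => w; ring. Qed.

Lemma nrm_scale c h : nrm (fun w => c * h w) = c ^+ 2 * nrm h.
Proof. by rewrite /nrm2 -(posfZ posE); congr Ex; apply/funext => w; ring. Qed.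

Lemma nrm_Nz i b h : nrm (Nz P i b h) = nrm (Av P i h) + b ^+ 2 * nrm (Dif P i h).
Proof. by rewrite (nrm_split i) Av_Nz_same Dif_Nz_same nrm_scale. Qed.

Lemma Nz_adj i b g h : dot (Nz P i b g) h = dot g (Nz P i b h).
Proof.
have e1 : dot (Nz P i b g) h = b * dot g h + (1 - b) * dot (Av P i g) h.
  rewrite /dotf -!(posfZ posE) -(posfD posE); congr Ex; apply/funext => w.
  by rewrite /Nz; ring.
have e2 : dot g (Nz P i b h) = b * dot g h + (1 - b) * dot g (Av P i h).
  rewrite /dotf -!(posfZ posE) -(posfD posE); congr Ex; apply/funext => w.
  by rewrite /Nz; ring.
by rewrite e1 e2 Av_adj.
Qed.

Lemma Nz_mul i b c h : Nz P i b (Nz P i c h) = Nz P i (b * c) h.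
Proof.
apply/funext => w; rewrite {1}/Nz Av_Nz_same /Nz; ring.
Qed.

Lemma Nz_kernel_comm i l b (K : W l -> W l -> R) h : i != l ->
  Nz P i b (kernel_op K h) = kernel_op K (Nz P i b h).
Proof. by move=> il; rewrite !Nz_kernel kernel_op_comm. Qed.

Lemma Nz_comm i l b c h : Nz P i b (Nz P l c h) = Nz P l c (Nz P i b h).
Proof.
have [->|il] := eqVneq i l; first by rewrite !Nz_mul mulrC.
by rewrite (Nz_kernel P l) Nz_kernel_comm.
Qed.

Lemma noises_linear b s : linear_op (noises P b s).
Proof.
elim: s => [//|i s IH] c f g; rewrite /noises/= -!/(noises _ _ _ _) IH.
exact: linN.
Qed.

Lemma Nz_noises_comm i b c s h : Nz P i b (noises P c s h) = noises P c s (Nz P i b h).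
Proof.
by elim: s => //= l s IH; rewrite -!/(noises _ _ _ _) Nz_comm IH.
Qed.

Lemma Av_noises_comm i c s h : Av P i (noises P c s h) = noises P c s (Av P i h).
Proof.
by elim: s => //= l s IH; rewrite -!/(noises _ _ _ _) -Nz_Av_comm IH.
Qed.

Lemma noises_mul b c s h : noises P b s (noises P c s h) = noises P (b * c) s h.
Proof.
elim: s => //= i s IH; rewrite -!/(noises _ _ _ _).
by rewrite -Nz_noises_comm Nz_mul IH.
Qed.

Lemma noises_adj b s g h : dot (noises P b s g) h = dot g (noises P b s h).
Proof.
elim: s g h => //= i s IH g h; rewrite -!/(noises _ _ _ _).
by rewrite Nz_adj IH -Nz_noises_comm.
Qed.

Lemma dot_nrm h : dot h h = nrm h.
Proof. by rewrite /dotf /nrm2; congr Ex; apply/funext => w; rewrite expr2. Qed.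

Lemma nrm_ge0 h : 0 <= nrm h. Proof. exact: nrm2_ge0. Qed.

Lemma nrm_Av_le i h : nrm (Av P i h) <= nrm h.
Proof. by rewrite [leRHS](nrm_split i) lerDl nrm_ge0. Qed.

Lemma nrm_Nz_mono i b c h : 0 <= b <= c -> nrm (Nz P i b h) <= nrm (Nz P i c h).
Proof.
move=> /andP[b0 bc]; rewrite !nrm_Nz lerD2l ler_wpM2r ?nrm_ge0//.
by rewrite ler_pXn2r// nnegrE (le_trans b0).
Qed.

Lemma Nz1 i h : Nz P i 1 h = h.
Proof. by apply/funext => w; rewrite /Nz subrr mul0r addr0 mul1r. Qed.

Lemma nrm_Nz_le i b h : 0 <= b <= 1 -> nrm (Nz P i b h) <= nrm h.
Proof. by move=> /nrm_Nz_mono h1; rewrite -[leRHS](congr1 nrm (Nz1 i h)). Qed.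

Lemma nrm_noises_le b s h : 0 <= b <= 1 -> nrm (noises P b s h) <= nrm h.
Proof.
by move=> b01; elim: s => //= i s; apply: le_trans; exact: nrm_Nz_le.
Qed.

(** The rate is a square because [<T_(b^2) h, h> = |T_b h|^2] while [T_(b^2) h = T_b (T_b h)]; this
    is the origin of the rates [b * b] from here on. *)
Lemma noises_damping b s : 0 <= b <= 1 -> damping Exp (noises P (b * b) s).
Proof.
move=> b01; split; first exact: noises_linear.
move=> h; rewrite -noises_mul noises_adj dot_nrm.
exact: nrm_noises_le.
Qed.

Lemma Dif_linear i : linear_op (Dif P i).
Proof. exact/linear_op_co/linA. Qed.

Lemma Dif_noises_comm i c s h : Dif P i (noises P c s h) = noises P c s (Dif P i h).
Proof.
by rewrite /Dif /co Av_noises_comm linear_opB//; exact: noises_linear.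
Qed.

(** Noise in coordinate [i] lowers the squared norm by exactly [1 - b ^+ 2] times the influence of
    [i] at that stage; the noise added from then on only decreases this influence, and the drops
    telescope. *)
Lemma total_influence_noises b s g : 0 <= b <= 1 ->
  (1 - b ^+ 2) * \sum_(i <- s) nrm (Dif P i (noises P b s g)) <= nrm g - nrm (noises P b s g).
Proof.
move=> b01; have b21 : b ^+ 2 <= 1 by rewrite expr_le1//; case/andP: b01.
elim: s => [|i s IH]; first by rewrite big_nil mulr0 subrr.
rewrite big_cons /=; set h := noises P b s g.
have e : nrm h - nrm (Nz P i b h) = (1 - b ^+ 2) * nrm (Dif P i h).
  by rewrite (nrm_split i h) nrm_Nz; ring.
have h1 : nrm (Dif P i (Nz P i b h)) <= nrm (Dif P i h).
  by rewrite Dif_Nz_same nrm_scale ler_piMl ?nrm_ge0.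
have h2 : \sum_(l <- s) nrm (Dif P l (Nz P i b h)) <= \sum_(l <- s) nrm (Dif P l h).
  apply: ler_sum => l _.
  have -> : Dif P l (Nz P i b h) = Nz P i b (Dif P l h).
    by rewrite /Dif /co -Nz_Av_comm linear_opB.
  exact: nrm_Nz_le.
have h3 : (1 - b ^+ 2) * nrm (Dif P i (Nz P i b h)) +
    (1 - b ^+ 2) * \sum_(l <- s) nrm (Dif P l (Nz P i b h)) <=
    (1 - b ^+ 2) * nrm (Dif P i h) + (1 - b ^+ 2) * \sum_(l <- s) nrm (Dif P l h).
  by rewrite lerD// ler_wpM2l// subr_ge0.
by rewrite mulrDr; apply: le_trans h3 _; rewrite -e; move: IH; rewrite -/h; lra.
Qed.

Lemma avs_linear s : linear_op (avs P s).
Proof.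
elim: s => [//|i s IH] c f g; rewrite /avs/= -!/(avs _ _ _) IH.
exact: linA.
Qed.

Lemma Av_avs_comm i s h : Av P i (avs P s h) = avs P s (Av P i h).
Proof. by elim: s => //= l s IH; rewrite -!/(avs _ _ _) Av_comm IH. Qed.

Lemma Dif_avs_comm i s h : Dif P i (avs P s h) = avs P s (Dif P i h).
Proof. by rewrite /Dif /co Av_avs_comm linear_opB//; exact: avs_linear. Qed.

Lemma avs_noises_comm c s r h : avs P r (noises P c s h) = noises P c s (avs P r h).
Proof. by elim: r => //= l r IH; rewrite -!/(avs _ _ _) IH Av_noises_comm. Qed.

Lemma nrm_avs_le s h : nrm (avs P s h) <= nrm h.
Proof. by elim: s => //= i s; apply: le_trans; exact: nrm_Av_le. Qed.

Lemma avs_pos s w : pos_functional (fun h => avs P s h w).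
Proof.
elim: s w => [w|i s IH w]; first by split => //= c f f0; exact: f0.
have [p1 p2 p3] := Av_pos probP i w.
split => [f g|c f|f f0] /=; rewrite -!/(avs _ _ _).
- by rewrite -p1; congr (Av _ _ _ _); apply/funext => x; exact: (posfD (IH x)).
- by rewrite -p2; congr (Av _ _ _ _); apply/funext => x; exact: (posfZ (IH x)).
- by apply: p3 => x; exact: (posf_ge0 (IH x)).
Qed.

Lemma Exp_avs s h : Exp (avs P s h) = Exp h.
Proof. by elim: s => //= i s <-; exact: Exp_Av. Qed.

Lemma avs_agree s h w w' : (forall i, i \notin s -> w i = w' i) ->
  avs P s h w = avs P s h w'.
Proof.
elim: s w w' => [|i s IH] w w' ww' /=.
  by congr h; apply/ffunP => i; exact: ww'.
congr Ex; apply/funext => a; apply: IH => l ls.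
have [<-|il] := eqVneq i l; first by rewrite !upd_in.
by rewrite !upd_out// ww'// in_cons negb_or eq_sym il.
Qed.

Lemma avs_enum h : avs P (enum I) h = fun=> Exp h.
Proof.
apply/funext => w; rewrite -(Exp_avs (enum I)).
transitivity (Exp (fun=> avs P (enum I) h w)).
  by rewrite Ex_cst//; exact: prod_prob_is_prob.
congr Ex; apply/funext => w'; apply: avs_agree => i.
by rewrite mem_enum.
Qed.

Lemma Nz_range i b lo hi h : 0 <= b <= 1 -> (forall w, lo <= h w <= hi) ->
  forall w, lo <= Nz P i b h w <= hi.
Proof.
move=> /andP[b0 b1] hh w; rewrite /Nz.
have /andP[l1 u1] := hh w.
have l2 : lo <= Av P i h w.
  rewrite -(congr1 (fun f => f w) (Av_cst probP i lo)); apply: (posf_le (Av_pos probP i w)) => x.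
  by case/andP: (hh x).
have u2 : Av P i h w <= hi.
  rewrite -(congr1 (fun f => f w) (Av_cst probP i hi)); apply: (posf_le (Av_pos probP i w)) => x.
  by case/andP: (hh x).
apply/andP; split; nra.
Qed.

Lemma noises_range b s lo hi h : 0 <= b <= 1 -> (forall w, lo <= h w <= hi) ->
  forall w, lo <= noises P b s h w <= hi.
Proof. by move=> b01 hh; elim: s => //= i s IH; exact: Nz_range. Qed.

Lemma avs_range s lo hi h : (forall w, lo <= h w <= hi) ->
  forall w, lo <= avs P s h w <= hi.
Proof.
move=> hh; elim: s => [//|i s IH] w /=; rewrite -/(avs _ _ _).
have := @Nz_range i 0 lo hi _ _ IH w; rewrite lexx ler01 => /(_ isT).
by rewrite /Nz mul0r add0r subr0 mul1r.
Qed.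

Lemma Exp_Nz i b h : Exp (Nz P i b h) = Exp h.
Proof.
rewrite /Nz posfD// !posfZ// Exp_Av//; ring.
Qed.

Lemma Exp_noises b s h : Exp (noises P b s h) = Exp h.
Proof. by elim: s => //= i s <-; exact: Exp_Nz. Qed.

End NoiseOperators.

(** * Hypercontractivity and third moments *)

Section Hypercontractivity.
Context {R : realType}.

(** Write [u = c + h] with [Ex Q h = 0]. The cross term [4 c b^3 h^3] is absorbed by
    [2 b^2 h^2 (c^2 + b^2 h^2)], and the fourth moment of [h] costs a factor [alpha^-1], for which
    [b^4] pays. *)
Lemma noise_fourth_moment (T : finType) (Q : T -> R) (alpha b : R) (u : T -> R) :
  is_prob Q -> (forall x, 0 < Q x -> alpha <= Q x) ->
  0 <= b -> 2 * b <= 1 -> 2 * b <= alpha ->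
  Ex Q (fun x => (b * u x + (1 - b) * Ex Q u) ^+ 4) <= Ex Q (fun x => u x ^+ 2) ^+ 2.
Proof.
move=> probQ atomQ b0 b1 ba.
have posQ := Ex_prob probQ.
set c := Ex Q u; pose h x := u x - c; set v := Ex Q (fun x => h x ^+ 2).
have Eh : Ex Q h = 0 by rewrite /h (posfB posQ u) Ex_cst// subrr.
have v0 : 0 <= v by exact: posf_sqr_ge0.
have Eu : Ex Q (fun x => u x ^+ 2) = c ^+ 2 + v.
  transitivity (Ex Q (fun x => c ^+ 2 + (2 * c * h x + h x ^+ 2))).
    by congr Ex; apply/funext => x; rewrite /h; ring.
  by rewrite !(posfD posQ) (posfZ posQ) Ex_cst// Eh mulr0 add0r.
have Q0 : forall x, 0 <= Q x by case: probQ.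
have h4 : alpha * Ex Q (fun x => h x ^+ 4) <= v ^+ 2.
  rewrite expr2 -(posfZ posQ) -[X in _ <= X](posfZ posQ) /Ex; apply: ler_sum => x _.
  have := Q0 x; rewrite le_eqVlt => /predU1P[<-|Qx]; first by rewrite !mul0r.
  rewrite ler_pM2l// (_ : alpha * _ = (alpha * h x ^+ 2) * h x ^+ 2); last by ring.
  rewrite ler_wpM2r ?sqr_ge0//.
  (* An atom has mass at least [alpha], and its own contribution is at most the whole variance
     [v]. *)
  apply: (@le_trans _ _ (Q x * h x ^+ 2)).
    by rewrite ler_wpM2r ?sqr_ge0// atomQ.
  rewrite /v /Ex (bigD1 x)//= lerDl sumr_ge0// => y _.
  by rewrite mulr_ge0 ?sqr_ge0.
have m40 : 0 <= Ex Q (fun x => h x ^+ 4).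
  by apply: (posf_ge0 posQ) => x; rewrite exprn_even_ge0.
have step : Ex Q (fun x => (b * u x + (1 - b) * c) ^+ 4) <=
    c ^+ 4 + 8 * c ^+ 2 * b ^+ 2 * v + 3 * b ^+ 4 * Ex Q (fun x => h x ^+ 4).
  rewrite [leRHS](_ : _ = Ex Q (fun x => c ^+ 4 + 4 * c ^+ 3 * b * h x +
      8 * c ^+ 2 * b ^+ 2 * h x ^+ 2 + 3 * b ^+ 4 * h x ^+ 4)); last first.
    by rewrite !(posfD posQ) !(posfZ posQ) Ex_cst// Eh mulr0 addr0.
  apply: (posf_le posQ) => x; rewrite -subr_ge0 /h.
  rewrite (_ : _ - _ = 2 * (b * (u x - c)) ^+ 2 * (b * (u x - c) - c) ^+ 2); last by ring.
  by apply: mulr_ge0; [apply: mulr_ge0 => //; exact: sqr_ge0|exact: sqr_ge0].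
apply: (le_trans step); rewrite Eu.
have b2 : 8 * b ^+ 2 <= 2 by nra.
have : 3 * b ^+ 4 <= alpha.
  have b4 : b ^+ 2 * b ^+ 2 <= 4^-1 * b ^+ 2 by rewrite ler_wpM2r ?sqr_ge0//; lra.
  have b5 : b ^+ 2 <= 2^-1 * b by rewrite expr2 ler_wpM2r//; lra.
  by rewrite (_ : b ^+ 4 = b ^+ 2 * b ^+ 2); [lra|ring].
move=> ba4.
have : 3 * b ^+ 4 * Ex Q (fun x => h x ^+ 4) <= v ^+ 2.
  by apply: le_trans h4; rewrite ler_wpM2r.
have : 8 * c ^+ 2 * b ^+ 2 * v <= 2 * c ^+ 2 * v.
  rewrite ler_wpM2r//; have := sqr_ge0 c; nra.
by move=> k1 k2; rewrite (_ : (c ^+ 2 + v) ^+ 2 = c ^+ 4 + 2 * c ^+ 2 * v + v ^+ 2); [lra|ring].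
Qed.

Context {I : finType} {W : I -> finType}.
Variable P : forall i, W i -> R.
Arguments P : clear implicits.
Hypothesis probP : forall i, is_prob (P i).
Local Notation Om := ({dffun forall i, W i}).
Implicit Types (w : Om) (g h f : Om -> R) (s : seq I) (b : R).

Lemma Av_upd_out h w i l (a : W i) : i != l ->
  Av P l h (upd w a) = Av P l (fun w => h (upd w a)) w.
Proof.
by move=> il; congr Ex; apply/funext => b; rewrite upd_comm.
Qed.

Lemma avs_upd_out h w i s (a : W i) : i \notin s ->
  avs P s h (upd w a) = avs P s (fun w => h (upd w a)) w.
Proof.
elim: s w => //= l s IH w; rewrite in_cons negb_or => /andP[il ils].
by rewrite -!/(avs _ _ _) Av_upd_out//; congr Ex; apply/funext => b; rewrite IH.
Qed.

Lemma noises_upd_out b h w i s (a : W i) : i \notin s ->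
  noises P b s h (upd w a) = noises P b s (fun w => h (upd w a)) w.
Proof.
elim: s w => //= l s IH w; rewrite in_cons negb_or => /andP[il ils].
rewrite -!/(noises _ _ _ _) /Nz IH// Av_upd_out//.
by congr (_ + _ * Ex _ _); apply/funext => c; rewrite IH.
Qed.

Variables (alpha b : R).
Hypothesis atomP : forall i x, 0 < P i x -> alpha <= P i x.
Hypotheses (b0 : 0 <= b) (b1 : 2 * b <= 1) (ba : 2 * b <= alpha).

(** Tensorization, stated at a point with the coordinates outside [s] frozen, so that the induction
    hypothesis applies to each section [h (upd w a)]. After the one-coordinate bound, the square of
    the average over [i] is a double sum over values [a] and [c], and Cauchy-Schwarz separates the
    two in each term. *)
Lemma noises_hypercontractive s h w : uniq s ->
  avs P s (fun x => noises P b s h x ^+ 4) w <= avs P s (fun x => h x ^+ 2) w ^+ 2.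
Proof.
elim: s h w => [|i s IH] h w /=; first by move=> _; rewrite -exprM.
move=> /andP[ils us]; rewrite -!/(avs _ _ _) -!/(noises _ _ _ _).
set X := noises P b s h.
rewrite Av_avs_comm.
apply: (@le_trans _ _ (avs P s (fun x => Av P i (fun y => X y ^+ 2) x ^+ 2) w)).
  apply: (posf_le (avs_pos probP s w)) => x.
  have := @noise_fourth_moment _ (P i) alpha b (fun a => X (upd x a)) (probP i)
    (atomP (i := i)) b0 b1 ba.
  rewrite /Av /Ex/=; apply: le_trans; rewrite le_eqVlt; apply/orP; left; apply/eqP; apply: eq_bigr => a _.
  congr (_ * _ ^+ 4); rewrite /Nz /Av; congr (_ + _ * _).
  by congr Ex; apply/funext => c; rewrite upd_upd.
have -> : (fun x => Av P i (fun y => X y ^+ 2) x ^+ 2) =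
    (fun x => \sum_a \sum_c P i a * P i c * (X (upd x a) ^+ 2 * X (upd x c) ^+ 2)).
  apply/funext => x; rewrite /Av /Ex expr2 mulr_suml; apply: eq_bigr => a _.
  by rewrite mulr_sumr; apply: eq_bigr => c _; ring.
rewrite (posf_sum (avs_pos probP s w)).
have -> : Av P i (avs P s (fun x => h x ^+ 2)) w ^+ 2 =
   \sum_a \sum_c P i a * P i c *
     (avs P s (fun x => h x ^+ 2) (upd w a) * avs P s (fun x => h x ^+ 2) (upd w c)).
  rewrite /Av /Ex expr2 mulr_suml; apply: eq_bigr => a _.
  by rewrite mulr_sumr; apply: eq_bigr => c _; ring.
apply: ler_sum => a _; rewrite (posf_sum (avs_pos probP s w)).
apply: ler_sum => c _; rewrite (posfZ (avs_pos probP s w)).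
have P0 x : 0 <= P i x by case: (probP i).
rewrite ler_wpM2l ?mulr_ge0//.
apply: le_trans (ler_norm _) _.
have H (e : W i) : avs P s (fun x => (X (upd x e) ^+ 2) ^+ 2) w <=
    avs P s (fun x => h x ^+ 2) (upd w e) ^+ 2.
  rewrite avs_upd_out//.
  rewrite (_ : (fun x => _) = fun x => noises P b s (fun y => h (upd y e)) x ^+ 4).
    exact: IH.
  by apply/funext => x; rewrite /X noises_upd_out// -exprM.
apply: (posf_CS_le (avs_pos probP s w) _ _ (H a) (H c)).
  by apply: (posf_ge0 (avs_pos probP s _)) => x; exact: sqr_ge0.
by apply: (posf_ge0 (avs_pos probP s _)) => x; exact: sqr_ge0.
Qed.

Lemma noise_hypercontractive h :
  Ex (prod_prob P) (fun x => noise P b h x ^+ 4) <= nrm2 (Ex (prod_prob P)) h ^+ 2.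
Proof.
have [w _|W0] := pickP [pred w : Om | true].
  have := noises_hypercontractive h w (enum_uniq I).
  by rewrite !avs_enum.
rewrite /nrm2 /Ex big_pred0; last by move=> x; have := W0 x.
by rewrite sqr_ge0.
Qed.

End Hypercontractivity.

(** * Inverting the noise approximately *)

Section Regularization.
Context {R : realType}.

Lemma expr_small (b e : R) : 0 <= b < 1 -> 0 < e -> exists n : nat, b ^+ n <= e.
Proof.
move=> /andP[b0 b1] e0; pose x := 1 - b.
have x0 : 0 < x by rewrite subr_gt0.
have H n : b ^+ n * (1 + n%:R * x) <= 1.
  elim: n => [|n IH]; first by rewrite mul1r mul0r addr0.
  apply: le_trans IH; rewrite exprSr -mulrA ler_wpM2l ?exprn_ge0//.
  rewrite -natr1 (_ : b = 1 - x); last by rewrite /x opprB addrC subrK.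
  have : 0 <= (n%:R + 1) * x ^+ 2 by rewrite mulr_ge0 ?sqr_ge0.
  by lra.
have [n hn] : exists n : nat, (e * x)^-1 <= n%:R.
  by exists (Num.truncn (e * x)^-1).+1; rewrite ltW// Num.Theory.truncnS_gt.
exists n; have := H n.
have h2 : 1 <= e * (1 + n%:R * x).
  have : 1 <= n%:R * (e * x) by rewrite -ler_pdivrMr ?mulr_gt0// mul1r.
  by lra.
move=> h1; rewrite -(ler_pM2r (_ : 0 < 1 + n%:R * x)) ?(le_trans h1)//.
by rewrite ltr_pwDl// mulr_ge0// ltW.
Qed.

Context {I : finType} {W : I -> finType}.
Variable P : forall i, W i -> R.
Arguments P : clear implicits.
Hypothesis probP : forall i, is_prob (P i).
Local Notation Om := ({dffun forall i, W i}).
Implicit Types (w : Om) (g h f : Om -> R) (s : seq I).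
Local Notation Exp := (Ex (prod_prob P)).
Local Notation nrm := (nrm2 Exp).
Let posE : pos_functional Exp := Exp_pos probP.

(** Truncated Neumann series for the inverse of [B = noise P b]: applying [B] to it gives
    [1 - (1 - B)^m]. *)
Definition geom_op b m f : Om -> R :=
  fun w => \sum_(l < m) iter l (co (noise P b)) f w.

Lemma geom_opE b m f w :
  f w = noise P b (geom_op b m f) w + iter m (co (noise P b)) f w.
Proof.
have lB : linear_op (noise P b) by exact: noises_linear.
elim: m => [|m IH].
  rewrite /geom_op (_ : (fun w => _) = fun=> 0); last by apply/funext => x; rewrite big_ord0.
  by rewrite linear_op0// add0r.
rewrite [LHS]IH iterS.
have -> : geom_op b m.+1 f = fun w => geom_op b m f w + iter m (co (noise P b)) f w.
  by apply/funext => x; rewrite /geom_op big_ord_recr.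
set h := iter m _ f; rewrite linear_opD// /co; ring.
Qed.

(** The growth in [m] is harmless, because [m] is fixed by the parameters before the spaces and the
    functions are given. *)
Lemma nrm_geom_op b m f : 0 <= b <= 1 -> nrm (geom_op (b * b) m f) <= 4 ^+ m * nrm f.
Proof.
move=> b01; have dB := noises_damping probP (enum I) b01.
have n0 := nrm_ge0 probP f.
elim: m => [|m IH].
  rewrite /geom_op (_ : (fun w => _) = fun w => 0 * f w); last first.
    by apply/funext => x; rewrite big_ord0 mul0r.
  by rewrite nrm_scale// expr0n mul0r mul1r.
rewrite {1}/geom_op (_ : (fun w => \sum_(l < m.+1) _) =
   fun w => geom_op (b * b) m f w + iter m (co (noise P (b * b))) f w); last first.
  by apply/funext => x; rewrite big_ord_recr.
apply: le_trans (nrm2D_le posE _ _) _.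
have h1 := damping_iter_contr posE m f (damping_co posE dB).
have h2 : 1 * nrm f <= 4 ^+ m * nrm f by rewrite ler_wpM2r// exprn_ege1// ler1n.
rewrite exprS; move: IH h1; rewrite -/(noise P (b * b)); lra.
Qed.

(* Log-convexity: [|T_b h| ^ 2 = <T_(b ^ 2) h, h> <= |T_(b ^ 2) h| |h|]. *)
Lemma nrm_noise_pow b p h : nrm h <= 1 ->
  nrm (noise P b h) ^+ (2 ^ p)%N <= nrm (noise P (b ^+ (2 ^ p)%N) h).
Proof.
move=> h1; elim: p => [|p IH]; first by rewrite expn0 !expr1.
rewrite expnSr !exprM; apply: (@le_trans _ _ (nrm (noise P (b ^+ (2 ^ p)%N) h) ^+ 2)).
  by rewrite ler_pXn2r// nnegrE ?exprn_ge0// nrm_ge0.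
set c := b ^+ _.
rewrite -[in leLHS]dot_nrm /noise noises_adj// noises_mul// -expr2 dotC.
apply: le_trans (posf_CS posE _ _) _.
by rewrite ler_piMr// nrm_ge0.
Qed.

End Regularization.

Section ThirdMoment.
Context {R : realType}.

(** [M] and [H] are fixed before [g] and [s], so that their sums control all stages of the averaging
    at once. The noise of rate [b * b] is [T T] with [T = noise P b]: one [T] makes the remainder of
    the Neumann series small, the other bounds the total influence. *)
Lemma third_moment_bound (alpha b delta : R) : 0 < alpha -> 0 < b -> b < 1 -> 0 < delta ->
  exists C : R, 0 <= C /\
  forall (I : finType) (W : I -> finType) (P : forall i : I, W i -> R),
  (forall i, is_prob (P i)) -> (forall i x, 0 < P i x -> alpha <= P i x) ->
  forall f : {dffun forall i, W i} -> R, (forall w, `|f w| <= 1) ->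
  exists M H : I -> R,
  [/\ forall i, 0 <= M i, forall i, 0 <= H i, \sum_i M i <= C, \sum_i H i <= delta
    & forall i g s, (forall w, `|g w| <= 1) ->
      Ex (prod_prob P) (fun w => `|g w| * Dif P i (avs P s (noise P (b * b) f)) w ^+ 2)
      <= Num.sqrt (nrm2 (Ex (prod_prob P)) g) * M i + H i].
Proof.
move=> a0 b0 b1 d0.
have b01 : 0 <= b <= 1 by rewrite !ltW.
(* [q * q] is the rate of the strong noise [B], and the two bounds are those required by
   [noise_hypercontractive]. The exponent is a power of 2 so that [nrm_noise_pow] compares [B] with
   [T]. *)
have [p hp] : exists p : nat, b ^+ (2 ^ p.+1)%N <= Num.min 2^-1 (alpha / 2).
  have b01' : 0 <= b < 1 by rewrite ltW.
  have e0 : 0 < Num.min 2^-1 (alpha / 2) by rewrite lt_min invr_gt0 ltr0n divr_gt0.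
  have [n hn] := expr_small b01' e0.
  exists n; apply: le_trans hn; apply: ler_wiXn2l => //; try exact: ltW.
  by rewrite (leq_trans (ltnW (ltn_expl n (ltnSn 1))))// leq_exp2l.
set q := b ^+ (2 ^ p)%N.
have qq : b ^+ (2 ^ p.+1)%N = q * q by rewrite expnS mulnC exprM expr2.
have q01 : 0 <= q <= 1 by rewrite exprn_ge0 ?exprn_ile1// ltW.
rewrite qq le_min in hp; case/andP: hp => hp1 hp2.
have bb : 0 < 1 - b ^+ 2 by rewrite subr_gt0 expr_lt1// ltW.
(* For the remainder [h], [damping_co_iter] gives [|B h|^2 <= 1 / (m + 1)]; by log-convexity this
   bounds the power [2 ^ p.+1] of [|T h|^2], whence [|T h|^2 <= delta / 2 * (1 - b ^+ 2)]. *)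
have [m hm] : exists m : nat, m.+1%:R^-1 <= (delta / 2 * (1 - b ^+ 2)) ^+ (2 ^ p.+1)%N.
  have := Num.Theory.truncnS_gt ((delta / 2 * (1 - b ^+ 2)) ^+ (2 ^ p.+1)%N)^-1.
  set x := _ ^+ _ => hx; exists (Num.truncn x^-1).
  have x0 : 0 < x by rewrite exprn_gt0// mulr_gt0// divr_gt0.
  by rewrite invf_ple ?posrE// ltW.
exists (2 * (4 ^+ m / (1 - b ^+ 2))); split.
  by rewrite mulr_ge0// divr_ge0 ?exprn_ge0// ltW.
move=> I W P probP atomP f f1.
set Exp := Ex (prod_prob P).
have posE : pos_functional Exp := Exp_pos probP.
have Exp_cst c : Exp (fun=> c) = c by rewrite /Exp Ex_cst//; exact: prod_prob_is_prob.
have nrm_le1 g : (forall w, `|g w| <= 1) -> nrm2 Exp g <= 1.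
  move=> g1; rewrite -[leRHS]Exp_cst; apply: (posf_le posE) => w.
  by rewrite -real_normK ?num_real// expr_le1.
set B := noise P (q * q); set T := noise P b.
have dB : damping Exp B by exact: noises_damping.
have lB : linear_op B by case: dB.
have lT : linear_op T by exact: noises_linear.
have nf1 := nrm_le1 f f1.
(* [f = B (geom_op f) + (1 - B)^m f]: hypercontractivity of [B] bounds the
   fourth moment of the first part, and the second one is small in mean square
   by the spectral bound [damping_co_iter]. *)
pose Mo i := Dif P i (T (T (geom_op P (q * q) m f))).
pose Ho i := Dif P i (T (T (iter m (co B) f))).
exists (fun i => 2 * nrm2 Exp (Mo i)), (fun i => 2 * nrm2 Exp (Ho i)); split.
- by move=> i; rewrite mulr_ge0// nrm_ge0.
- by move=> i; rewrite mulr_ge0// nrm_ge0.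
- rewrite -mulr_sumr ler_wpM2l// ler_pdivlMr// mulrC.
  rewrite -big_enum/=; apply: le_trans (total_influence_noises probP (enum I) (T (geom_op P (q * q) m f)) b01) _.
  apply: (@le_trans _ _ (nrm2 Exp (T (geom_op P (q * q) m f)))).
    by rewrite lerBlDr lerDl nrm_ge0.
  apply: le_trans (nrm_noises_le probP _ _ b01) _.
  apply: le_trans (nrm_geom_op probP m f q01) _.
  by rewrite ler_piMr// exprn_ge0.
- rewrite -mulr_sumr -ler_pdivlMl// mulrC -(ler_pM2l bb).
  rewrite -big_enum/=; apply: le_trans (total_influence_noises probP (enum I) (T (iter m (co B) f)) b01) _.
  set h := iter m (co B) f.
  apply: (@le_trans _ _ (nrm2 Exp (T h))).
    by rewrite lerBlDr lerDl nrm_ge0.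
  have h1 : nrm2 Exp h <= 1.
    apply: le_trans nf1; apply: (damping_iter_contr posE); exact: damping_co.
  have := nrm_noise_pow probP b p.+1 h1; rewrite qq -/B -/T => h2.
  have h3 : nrm2 Exp (B h) <= m.+1%:R^-1.
    rewrite -(ler_pM2l (_ : 0 < m.+1%:R))// divff ?pnatr_eq0//.
    exact: le_trans (damping_co_iter posE m f dB) nf1.
  rewrite -(@ler_pXn2r _ (2 ^ p.+1)%N) ?expn_gt0// ?nnegrE ?nrm_ge0//.
    by apply: le_trans h2 (le_trans h3 _); rewrite mulrC.
  by rewrite ltW// mulr_gt0// divr_gt0.
move=> i g s g1.
(* Everything commutes with the noises, so [B] can be brought outermost, where hypercontractivity
   applies to it. *)
have e : Dif P i (avs P s (noise P (b * b) f)) =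
    fun w => B (avs P s (Mo i)) w + avs P s (Ho i) w.
  have -> : noise P (b * b) f = T (T f) by rewrite /T /noise noises_mul.
  have ef : f = fun w => B (geom_op P (q * q) m f) w + iter m (co B) f w.
    by apply/funext => w; rewrite -geom_opE.
  rewrite {1}ef !(linear_opD _ _ lT) (linear_opD _ _ (avs_linear P s)).
  rewrite (linear_opD _ _ (Dif_linear P i)) /Mo /Ho.
  have TB h : T (B h) = B (T h) by rewrite /T /B /noise !noises_mul// mulrC.
  by apply/funext => w; rewrite !Dif_avs_comm// !TB /B /noise Dif_noises_comm// avs_noises_comm.
rewrite e.
set X := B _; set Y := avs P s (Ho i).
apply: (@le_trans _ _ (Exp (fun w => 2 * (`|g w| * X w ^+ 2) + 2 * Y w ^+ 2))).
  apply: (posf_le posE) => w.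
  have s1 : (X w + Y w) ^+ 2 <= 2 * X w ^+ 2 + 2 * Y w ^+ 2.
    by have := sqr_ge0 (X w - Y w); lra.
  apply: le_trans (ler_wpM2l (normr_ge0 _) s1) _.
  by rewrite mulrDr mulrCA lerD2l ler_piMl ?g1// mulr_ge0// sqr_ge0.
rewrite (posfD posE) !(posfZ posE) mulrCA lerD//; last first.
  by rewrite ler_wpM2l//; exact: nrm_avs_le.
rewrite ler_wpM2l//; apply: le_trans (ler_norm _) _.
apply: (posf_CS_le posE) => //; first exact: nrm_ge0.
  rewrite sqr_sqrtr ?nrm_ge0//; apply: (posf_le posE) => w.
  by rewrite real_normK ?num_real.
have -> : (fun w => (X w ^+ 2) ^+ 2) = fun w => X w ^+ 4.
  by apply/funext => w; rewrite -exprM.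
have hq0 : 0 <= q * q by rewrite mulr_ge0; case/andP: q01.
apply: le_trans (noise_hypercontractive probP atomP hq0 _ _ _) _; try lra.
rewrite ler_pXn2r// ?nnegrE ?nrm_ge0//.
exact: nrm_avs_le.
Qed.

End ThirdMoment.

(** * Correlation and smoothing *)

Section Covariance.
Context {R : realType} {T : finType}.
Variable Q : T -> R.
Hypothesis probQ : is_prob Q.
Implicit Types (u v : T -> R).
Let posQ : pos_functional (Ex Q) := Ex_prob probQ.

Lemma CovE u v : Cov Q u v = Ex Q (fun x => u x * v x) - Ex Q u * Ex Q v.
Proof.
rewrite /Cov; transitivity (Ex Q (fun x => u x * v x - Ex Q v * u x -
    (Ex Q u * v x - Ex Q u * Ex Q v))).
  by congr Ex; apply/funext => x; ring.
rewrite !(posfB posQ) !(posfZ posQ) Ex_cst//; ring.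
Qed.

Lemma Var_ge0 u : 0 <= Var Q u.
Proof. by apply: (posf_ge0 posQ) => x; rewrite -expr2 sqr_ge0. Qed.

Lemma VarE u : Var Q u = Ex Q (fun x => (u x - Ex Q u) ^+ 2).
Proof. by rewrite /Var /Cov; congr Ex; apply/funext => x; rewrite expr2. Qed.

Lemma Cov_CS u v : Cov Q u v ^+ 2 <= Var Q u * Var Q v.
Proof. by rewrite !VarE; exact: posf_CS. Qed.

Lemma Ex_Z c u : Ex Q (fun x => c * u x) = c * Ex Q u.
Proof. exact: (posfZ posQ). Qed.

Lemma CovZl c u v : Cov Q (fun x => c * u x) v = c * Cov Q u v.
Proof.
rewrite /Cov Ex_Z -[RHS]Ex_Z; congr Ex; apply/funext => x; ring.
Qed.

Lemma CovZr c u v : Cov Q u (fun x => c * v x) = c * Cov Q u v.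
Proof.
rewrite /Cov Ex_Z -[RHS]Ex_Z; congr Ex; apply/funext => x; ring.
Qed.

Lemma VarZ c u : Var Q (fun x => c * u x) = c ^+ 2 * Var Q u.
Proof. by rewrite /Var CovZl CovZr mulrA expr2. Qed.

End Covariance.

Section Correlation.
Context {R : realType} {J : finType} {T : J -> finType}.
Local Notation X := ({dffun forall j, T j}).
Variable Q : X -> R.
Hypothesis probQ : is_prob Q.
Implicit Types (S : {set J}) (u v : X -> R) (x y : X).
Let posQ : pos_functional (Ex Q) := Ex_prob probQ.

Definition agree S x y : bool := [forall j in S, y j == x j].

Lemma agreeP S x y : reflect (forall j, j \in S -> y j = x j) (agree S x y).
Proof. by apply: (iffP forall_inP) => H j jS; have /eqP := H j jS. Qed.

Lemma agreexx S x : agree S x x.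
Proof. exact/agreeP. Qed.

Lemma agree_sym S x y : agree S x y = agree S y x.
Proof. by apply/agreeP/agreeP => H j /H. Qed.

Lemma agree_trans S x y z : agree S x y -> agree S x z = agree S y z.
Proof.
move=> /agreeP xy; apply/agreeP/agreeP => H j jS; first by rewrite H// xy.
by rewrite H// xy.
Qed.

Definition depends_on S u : Prop := forall x y, agree S x y -> u x = u y.

Lemma restrict_agree S x y : (Defs.restrict S x == Defs.restrict S y) = agree S x y.
Proof.
apply/eqP/agreeP => [/ffunP H j jS|H].
  by have := H (exist _ j jS); rewrite !ffunE.
by apply/ffunP => -[j jS]; rewrite !ffunE/= H.
Qed.

(** Brings functions on the whole product into the form over which [correlation2] takes its
    supremum; the value 0 off the range of the restriction is arbitrary. *)
Lemma depends_on_restrict S u : depends_on S u -> exists f, u = f \o Defs.restrict S.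
Proof.
move=> du; exists (fun z => if [pick x | Defs.restrict S x == z] is Some x then u x else 0).
apply/funext => x /=; case: pickP => [y|/(_ x)]; last by rewrite eqxx.
by rewrite restrict_agree => /du.
Qed.

Let cor_set S S' : set R := fun c : R =>
    exists (f : {dffun forall i : {i : J | i \in S}, T (val i)} -> R)
           (g : {dffun forall i : {i : J | i \in S'}, T (val i)} -> R),
      [/\ Var Q (f \o Defs.restrict S) = 1,
          Var Q (g \o Defs.restrict S') = 1
        & c = Cov Q (f \o Defs.restrict S) (g \o Defs.restrict S')].

Let cor_ub S S' : has_ubound (cor_set S S').
Proof.
exists 1 => c [f [g [vf vg ->]]]; apply: le_trans (ler_norm _) _.
rewrite -(@ler_pXn2r _ 2)// ?nnegrE// real_normK ?num_real//.
by apply: le_trans (Cov_CS probQ _ _) _; rewrite vf vg mulr1 expr1n.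
Qed.

Lemma Cov_normalized_le S S' u v : depends_on S u -> depends_on S' v ->
  Var Q u = 1 -> Var Q v = 1 -> Cov Q u v <= correlation2 Q S S'.
Proof.
move=> /depends_on_restrict[f ->] /depends_on_restrict[g ->] vf vg.
apply: (@ub_le_sup _ (cor_set S S')); first exact: cor_ub.
by exists f, g.
Qed.

Lemma Cov_correlation2 S S' u v : depends_on S u -> depends_on S' v ->
  `|Cov Q u v| <= correlation2 Q S S' * (Num.sqrt (Var Q u) * Num.sqrt (Var Q v)).
Proof.
move=> du dv.
have dZ c : depends_on S (fun x => c * u x) by move=> x y xy; rewrite (du x y xy).
have dZ' c : depends_on S' (fun x => c * v x) by move=> x y xy; rewrite (dv x y xy).
have := Cov_CS probQ u v.
(* A function of variance zero cannot be normalized, but then its covariances vanish by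
   Cauchy-Schwarz. *)
have [u0|u0] := eqVneq (Var Q u) 0.
  rewrite u0 mul0r sqrtr0 mul0r mulr0 => h.
  by rewrite normr_le0 -sqrf_eq0 eq_le h sqr_ge0.
have [v0|v0] := eqVneq (Var Q v) 0.
  rewrite v0 mulr0 sqrtr0 !mulr0 => h.
  by rewrite normr_le0 -sqrf_eq0 eq_le h sqr_ge0.
move=> _.
set a := Num.sqrt (Var Q u); set b := Num.sqrt (Var Q v).
have a0 : 0 < a by rewrite sqrtr_gt0 lt_def u0 (Var_ge0 probQ).
have b0 : 0 < b by rewrite sqrtr_gt0 lt_def v0 (Var_ge0 probQ).
have au : Var Q u = a ^+ 2 by rewrite sqr_sqrtr// (Var_ge0 probQ).
have bv : Var Q v = b ^+ 2 by rewrite sqr_sqrtr// (Var_ge0 probQ).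
have H c : c ^+ 2 = 1 -> c * Cov Q u v <= correlation2 Q S S' * (a * b).
  move=> c1; rewrite -ler_pdivrMr ?mulr_gt0//.
  have := Cov_normalized_le (dZ (c * a^-1)) (dZ' b^-1).
  rewrite !(VarZ probQ) au bv exprMn c1 mul1r -!exprMn !mulVf ?gt_eqF// expr1n (CovZl probQ) (CovZr probQ).
  move=> /(_ erefl erefl); apply: le_trans; rewrite le_eqVlt; apply/orP; left.
  by apply/eqP; field; rewrite !gt_eqF.
rewrite ler_norml lerNl -mulN1r H ?sqrrN ?expr1n//=.
by have := H 1; rewrite expr1n mul1r; apply.
Qed.

(** Any pair in the defining set has [|Cov|] at most the supremum; if there is none, the supremum is
    [sup set0 = 0]. *)
Lemma correlation2_ge0 S S' : 0 <= correlation2 Q S S'.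
Proof.
have [[c [f [g [vf vg e]]]]|N] := pselect (exists c, cor_set S S' c).
  have df : depends_on S (f \o Defs.restrict S).
    by move=> x y /=; rewrite -restrict_agree => /eqP ->.
  have dg : depends_on S' (g \o Defs.restrict S').
    by move=> x y /=; rewrite -restrict_agree => /eqP ->.
  have := Cov_correlation2 df dg; rewrite vf vg sqrtr1 !mulr1.
  exact: le_trans.
rewrite /correlation2 (_ : (fun c => _) = set0) ?sup0//.
by apply/seteqP; split => // c hc; apply: N; exists c.
Qed.

Lemma Cov_correlation2_sqr S S' r u v : depends_on S u -> depends_on S' v ->
  correlation2 Q S S' <= r -> Cov Q u v ^+ 2 <= r ^+ 2 * (Var Q u * Var Q v).
Proof.
move=> du dv hr.
have r0 : 0 <= r by apply: le_trans hr; exact: correlation2_ge0.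
rewrite -[_ ^+ 2]real_normK ?num_real//.
rewrite -(sqr_sqrtr (Var_ge0 probQ u)) -(sqr_sqrtr (Var_ge0 probQ v)) -!exprMn.
rewrite ler_pXn2r// ?nnegrE ?mulr_ge0// ?sqrtr_ge0//.
apply: le_trans (Cov_correlation2 du dv) _.
by rewrite ler_wpM2r ?mulr_ge0 ?sqrtr_ge0.
Qed.

(** Kernel of the conditional expectation given the coordinates in [S]. On a class of probability 0
    the quotient is 0, which does no harm since [Q] vanishes on that class. *)
Definition cond_kernel S x y : R := (agree S x y)%:R * (Q y / Pr Q (agree S x)).

Definition cond_exp S u x : R := \sum_y cond_kernel S x y * u y.

Lemma cond_exp_depends S u : depends_on S (cond_exp S u).
Proof.
move=> x x' xx'; apply: eq_bigr => y _; rewrite /cond_kernel.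
have e : agree S x =1 agree S x' by move=> z; exact: agree_trans.
by rewrite (e y) /Pr (eq_bigl _ _ e).
Qed.

Lemma Ex_cond_exp S u v : depends_on S v ->
  Ex Q (fun x => cond_exp S u x * v x) = Ex Q (fun x => u x * v x).
Proof.
move=> dv; rewrite /Ex /cond_exp.
under eq_bigr do rewrite mulr_suml mulr_sumr.
rewrite exchange_big/=; apply: eq_bigr => y _.
have Q0 : forall z, 0 <= Q z by case: probQ.
transitivity (\sum_(x | agree S y x) Q x * (Q y / Pr Q (agree S y) * u y * v y)).
  rewrite [RHS]big_mkcond; apply: eq_bigr => x _; rewrite /cond_kernel agree_sym.
  case: ifPn => [yx|_]; last by rewrite !mul0r mulr0.
  rewrite mul1r (dv _ _ yx) (_ : Pr Q (agree S x) = Pr Q (agree S y)); first by ring.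
  apply: eq_bigl => z; apply/esym; exact: agree_trans.
rewrite -mulr_suml -/(Pr Q (agree S y)).
have [e|ne] := eqVneq (Pr Q (agree S y)) 0.
  have -> : Q y = 0; last by rewrite !mul0r mulr0.
  apply: le_anti; rewrite Q0 andbT -e /Pr (bigD1 y) ?agreexx//= lerDl.
  exact: sumr_ge0.
by field.
Qed.

Lemma depends_on_cst S c : depends_on S (fun=> c).
Proof. by []. Qed.

(* [Var (E[u | S]) = Cov (u, E[u | S])], so the correlation bound applied to
   this covariance bounds the variance itself. *)
Lemma nrm_cond_exp_le S S' r u : depends_on S' u -> correlation2 Q S S' <= r ->
  Ex Q (fun x => cond_exp S u x ^+ 2) <=
  Ex Q (fun x => (r * u x + (1 - r) * Ex Q u) ^+ 2).
Proof.
move=> du hr; set v := cond_exp S u; have dv : depends_on S v by exact: cond_exp_depends.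
have Ev : Ex Q v = Ex Q u.
  have := Ex_cond_exp u (@depends_on_cst S 1).
  have e1 h : Ex Q (fun x => h x * 1) = Ex Q h.
    by congr Ex; apply/funext => x; rewrite mulr1.
  by rewrite !e1.
have Euv : Cov Q v u = Var Q v.
  rewrite /Var !(CovE probQ) Ev (Ex_cond_exp u dv); congr (_ - _).
  by congr Ex; apply/funext => x; rewrite mulrC.
have E2 h : Ex Q (fun x => h x ^+ 2) = Ex Q h ^+ 2 + Var Q h.
  rewrite /Var (CovE probQ) -expr2 addrC subrK.
  by congr Ex; apply/funext => x; rewrite expr2.
have vv : Var Q v <= r ^+ 2 * Var Q u.
  have [->|v0] := eqVneq (Var Q v) 0; first by rewrite mulr_ge0 ?sqr_ge0 ?(Var_ge0 probQ).
  have := Cov_correlation2_sqr dv du hr; rewrite Euv expr2 mulrCA ler_pM2l//.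
  by rewrite lt_def v0 (Var_ge0 probQ).
rewrite E2 Ev; apply: le_trans (_ : Ex Q u ^+ 2 + r ^+ 2 * Var Q u <= _).
  by rewrite lerD2l.
rewrite E2 le_eqVlt; apply/orP; left; apply/eqP.
have -> : Ex Q (fun x => r * u x + (1 - r) * Ex Q u) = Ex Q u.
  by rewrite (posfD posQ) (Ex_Z probQ) Ex_cst//; ring.
congr (_ + _); rewrite -(VarZ probQ) !VarE; congr Ex; apply/funext => x.
by rewrite (posfD posQ) !(Ex_Z probQ) Ex_cst//; ring.
Qed.

End Correlation.

(** * Conditioning is dominated by noise *)

Section Smoothing.
Context {R : realType} {I J : finType} {T : I -> J -> finType}.
Local Notation W := (fun i => {dffun forall j, T i j}).
Local Notation Om := ({dffun forall i, W i}).
Variable P : forall i, W i -> R.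
Arguments P : clear implicits.
Hypothesis probP : forall i, is_prob (P i).
Implicit Types (w : Om) (g h f F G : Om -> R) (s : seq I) (S : {set J}).
Local Notation Exp := (Ex (prod_prob P)).
Local Notation nrm := (nrm2 Exp).
Local Notation dot := (dotf Exp).
Let posE : pos_functional Exp := Exp_pos probP.

(** Measurability of [h] with respect to the components in [S] of the i-th point, the other points
    being frozen; all functions thus stay on the full product space. *)
Definition coord_depends i S h : Prop :=
  forall w, depends_on S (fun a : W i => h (upd w a)).

Lemma kernel_op_coord_depends i l S (K : W l -> W l -> R) h : i != l ->
  coord_depends i S h -> coord_depends i S (kernel_op K h).
Proof.
move=> il dh w a b ab; rewrite /kernel_op.
apply: eq_bigr => c _; rewrite !upd_out// ![upd (upd w _) c]upd_comm//.
by congr (_ * _); exact: dh.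
Qed.

Lemma Av_coord_depends i l S h : coord_depends i S h -> coord_depends i S (Av P l h).
Proof.
have [->|il] := eqVneq i l; first by move=> _ w a b _; rewrite !Av_upd.
by rewrite Av_kernel; exact: kernel_op_coord_depends.
Qed.

Lemma Nz_coord_depends i l S b h :
  coord_depends i S h -> coord_depends i S (Nz P l b h).
Proof.
move=> dh w x y xy; rewrite /Nz (dh w x y xy); congr (_ + _ * _).
exact: Av_coord_depends.
Qed.

Lemma noises_coord_depends i S b s h :
  coord_depends i S h -> coord_depends i S (noises P b s h).
Proof. by move=> dh; elim: s => //= l s; exact: Nz_coord_depends. Qed.

Lemma avs_coord_depends i S s h :
  coord_depends i S h -> coord_depends i S (avs P s h).
Proof. by move=> dh; elim: s => //= l s; exact: Av_coord_depends. Qed.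

Lemma co_coord_depends i S (B : (Om -> R) -> Om -> R) h :
  coord_depends i S h -> coord_depends i S (B h) -> coord_depends i S (co B h).
Proof. by move=> dh dB w x y xy; rewrite /co (dh w x y xy) (dB w x y xy). Qed.

Definition cond_op i S h : Om -> R := kernel_op (cond_kernel (P i) S) h.

Lemma cond_op_upd i S h w (a : W i) :
  cond_op i S h (upd w a) = cond_exp (P i) S (fun c => h (upd w c)) a.
Proof. by apply: eq_bigr => c _; rewrite upd_in upd_upd. Qed.

Lemma dot_cond_op i S F G : coord_depends i S G -> dot (cond_op i S F) G = dot F G.
Proof.
move=> dG; rewrite /dotf -(Exp_Av probP i) -[RHS](Exp_Av probP i).
congr Ex; apply/funext => w; rewrite /Av.
rewrite -(Ex_cond_exp (probP i) (fun c => F (upd w c)) (dG w)).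
by congr Ex; apply/funext => a; rewrite cond_op_upd.
Qed.

Lemma nrm_cond_op_le i S S' r h : coord_depends i S' h ->
  correlation2 (P i) S S' <= r -> nrm (cond_op i S h) <= nrm (Nz P i r h).
Proof.
move=> dh hr; rewrite /nrm2 -(Exp_Av probP i) -[leRHS](Exp_Av probP i).
apply: (posf_le posE) => w; rewrite /Av.
have := nrm_cond_exp_le (probP i) (dh w) hr.
rewrite /Ex; under eq_bigr do rewrite -cond_op_upd.
move=> /le_trans; apply; rewrite le_eqVlt; apply/orP; left; apply/eqP.
by apply: eq_bigr => a _; rewrite /Nz Av_upd.
Qed.

Definition cond_ops S s h : Om -> R := foldr (fun i => cond_op i S) h s.

Lemma dot_cond_ops S s F G : (forall i, coord_depends i S G) ->
  dot (cond_ops S s F) G = dot F G.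
Proof. by move=> dG; elim: s => //= i s <-; exact: dot_cond_op. Qed.

Lemma cond_ops_coord_depends i S S' s h : i \notin s ->
  coord_depends i S' h -> coord_depends i S' (cond_ops S s h).
Proof.
move=> + dh; elim: s => //= l s IH; rewrite in_cons negb_or => /andP[il /IH].
exact: kernel_op_coord_depends.
Qed.

Lemma Nz_cond_ops_comm i b S s h : i \notin s ->
  Nz P i b (cond_ops S s h) = cond_ops S s (Nz P i b h).
Proof.
elim: s => //= l s IH; rewrite in_cons negb_or => /andP[il /IH <-].
exact: Nz_kernel_comm.
Qed.

(** One coordinate at a time: the outermost conditional expectation is exchanged for noise, which
    commutes with the conditioning in the remaining coordinates and is moved onto [h]. *)
Lemma nrm_cond_ops_le S S' r s h : uniq s -> (forall i, coord_depends i S' h) ->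
  (forall i, correlation2 (P i) S S' <= r) ->
  nrm (cond_ops S s h) <= nrm (noises P r s h).
Proof.
move=> + + hr; elim: s h => //= i s IH h /andP[ils us] dh.
rewrite -!/(noises _ _ _ _) -!/(cond_ops _ _ _).
apply: le_trans (nrm_cond_op_le _ (hr i)) _.
  exact: cond_ops_coord_depends.
rewrite Nz_cond_ops_comm// Nz_noises_comm//; apply: IH => // l.
exact: Nz_coord_depends.
Qed.

Lemma noises1 s h : noises P 1 s h = h.
Proof. by elim: s => //= i s IH; rewrite -!/(noises _ _ _ _) IH Nz1. Qed.

Lemma noise_iter b l h : iter l (noise P b) h = noise P (b ^+ l) h.
Proof.
elim: l => [|l IH]; first by rewrite expr0 /noise noises1.
by rewrite iterS IH /noise noises_mul// exprS.
Qed.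

Lemma nrm_le1 g : (forall w, `|g w| <= 1) -> nrm g <= 1.
Proof.
move=> g1; rewrite -[leRHS](Ex_cst 1 (prod_prob_is_prob probP)).
apply: (posf_le posE) => w.
by rewrite -real_normK ?num_real// expr_le1.
Qed.

(** Since [G] depends on [S] only, [(1 - A) F] may be replaced by its conditional expectation given
    [S]. As the correlation is at most the rate of [A ^ l], this is dominated in norm by
    [A ^ l (1 - A) F], to which the spectral bound [1 / sqrt (l + 1)] applies. *)
Lemma smoothing_error_le b l S S' F G : 0 < b < 1 ->
  (forall i, correlation2 (P i) S S' <= (b * b) ^+ l) ->
  (forall i, coord_depends i S' F) -> (forall i, coord_depends i S G) ->
  (forall w, `|F w| <= 1) -> (forall w, `|G w| <= 1) ->
  (Exp (fun w => F w * G w) - Exp (fun w => noise P (b * b) F w * G w)) ^+ 2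
   <= l.+1%:R^-1.
Proof.
move=> /andP[b0 b1] hr dF dG F1 G1.
set A := noise P (b * b).
have dA : damping Exp A by apply: noises_damping => //; rewrite !ltW.
have -> : Exp (fun w => F w * G w) - Exp (fun w => A F w * G w) = dot (co A F) G.
  rewrite /dotf -(posfB posE); congr Ex; apply/funext => w; rewrite /co; ring.
rewrite -(dot_cond_ops (enum I) _ dG).
apply: le_trans (posf_CS posE _ _) _.
apply: (@le_trans _ _ (nrm (cond_ops S (enum I) (co A F)))).
  by rewrite ler_piMr ?nrm_le1// nrm_ge0.
apply: le_trans (nrm_cond_ops_le (enum_uniq I) _ hr) _.
  move=> i; apply: co_coord_depends => //; exact: noises_coord_depends.
rewrite -/(noise P _ _) -noise_iter -/A.
rewrite -(ler_pM2l (_ : 0 < l.+1%:R))// divff ?pnatr_eq0//.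
apply: le_trans (damping_iter_co posE l F dA) _.
exact: nrm_le1.
Qed.

End Smoothing.

Section SmoothingParameter.
Context {R : realType}.

Lemma bernoulli_le (x : R) n : 0 <= x <= 1 -> 1 - n%:R * x <= (1 - x) ^+ n.
Proof.
move=> /andP[x0 x1]; elim: n => [|n IH]; first by rewrite mul0r subr0.
rewrite exprS; apply: le_trans (_ : (1 - x) * (1 - n%:R * x) <= _).
  rewrite -natr1; have : 0 <= n%:R * x ^+ 2 by rewrite mulr_ge0 ?sqr_ge0.
  lra.
by rewrite ler_wpM2l// subr_ge0.
Qed.

Lemma smoothing_parameter (rho e : R) : 0 <= rho < 1 -> 0 < e ->
  exists (b : R) (l : nat), [/\ 0 < b, b < 1, rho <= (b * b) ^+ l & l.+1%:R^-1 <= e ^+ 2].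
Proof.
move=> /andP[r0 r1] e0.
pose l := Num.truncn (e ^+ 2)^-1.
have hl : l.+1%:R^-1 <= e ^+ 2.
  have e2 : 0 < e ^+ 2 by rewrite exprn_gt0.
  by rewrite invf_ple ?posrE// ltW// Num.Theory.truncnS_gt.
(* By Bernoulli [(1 - x) ^ (2 l) >= 1 - 2 l x >= rho]; the additional 2 in [N] keeps [x < 1] even
   for [l = 0]. *)
pose N : R := (2 * l).+2%:R; pose x := (1 - rho) / N.
have N2 : 2 <= N by rewrite /N ler_nat.
have N0 : 0 < N by lra.
have x0 : 0 < x by rewrite divr_gt0// subr_gt0.
have xN : x * N = 1 - rho by rewrite /x divfK// gt_eqF.
have x1 : x < 1 by nra.
exists (1 - x), l; split => //; [lra|lra|].
have -> : (1 - x) * (1 - x) = (1 - x) ^+ 2 by rewrite expr2.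
rewrite -exprM; apply: le_trans (bernoulli_le _ _); last by rewrite !ltW.
have : (2 * l)%:R * x <= N * x by rewrite ler_pM2r// ler_nat ltnW.
by lra.
Qed.

End SmoothingParameter.

(** * Influences and marginal product spaces *)

Section Influence.
Context {R : realType} {I : finType} {V : I -> finType}.
Variable Q : forall i, V i -> R.
Arguments Q : clear implicits.
Hypothesis probQ : forall i, is_prob (Q i).
Local Notation X := ({dffun forall i, V i}).

Lemma sum_agree_off (i : I) (x : X) (g : X -> R) :
  \sum_(y : X | [forall l, (l != i) ==> (y l == x l)]) prod_prob Q y * g y =
  (\prod_(l | l != i) Q l (x l)) * Av Q i g x.
Proof.
rewrite (reindex_onto (fun a : V i => upd x a) (fun y => y i))/=; last first.
  move=> y /forallP/= yx; apply/ffunP => l.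
  have [<-|il] := eqVneq i l; first by rewrite upd_in.
  by rewrite upd_out//; have := yx l; rewrite eq_sym il => /eqP.
rewrite /Av /Ex mulr_sumr; apply: eq_big => [a|a _].
  rewrite upd_in eqxx andbT; apply/forallP => l; apply/implyP => li.
  by rewrite upd_out// eq_sym.
rewrite /prod_prob (bigD1 i)//= upd_in (eq_bigr (fun l => Q l (x l))).
  by ring.
by move=> l li; rewrite upd_out// eq_sym.
Qed.

Lemma influenceE (i : I) (f : X -> R) :
  influence Q i f = nrm2 (Ex (prod_prob Q)) (Dif Q i f).
Proof.
rewrite /influence /nrm2 -[RHS](Exp_Av probQ i); apply: eq_bigr => x _.
rewrite /cond_Var /cond_Ex !sum_agree_off.
have -> : Pr (prod_prob Q) (fun y : X => [forall l, (l != i) ==> (y l == x l)]) =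
    \prod_(l | l != i) Q l (x l).
  have := sum_agree_off i x (fun=> 1); rewrite Av_cst// mulr1 => <-.
  by apply: eq_bigr => y _; rewrite mulr1.
set q := \prod_(l | _) _.
(* If the conditioning event has probability zero, the outer weight of [x] vanishes as well. *)
have [q0|q0] := eqVneq q 0.
  by rewrite /prod_prob (bigD1 i)//= -/q q0 mulr0 !mul0r.
rewrite mulrAC divff// mul1r mulrAC divff// mul1r; congr (_ * _).
by rewrite /Av; congr Ex; apply/funext => a; rewrite /Dif /co Av_upd.
Qed.

End Influence.

Section Coordinates.
Context {R : realType} {n k : nat} {Omega : 'I_n -> 'I_k -> finType}.
Local Notation W := (fun i => {dffun forall j, Omega i j}).
Local Notation Om := ({dffun forall i, W i}).
Variable P : forall i, W i -> R.
Arguments P : clear implicits.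
Hypothesis probP : forall i, is_prob (P i).
Variable j : 'I_k.
Local Notation Q := (fun l : 'I_n => marginal (P l) j).

Lemma Ex_marginal (l : 'I_n) (g : Omega l j -> R) :
  Ex (P l) (fun a => g (a j)) = Ex (Q l) g.
Proof.
rewrite /Ex /marginal /Pr (partition_big (fun a : W l => a j) predT)//=.
apply: eq_bigr => x _; rewrite mulr_suml; apply: eq_bigr => a /eqP ax.
by rewrite ax.
Qed.

Lemma marginal_prob (l : 'I_n) : is_prob (Q l).
Proof.
split=> [x|]; first by apply: sumr_ge0 => a _; case: (probP l).
have := Ex_marginal (l := l) (fun=> 1); rewrite Ex_cst// /Ex => ->.
by apply: eq_bigr => x _; rewrite mulr1.
Qed.

Lemma coordinates_upd (w : Om) i (a : W i) :
  coordinates j (upd w a) = upd (coordinates j w) (a j).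
Proof.
apply/ffunP => l; rewrite !ffunE.
by have [<-|il] := eqVneq i l; rewrite ?eqtype.dfwith_in// !eqtype.dfwith_out// ffunE.
Qed.

Lemma Av_coordinates i h :
  Av P i (h \o @coordinates n k Omega j) = Av Q i h \o @coordinates n k Omega j.
Proof.
apply/funext => w; rewrite /Av /= -Ex_marginal; congr Ex; apply/funext => a /=.
by rewrite coordinates_upd.
Qed.

Lemma avs_coordinates s h :
  avs P s (h \o @coordinates n k Omega j) = avs Q s h \o @coordinates n k Omega j.
Proof.
by elim: s => //= i s IH; rewrite -!/(avs _ _ _) IH Av_coordinates.
Qed.

(** On either space, averaging out all coordinates turns a function into its mean, so the
    intertwining relation [avs_coordinates] identifies the image law with the product of the
    marginals. *)
Lemma Ex_coordinates h :
  Ex (prod_prob P) (h \o @coordinates n k Omega j) = Ex (prod_prob Q) h.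
Proof.
have [w _|W0] := pickP [pred w : Om | true].
  have := congr1 (fun g => g w) (avs_coordinates (enum 'I_n) h) => /=.
  by rewrite !avs_enum//; exact: marginal_prob.
have := sum_prod_prob probP; rewrite big_pred0; last by move=> w; have := W0 w.
by move=> /eqP; rewrite eq_sym oner_eq0.
Qed.

Lemma influence_coordinates i h :
  influence Q i h = nrm2 (Ex (prod_prob P)) (Dif P i (h \o @coordinates n k Omega j)).
Proof.
rewrite influenceE; last exact: marginal_prob.
rewrite /nrm2 -Ex_coordinates; congr Ex; apply/funext => w /=.
by rewrite /Dif /co Av_coordinates.
Qed.

Lemma coordinates_coord_depends i (h : {dffun forall i, Omega i j} -> R) :
  coord_depends i [set j] (h \o @coordinates n k Omega j).
Proof.
move=> w a b /agreeP ab /=; rewrite !coordinates_upd.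
by rewrite (ab j)// inE.
Qed.

End Coordinates.

(** * Products of s-wise independent functions *)

Section WiseIndependence.
Context {R : realType} {J : finType} {T : J -> finType}.
Local Notation X := ({dffun forall j, T j}).
Variable Q : X -> R.
Hypothesis probQ : is_prob Q.
Implicit Types (S : {set J}) (v : J -> X -> R) (x y : X).
Let posQ : pos_functional (Ex Q) := Ex_prob probQ.

Lemma depends_on_sum j (u : X -> R) : depends_on [set j] u ->
  exists c : T j -> R, forall x, u x = \sum_b c b * (x j == b)%:R.
Proof.
move=> du; exists (fun b => if [pick x : X | x j == b] is Some x then u x else 0) => x.
rewrite (bigD1 (x j))//= eqxx mulr1 big1 ?addr0; last first.
  by move=> b; rewrite eq_sym => /negbTE ->; rewrite mulr0.
case: pickP => [y /eqP yx|/(_ x)]; last by rewrite eqxx.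
by apply: du; apply/agreeP => l; rewrite inE => /eqP ->.
Qed.

(** Independence is defined by events and passes to functions by multilinearity. The list [r] holds
    the indices whose factor is not yet known to be an indicator, a property written
    [w j x = (w j x != 0)%:R]; each step expands one factor over the values of its coordinate. *)
Lemma wise_independent_prod s S v : wise_independent Q s -> (#|S| <= s)%N ->
  (forall j, depends_on [set j] (v j)) ->
  Ex Q (fun x => \prod_(j in S) v j x) = \prod_(j in S) Ex Q (v j).
Proof.
move=> indQ Ss.
suff H (r : seq J) w : (forall j, depends_on [set j] (w j)) ->
   (forall j, j \in S -> j \notin r -> forall x, w j x = (w j x != 0)%:R) ->
   Ex Q (fun x => \prod_(j in S) w j x) = \prod_(j in S) Ex Q (w j).
  by move=> dv; apply: (H (enum J) v dv) => j _; rewrite mem_enum.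
elim: r w => [|j r IH] w dw bw.
  pose A j : {set T j} := [set b | [exists x : X, (x j == b) && (w j x != 0)]].
  have wA j x : j \in S -> w j x = (x j \in A j)%:R.
    move=> jS; rewrite bw//; congr (nat_of_bool _)%:R; rewrite inE.
    apply/idP/existsP => [wx|[y /andP[/eqP yx wy]]]; first by exists x; rewrite eqxx.
    rewrite (dw j x y)//; apply/agreeP => l; rewrite inE => /eqP ->.
    exact: yx.
  have PrE (B : pred X) : Pr Q B = Ex Q (fun x => (B x)%:R).
    rewrite /Pr /Ex big_mkcond; apply: eq_bigr => x _.
    by case: (B x); rewrite ?mulr1 ?mulr0.
  transitivity (Pr Q (fun x => [forall j in S, x j \in A j])).
    rewrite PrE; congr Ex; apply/funext => x.
    under eq_bigr => j jS do rewrite wA//.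
    case: (boolP [forall j in S, x j \in A j]) => [/forall_inP H|].
      by rewrite big1// => j jS; rewrite H.
    rewrite negb_forall => /existsP[j]; rewrite negb_imply => /andP[jS /negbTE xA].
    by rewrite (bigD1 j)//= xA mul0r.
  rewrite indQ//; apply: eq_bigr => j jS; rewrite PrE; congr Ex.
  by apply/funext => x; rewrite wA.
have [jS|jS] := boolP (j \in S); last first.
  apply: IH => // l lS lr; apply: bw => //; rewrite in_cons negb_or lr andbT.
  by apply: contraNneq jS => <-.
have [c wc] := depends_on_sum (dw j).
pose w' b l x : R := if l == j then (if x j == b then 1 else 0) else w l x.
have dw' b l : depends_on [set l] (w' b l).
  move=> x y /agreeP xy; rewrite /w'; case: eqP => [e|_].
    by subst l; rewrite xy// inE.
  by apply: dw; apply/agreeP.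
have IHb b : Ex Q (fun x => \prod_(l in S) w' b l x) = \prod_(l in S) Ex Q (w' b l).
  apply: IH => // l lS lr x; rewrite /w'.
  case: eqP => [_|/eqP lj]; first by case: (x j == b); rewrite ?oner_eq0 ?eqxx.
  by apply: bw => //; rewrite in_cons negb_or lj.
have E1 : Ex Q (w j) = \sum_b c b * Ex Q (w' b j).
  rewrite (_ : w j = fun x => \sum_b c b * (w' b j) x).
    by rewrite (posf_sum posQ); apply: eq_bigr => b _; rewrite (posfZ posQ).
  apply/funext => x; rewrite wc; apply: eq_bigr => b _; rewrite /w' eqxx.
  by case: eqP.
rewrite [RHS](bigD1 j)//= E1 mulr_suml.
transitivity (\sum_b c b * Ex Q (fun x => \prod_(l in S) w' b l x)).
  rewrite -(eq_bigr _ (fun b _ => posfZ posQ _ _)) -(posf_sum posQ).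
  congr Ex; apply/funext => x; rewrite (bigD1 j)//= wc mulr_suml.
  apply: eq_bigr => b _; rewrite [in RHS](bigD1 j)//= {1}/w' eqxx mulrA.
  congr (_ * _ * _); first by case: eqP.
  by apply: eq_bigr => l /andP[_ lj]; rewrite /w' (negbTE lj).
apply: eq_bigr => b _; rewrite IHb (bigD1 j)//= mulrA; congr (_ * _).
apply: eq_bigr => l /andP[_ lj]; congr Ex; apply/funext => x.
by rewrite /w' (negbTE lj).
Qed.

Lemma wise_independent_centered s S v : wise_independent Q s -> (#|S| <= s)%N ->
  (0 < #|S|)%N -> (forall j, depends_on [set j] (v j)) ->
  Ex Q (fun x => \prod_(j in S) (v j x - Ex Q (v j))) = 0.
Proof.
move=> indQ Ss /card_gt0P[j jS] dv.
rewrite (@wise_independent_prod s S (fun j x => v j x - Ex Q (v j)))//; last first.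
  by move=> l x y xy; rewrite (dv l x y xy).
by rewrite (bigD1 j)//= (posfB posQ) Ex_cst// subrr mul0r.
Qed.

Lemma uncorrelated_centered (j l : J) (u v : X -> R) : correlation2 Q [set j] [set l] = 0 ->
  depends_on [set j] u -> depends_on [set l] v ->
  Ex Q (fun x => (u x - Ex Q u) * (v x - Ex Q v)) = 0.
Proof.
move=> c0 du dv; have := Cov_correlation2_sqr probQ du dv (lexx _).
rewrite c0 expr0n mul0r => h.
by apply/eqP; rewrite -sqrf_eq0 eq_le h sqr_ge0.
Qed.

End WiseIndependence.

Section ProductReplacement.
Context {R : realType} {I J : finType} {T : I -> J -> finType}.
Local Notation W := (fun i => {dffun forall j, T i j}).
Local Notation Om := ({dffun forall i, W i}).
Variable P : forall i, W i -> R.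
Arguments P : clear implicits.
Hypothesis probP : forall i, is_prob (P i).
Implicit Types (w : Om) (F G : J -> Om -> R) (s : nat) (S B : {set J}).
Local Notation Exp := (Ex (prod_prob P)).
Let posE : pos_functional Exp := Exp_pos probP.

Lemma Dif_norm_le1 i (g : Om -> R) : (forall w, 0 <= g w <= 1) ->
  forall w, `|Dif P i g w| <= 1.
Proof.
move=> g01 w; have /andP[g0 g1] := g01 w.
have /andP[a0 a1] : 0 <= Av P i g w <= 1 by exact: (avs_range probP [:: i] g01).
by rewrite /Dif /co ler_norml; apply/andP; split; lra.
Qed.

(** Expand [\prod_j (D j + A j)] over subsets [S]. A nonempty term vanishes for [#|S| <= s] by
    independence, for [#|S| = 1] by centering and for [#|S| = 2] by the zero correlations. Any other
    [S] has at least three elements and more than [#|B|], hence an element [j] outside [B] and two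
    further ones. *)
Lemma Av_step_le i s B G (c : J -> R) :
  (forall j w, 0 <= G j w <= 1) ->
  (forall j, coord_depends i [set j] (G j)) ->
  (forall j l, j != l -> correlation2 (P i) [set j] [set l] = 0) ->
  wise_independent (P i) s -> (#|B| <= s)%N -> (forall l, 0 <= c l) ->
  (forall j l, j \notin B ->
     Exp (fun w => `|Dif P i (G j) w| * Dif P i (G l) w ^+ 2) <= c l) ->
  `|Exp (fun w => \prod_j G j w) - Exp (fun w => \prod_j Av P i (G j) w)|
  <= #|{set J}|%:R * \sum_l c l.
Proof.
move=> G01 dG cor0 indP Bs c0 cB.
pose D j w := Dif P i (G j) w; pose A j w := Av P i (G j) w.
pose term S w : R := \prod_j (if j \in S then D j w else A j w).
have D1 j w : `|D j w| <= 1 by exact: Dif_norm_le1.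
have A1 j w : `|A j w| <= 1.
  have /andP[a0 a1] := avs_range probP [:: i] (G01 j) w.
  by rewrite /A; change (avs P [:: i] (G j) w) with (Av P i (G j) w) in a0, a1; rewrite ger0_norm.
have -> : Exp (fun w => \prod_j G j w) = \sum_(S in {set J}) Exp (term S).
  rewrite -(posf_sum posE); congr Ex; apply/funext => w.
  under eq_bigr => j _.
    rewrite (_ : G j w = D j w + A j w); last by rewrite /D /Dif /co subrK.
    over.
  by rewrite bigA_distr.
rewrite (bigD1 finset.set0)//= (_ : Exp (term finset.set0) = Exp (fun w => \prod_j Av P i (G j) w)); last first.
  by congr Ex; apply/funext => w; apply: eq_bigr => j _; rewrite inE.
rewrite [X in `|X|](_ : _ = \sum_(S | S != finset.set0) Exp (term S)); last by rewrite addrAC subrr add0r.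
have vanish S :
    (forall w, Ex (P i) (fun a => \prod_(j in S) (G j (upd w a) -
        Ex (P i) (fun b => G j (upd w b)))) = 0) -> Exp (term S) = 0.
  move=> H; rewrite -(Exp_Av probP i).
  rewrite (_ : Av P i (term S) = fun=> 0).
    by rewrite Ex_cst//; exact: prod_prob_is_prob.
  have -> : term S = fun w => (\prod_(j | j \notin S) A j w) * \prod_(j in S) D j w.
    apply/funext => w; rewrite /term (bigID (mem S))/= mulrC; congr (_ * _).
      by apply: eq_bigr => j /negbTE ->.
    by apply: eq_bigr => j ->.
  rewrite Av_mul//; last first.
    by move=> w a; apply: eq_bigr => j _; rewrite /A Av_upd.
  apply/funext => w; rewrite /Av (_ : Ex _ _ = 0) ?mulr0// -[RHS](H w).
  by congr Ex; apply/funext => a; apply: eq_bigr => j _; rewrite /D /Dif /co Av_upd.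
have c_ge0 : 0 <= \sum_l c l by apply: sumr_ge0.
have bound S : S != finset.set0 -> `|Exp (term S)| <= \sum_l c l.
  move=> S0; have cS : (0 < #|S|)%N by rewrite finset.card_gt0.
  have [Ss|sS] := leqP #|S| s.
    rewrite vanish ?normr0// => w.
    by apply: (wise_independent_centered (probP i) indP Ss cS) => j; exact: dG.
  have [S1|S1] := eqVneq #|S| 1%N.
    rewrite vanish ?normr0// => w; move/eqP/cards1P: S1 => [j ->].
    rewrite (_ : (fun a => _) = fun a => G j (upd w a) - Ex (P i) (fun b => G j (upd w b))).
      by rewrite (posfB (Ex_prob (probP i))) Ex_cst// subrr.
    by apply/funext => a; rewrite big_set1.
  have [S2|S2] := eqVneq #|S| 2%N.
    rewrite vanish ?normr0// => w; move/eqP/cards2P: S2 => [j [l [jl ->]]].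
    rewrite -(uncorrelated_centered (probP i) (cor0 _ _ jl) (dG j w) (dG l w)).
    congr Ex; apply/funext => a; rewrite big_setU1 ?inE//= big_set1.
    by [].
  have [j jS jB] : exists2 j, j \in S & j \notin B.
    apply/subsetPn; apply/negP => /subset_leq_card; rewrite leqNgt.
    by rewrite (leq_ltn_trans Bs).
  have /card_gt1P[m1 [m2 [m1S m2S m12]]] : (1 < #|S :\ j|)%N.
    have e : #|S| = #|S :\ j|.+1 by rewrite (cardsD1 j S) jS.
    by move: S1 S2; rewrite e; case: #|S :\ j| => [|[|m]].
  move: m1S m2S; rewrite !inE => /andP[m1j m1S] /andP[m2j m2S].
  apply: le_trans (posf_norm posE _) _.
  apply: (@le_trans _ _ (Exp (fun w => \sum_l `|D j w| * D l w ^+ 2))); last first.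
    rewrite (posf_sum posE); apply: ler_sum => l _; exact: cB.
  apply: (posf_le posE) => w; rewrite -mulr_sumr /term normr_prod.
  have h01 l : 0 <= `|if l \in S then D l w else A l w| <= 1.
    by rewrite normr_ge0; case: ifP => _; [exact: D1|exact: A1].
  rewrite (bigD1 j)//= jS ler_wpM2l//.
  rewrite (bigD1 m1)//= m1S (bigD1 m2)/=; last by rewrite m2j eq_sym.
  rewrite m2S; set p := \prod_(l | _) _.
  have p1 : p <= 1 by apply: prodr_ile1 => l _.
  have p0 : 0 <= p by apply: prodr_ge0 => l _.
  rewrite (bigD1 m1)//= (bigD1 m2)/=; last by rewrite eq_sym.
  set q := \sum_(l | _) _; have q0 : 0 <= q by apply: sumr_ge0 => l _; exact: sqr_ge0.
  rewrite -(real_normK (num_real (D m1 w))) -(real_normK (num_real (D m2 w))).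
  have := normr_ge0 (D m1 w); have := normr_ge0 (D m2 w).
  move: `|D m1 w| `|D m2 w| => x y y0 x0.
  have xy : 0 <= x * y by exact: mulr_ge0.
  have : x * y * p <= x * y * 1 by rewrite ler_wpM2l.
  by rewrite -mulrA; have := sqr_ge0 (x - y); lra.
apply: le_trans (ler_norm_sum _ _ _) _.
apply: (@le_trans _ _ (\sum_(S in {set J}) \sum_l c l)).
  by rewrite big_mkcond; apply: ler_sum => S _; case: ifP => // /bound.
by rewrite sumr_const mulr_natl.
Qed.

End ProductReplacement.

Section Telescope.
Context {R : realType} {I : finType}.

(** [e i] has to bound the step at [i] whatever coordinates were averaged before it. *)
Lemma telescope_seq (Phi : seq I -> R) (e : I -> R) (s : seq I) :
  (forall i r, Phi r <= Phi (i :: r) + e i) -> Phi [::] <= Phi s + \sum_(i <- s) e i.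
Proof.
move=> H; elim: s => [|i s IH]; first by rewrite big_nil addr0.
by rewrite big_cons; have := H i s; lra.
Qed.

Lemma telescope_seq_norm (Phi : seq I -> R) (e : I -> R) (s : seq I) :
  (forall i r, `|Phi r - Phi (i :: r)| <= e i) -> `|Phi [::] - Phi s| <= \sum_(i <- s) e i.
Proof.
move=> H; rewrite ler_norml; apply/andP; split.
  have := @telescope_seq (fun r => - Phi r) e s; rewrite -subr_ge0 opprK.
  have H1 i r : - Phi r <= - Phi (i :: r) + e i by have := H i r; rewrite ler_norml; lra.
  by move=> /(_ H1); lra.
have H1 i r : Phi r <= Phi (i :: r) + e i by have := H i r; rewrite ler_norml; lra.
by have := @telescope_seq Phi e s H1; lra.
Qed.

End Telescope.

Section SmoothingProducts.
Context {R : realType} {I J : finType} {T : I -> J -> finType}.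
Local Notation W := (fun i => {dffun forall j, T i j}).
Local Notation Om := ({dffun forall i, W i}).
Variable P : forall i, W i -> R.
Arguments P : clear implicits.
Hypothesis probP : forall i, is_prob (P i).
Local Notation Exp := (Ex (prod_prob P)).
Let posE : pos_functional Exp := Exp_pos probP.

Lemma coord_dependsW i (S S' : {set J}) (h : Om -> R) : S \subset S' ->
  coord_depends i S h -> coord_depends i S' h.
Proof.
move=> /fintype.subsetP SS' dh w x y /agreeP xy; apply: dh; apply/agreeP => j /SS'.
exact: xy.
Qed.

Lemma smoothing_error b l e S S' (F G : Om -> R) : 0 < b < 1 -> 0 <= e ->
  l.+1%:R^-1 <= e ^+ 2 -> (forall i, correlation2 (P i) S S' <= (b * b) ^+ l) ->
  (forall i, coord_depends i S' F) -> (forall i, coord_depends i S G) ->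
  (forall w, `|F w| <= 1) -> (forall w, `|G w| <= 1) ->
  `|Exp (fun w => F w * G w) - Exp (fun w => noise P (b * b) F w * G w)| <= e.
Proof.
move=> b01 e0 le hr dF dG F1 G1.
rewrite -(@ler_pXn2r _ 2)// ?nnegrE// real_normK ?num_real//.
exact: le_trans (smoothing_error_le probP b01 hr dF dG F1 G1) le.
Qed.

(** The factors are smoothed one after the other, [r] listing those already done. The product of the
    others depends on the components different from [j], which is where the correlation of one space
    with all the others enters. *)
Lemma smoothing_prod_error b l e (F : J -> Om -> R) : 0 < b < 1 -> 0 <= e ->
  l.+1%:R^-1 <= e ^+ 2 ->
  (forall i j, correlation2 (P i) (~: [set j]) [set j] <= (b * b) ^+ l) ->
  (forall i j, coord_depends i [set j] (F j)) -> (forall j w, 0 <= F j w <= 1) ->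
  `|Exp (fun w => \prod_j F j w) - Exp (fun w => \prod_j noise P (b * b) (F j) w)|
  <= #|J|%:R * e.
Proof.
move=> b01 e0 le hr dF F01.
have bb01 : 0 <= b * b <= 1.
  by case/andP: b01 => b0 b1; rewrite mulr_ge0 ?mulr_ile1 ?ltW.
pose G (r : seq J) j := if j \in r then noise P (b * b) (F j) else F j.
have G01 (r : seq J) j w : 0 <= G r j w <= 1.
  by rewrite /G; case: ifP => _ //; apply: noises_range => // ?; exact: F01.
have dG i (r : seq J) j : coord_depends i [set j] (G r j).
  by rewrite /G; case: ifP => _ //; apply: noises_coord_depends; exact: dF.
have step j (r : seq J) : `|Exp (fun w => \prod_l G r l w) - Exp (fun w => \prod_l G (j :: r) l w)| <= e.
  have [jr|jr] := boolP (j \in r).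
    rewrite (_ : G (j :: r) = G r) ?subrr ?normr0//.
    by apply/funext => l'; rewrite /G in_cons; case: eqP => // ->; rewrite jr.
  pose H w := \prod_(l' | l' != j) G r l' w.
  have -> : (fun w => \prod_l' G r l' w) = fun w => F j w * H w.
    by apply/funext => w; rewrite (bigD1 j)//= {1}/G (negbTE jr).
  have -> : (fun w => \prod_l' G (j :: r) l' w) = fun w => noise P (b * b) (F j) w * H w.
    apply/funext => w; rewrite (bigD1 j)//= {1}/G in_cons eqxx/=; congr (_ * _).
    by apply: eq_bigr => l' lj; rewrite /G in_cons (negbTE lj).
  apply: (smoothing_error b01 e0 le (fun i => hr i j)) => //.
  - move=> i w x y xy; apply: eq_bigr => l' lj.
    apply: (coord_dependsW _ (@dG i r l')) xy.
    by apply/fintype.subsetP => m; rewrite !inE => /eqP ->.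
  - by move=> w; have /andP[F0 F1] := F01 j w; rewrite ger0_norm.
  - move=> w; rewrite ger0_norm; first by apply: prodr_ile1 => l' _; exact: G01.
    by apply: prodr_ge0 => l' _; case/andP: (G01 r l' w).
have := telescope_seq_norm (enum J) step.
rewrite big_const_seq count_predT -cardE iter_addr_0 mulr_natl.
rewrite (_ : (fun w => \prod_l0 G (enum J) l0 w) = fun w => \prod_j noise P (b * b) (F j) w).
  by [].
by apply/funext => w; apply: eq_bigr => j _; rewrite /G mem_enum.
Qed.

End SmoothingProducts.

Section WiseIndependentProducts.
Context {R : realType}.

Lemma wise_independent_product_bound (k : nat) (eps alpha rho : R) :
  0 < eps -> 0 < alpha -> 0 <= rho -> rho < 1 ->
  exists tau : R, 0 < tau /\
  forall (I : finType) (T : I -> 'I_k -> finType)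
    (P : forall i, {dffun forall j, T i j} -> R),
  (forall i, is_prob (P i)) -> (forall i x, 0 < P i x -> alpha <= P i x) ->
  (forall i j, correlation2 (P i) (~: [set j]) [set j] <= rho) ->
  forall (F : 'I_k -> {dffun forall i, {dffun forall j, T i j}} -> R) (s : nat),
  (forall j w, 0 <= F j w <= 1) -> (forall i j, coord_depends i [set j] (F j)) ->
  (forall i j l, j != l -> correlation2 (P i) [set j] [set l] = 0) ->
  (forall i, wise_independent (P i) s) ->
  (forall i, (#|[set j : 'I_k | (tau < nrm2 (Ex (prod_prob P)) (Dif P i (F j)))%R]| <= s)%N) ->
  `|Ex (prod_prob P) (fun w => \prod_j F j w) - \prod_j Ex (prod_prob P) (F j)| <= eps.
Proof.
move=> eps0 alpha0 rho0 rho1.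
pose K : R := k%:R; pose N : R := #|{set 'I_k}|%:R.
have K0 : 0 <= K by exact: ler0n.
have N0 : 0 <= N by exact: ler0n.
(* The denominator [y + 1] covers [y = 0]. Budget: half of [eps] for smoothing, a quarter for the
   sums of [H] and a quarter for those of [M]. *)
have frac (x y : R) : 0 < x -> 0 <= y -> 0 < x / (y + 1) /\ y * (x / (y + 1)) <= x.
  move=> x0 y0; have y1 : 0 < y + 1 by lra.
  split; first exact: divr_gt0.
  by rewrite mulrCA ger_pMr// ler_pdivrMr// mul1r; lra.
have [e0 He] := frac (eps / 2) K ltac:(lra) K0; set e := eps / 2 / (K + 1) in e0 He.
have [|b [l [b0 b1 hb hl]]] := @smoothing_parameter R rho e _ e0; first by rewrite rho0.
have b01 : 0 < b < 1 by rewrite b0.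
have NK0 : 0 <= N * K by exact: mulr_ge0.
have [d0 Hd] := frac (eps / 4) (N * K) ltac:(lra) NK0; set d := eps / 4 / (N * K + 1) in d0 Hd.
have [C [C0 HC]] := third_moment_bound alpha0 b0 b1 d0.
have NKC0 : 0 <= N * K * C by exact: mulr_ge0.
have [t0 Ht] := frac (eps / 4) (N * K * C) ltac:(lra) NKC0; set t := eps / 4 / (N * K * C + 1) in t0 Ht.
(* Influences are squared norms: one of size at most [t ^+ 2] contributes at most [t] through the
   square root in [third_moment_bound]. *)
exists (t ^+ 2); split; first by rewrite exprn_gt0.
move=> I T P probP atomP corP F s F01 dF cor0 indP hB.
set Exp := Ex (prod_prob P).
pose Fs j := noise P (b * b) (F j).
have bb01 : 0 <= b * b <= 1 by rewrite mulr_ge0 ?mulr_ile1 ?ltW.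
have Fs01 j w : 0 <= Fs j w <= 1 by apply: noises_range => // ?; exact: F01.
have corP' i j : correlation2 (P i) (~: [set j]) [set j] <= (b * b) ^+ l.
  exact: le_trans (corP i j) hb.
have := smoothing_prod_error probP b01 (ltW e0) hl corP' dF F01.
rewrite card_ord -/K -/Exp => sm.
have F1 j w : `|F j w| <= 1 by have /andP[? ?] := F01 j w; rewrite ger0_norm.
have := fun j => HC I _ P probP atomP (F j) (F1 j) => /choice[M] /choice[H] HMH.
pose B i := [set j : 'I_k | (t ^+ 2 < nrm2 Exp (Dif P i (F j)))%R].
pose c i j := t * M j i + H j i.
have step i (r : seq I) : `|Exp (fun w => \prod_j avs P r (Fs j) w) -
    Exp (fun w => \prod_j avs P (i :: r) (Fs j) w)| <= N * \sum_j c i j.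
  apply: (Av_step_le probP (s := s) (B := B i)) => //.
  - by move=> j w; apply: (avs_range probP) => ?; exact: Fs01.
  - by move=> j; apply: avs_coord_depends; apply: noises_coord_depends; exact: dF.
  - by move=> j l'; exact: cor0.
  - exact: hB.
  - by move=> j; have [M0 H0 _ _ _] := HMH j; rewrite addr_ge0// mulr_ge0// ltW.
  move=> j l' jB; have [M0 H0 _ _ HM] := HMH l'.
  apply: le_trans (HM i (Dif P i (avs P r (Fs j))) r _) _.
    by apply: Dif_norm_le1 => // ?; apply: (avs_range probP) => ?; exact: Fs01.
  rewrite lerD2r ler_wpM2r// -[leRHS]ger0_norm ?(ltW t0)// -sqrtr_sqr ler_sqrt ?sqr_ge0//.
  apply: le_trans (_ : nrm2 Exp (Dif P i (F j)) <= _); last first.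
    by move: jB; rewrite inE -leNgt.
  rewrite Dif_avs_comm; apply: le_trans (nrm_avs_le probP _ _) _.
  by rewrite /Fs /noise Dif_noises_comm; exact: nrm_noises_le.
have := telescope_seq_norm (enum I) step.
rewrite (_ : Exp (fun w => \prod_j avs P (enum I) (Fs j) w) = \prod_j Exp (F j)); last first.
  rewrite (_ : (fun w => _) = fun=> \prod_j Exp (F j)).
    by rewrite /Exp Ex_cst//; exact: prod_prob_is_prob.
  by apply/funext => w; apply: eq_bigr => j _; rewrite avs_enum// /Fs /noise Exp_noises.
rewrite big_enum/= -mulr_sumr exchange_big/= => tel.
have sumc : \sum_j \sum_i c i j <= K * (t * C + d).
  apply: (@le_trans _ _ (\sum_(j < k) (t * C + d))).
    apply: ler_sum => j _; have [_ _ hM hH _] := HMH j.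
    by rewrite big_split/= -mulr_sumr lerD// ler_wpM2l// ltW.
  by rewrite sumr_const card_ord mulr_natl.
have NS : N * \sum_j \sum_i c i j <= N * (K * (t * C + d)) by rewrite ler_wpM2l.
have -> : Exp (fun w => \prod_j F j w) - \prod_j Exp (F j) =
  (Exp (fun w => \prod_j F j w) - Exp (fun w => \prod_j Fs j w)) +
  (Exp (fun w => \prod_j Fs j w) - \prod_j Exp (F j)) by ring.
apply: le_trans (ler_normD _ _) _.
by move: sm tel NS Hd Ht He; rewrite -!/(Fs _) /=; lra.
Qed.

End WiseIndependentProducts.

(** * Gaussian stability *)

Section GaussianMeasure.
Import numFieldTopology.Exports numFieldNormedType.Exports.
Context {R : realType}.
Local Open Scope classical_set_scope.
Local Open Scope ereal_scope.
Local Notation mu := (@lebesgue_measure R).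
Local Notation gauss := (normal_prob (0 : R) 1).
Implicit Types (m s : R) (a b : \bar R).

(** The Radon-Nikodym derivative and [normal_pdf] have the same integral over every measurable set,
    so they agree almost everywhere. *)
Lemma integral_normal_prob m s (E : set (measurableTypeR R)) (f : measurableTypeR R -> \bar R) :
  measurable E -> measurable_fun E f -> (forall x, 0 <= f x) ->
  \int[normal_prob m s]_(x in E) f x =
  \int[mu]_(x in E) (f x * (normal_pdf m s x)%:E).
Proof.
move=> mE mf f0.
pose nu : {finite_measure set (measurableTypeR R) -> \bar R} := normal_prob m s.
have dom : nu `<< mu by exact: normal_prob_dominates.
rewrite -(Radon_Nikodym_SigmaFinite.change_of_variables (nu := nu) dom f0 mE mf).
have mp : measurable_fun setT (fun x => (normal_pdf m s x)%:E).
  by apply/measurable_EFinP; exact: measurable_normal_pdf.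
have mg : measurable_fun setT (Radon_Nikodym_SigmaFinite.f nu mu).
  exact: measurable_int (Radon_Nikodym_SigmaFinite.f_integrable dom).
have ae : ae_eq mu setT (Radon_Nikodym_SigmaFinite.f nu mu)
    (fun x => (normal_pdf m s x)%:E).
  apply: integral_ae_eq => //.
    exact: Radon_Nikodym_SigmaFinite.f_integrable.
  by move=> F _ mF; rewrite -Radon_Nikodym_SigmaFinite.f_integral.
apply: ae_eq_integral => //.
- apply: emeasurable_funM => //; exact: measurable_funTS.
- apply: emeasurable_funM => //; exact: measurable_funTS.
- apply: ae_eqe_mul2l; exact: ae_eq_subset ae.
Qed.

(** The endpoint is extended because [Phi_inv] takes infinite values at 0 and 1. *)
Definition lower_ray a : set R := [set y | y%:E <= a].

Lemma lower_rayE (a : R) : lower_ray a%:E = `]-oo, a].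
Proof. by apply/seteqP; split => y /=; rewrite /lower_ray/= in_itv/= lee_fin. Qed.

Lemma lower_rayy : lower_ray +oo = setT.
Proof. by apply/seteqP; split => // y _; exact: leey. Qed.

Lemma lower_rayNy : lower_ray -oo = set0.
Proof. by apply/seteqP; split. Qed.

Lemma measurable_lower_ray a : measurable (lower_ray a).
Proof.
case: a => [a| |]; first by rewrite lower_rayE; exact: measurable_itv.
- by rewrite lower_rayy.
- by rewrite lower_rayNy.
Qed.

Definition gauss_norm : R := Num.sqrt (pi *+ 2).

Lemma gauss_norm_gt0 : (0 < gauss_norm)%R.
Proof. by rewrite sqrtr_gt0 pmulrn_lgt0// pi_gt0. Qed.

Lemma normal_pdf_posE m (c x : R) : (0 < c)%R ->
  normal_pdf m c x = ((c * gauss_norm)^-1 * expR (- ((x - m) ^+ 2 / (2 * c ^+ 2))))%R.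
Proof.
move=> c0; rewrite normal_pdfE ?gt_eqF// /normal_peak /normal_fun; congr (_^-1 * expR _)%R.
  by rewrite -mulrnAr sqrtrM ?sqr_ge0// sqrtr_sqr gtr0_norm.
by rewrite mulNr mulr_natl.
Qed.

Lemma normal_prob_affine m (c : R) a : (0 < c)%R ->
  gauss [set z | (m + c * z)%R%:E <= a] = normal_prob m c (lower_ray a).
Proof.
move=> c0; case: a => [a| |]; last 2 first.
- rewrite (_ : [set _ | _] = setT) ?lower_rayy ?probability_setT//.
  by apply/seteqP; split => // y _; exact: leey.
- by rewrite (_ : [set _ | _] = set0) ?lower_rayNy ?measure0//; apply/seteqP; split.
pose F (z : R^o) : R^o := (m + c * z)%R.
pose b := ((a - m) / c)%R.
have Fb : F b = a by rewrite /F /b; field; rewrite gt_eqF.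
have F' : F^`() = cst c.
  apply/funext => z; rewrite derive1E /F deriveD// derive_cst add0r deriveM//.
  by rewrite derive_cst scaler0 addr0 derive_id; exact: mulr1.
have -> : [set z | (m + c * z)%:E <= a%:E] = `]-oo, b].
  apply/seteqP; split => z /=; rewrite in_itv/= lee_fin -Fb /F lerD2l ler_pM2l//.
have c1 : c != 0%R by rewrite gt_eqF.
rewrite lower_rayE -Fb /normal_prob.
rewrite (@increasing_ge0_integration_by_substitutionNy R F (normal_pdf m c) b); first last.
- by move=> x _; exact: normal_pdf_ge0.
- by apply: continuous_subspaceT => x; exact: continuous_normal_pdf.
- apply: cvg_comp (cvg_addrl_Ny m).
  by apply/gt0_cvgMrNy.
- split => [x _|]; first exact: (@ex_derive _ _ _ _ _ _ _).
  apply: cvg_at_left_filter; apply: differentiable_continuous.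
  by apply/derivable1_diffP; exact: (@ex_derive _ _ _ _ _ _ _).
- by rewrite F'; exact: cvg_cst.
- by rewrite F'; exact: is_cvg_cst.
- by rewrite F' => x _; exact: cvg_cst.
- by move=> x y _ _ xy; rewrite /F ltrD2l ltr_pM2l.
apply: eq_integral => x _; rewrite F' /=; congr EFin.
have K0 : gauss_norm != 0%R by rewrite gt_eqF// gauss_norm_gt0.
rewrite normal_pdf_posE// [RHS](_ : _ = normal_pdf m c (F x) * c)%R// normal_pdf_posE//.
rewrite /F (_ : (m + c * x - m) ^+ 2 / (2 * c ^+ 2) = (x - 0) ^+ 2 / (2 * 1 ^+ 2))%R.
  by field; rewrite K0 c1.
by field; rewrite c1.
Qed.

(** Both sides are the bivariate normal density, whose symmetry is hidden by the asymmetric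
    construction of [gaussian2]. *)
Lemma gauss_density_sym (rho s t : R) : (0 <= rho < 1)%R ->
  let c := Num.sqrt (1 - rho ^+ 2) in
  (normal_pdf 0 1 s * normal_pdf (rho * s) c t =
   normal_pdf 0 1 t * normal_pdf (rho * t) c s)%R.
Proof.
move=> /andP[r0 r1] c.
have cc : (0 < 1 - rho ^+ 2)%R by rewrite subr_gt0 expr_lt1.
have c0 : (0 < c)%R by rewrite sqrtr_gt0.
have c2 : (c ^+ 2 = 1 - rho ^+ 2)%R by rewrite sqr_sqrtr// ltW.
rewrite !normal_pdf_posE// mulrACA [RHS]mulrACA -!expRD; congr (_ * expR _)%R.
by rewrite c2; field; rewrite gt_eqF.
Qed.

End GaussianMeasure.

(** * Symmetry of the bivariate Gaussian law *)

Section JointLaw.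
Import numFieldTopology.Exports numFieldNormedType.Exports.
Context {R : realType}.
Local Open Scope classical_set_scope.
Local Open Scope ereal_scope.
Local Notation mu := (@lebesgue_measure R).
Local Notation gauss := (normal_prob (0 : R) 1).
Implicit Types (rho s t : R) (a b : \bar R) (A B : set (measurableTypeR R)).

Local Notation sd rho := (Num.sqrt (1 - rho ^+ 2)%R).

(** The conditional law of the second Gaussian variable when the first equals [s]. *)
Definition cond_law rho B s : \bar R := gauss [set z | B (rho * s + sd rho * z)%R].

Lemma gaussian2_preimage rho A B :
  gaussian2 rho (A `*` B) =
  (gauss \x gauss) [set z : R * R | A z.1 /\ B (rho * z.1 + sd rho * z.2)%R].
Proof. by []. Qed.

Lemma measurable_gaussian2_preimage rho A B : measurable A -> measurable B ->
  measurable [set z : measurableTypeR R * measurableTypeR R | A z.1 /\ B (rho * z.1 + sd rho * z.2)%R].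
Proof.
move=> mA mB.
rewrite (_ : [set z | _] = (fst @^-1` A) `&` ((fun z => (rho * z.1 + sd rho * z.2)%R) @^-1` B)); last first.
  by apply/seteqP; split.
apply: measurableI.
  by rewrite -[_ @^-1` _]setTI; exact: measurable_fst.
rewrite -[_ @^-1` _]setTI.
have mf : measurable_fun setT (fun z : measurableTypeR R * measurableTypeR R => (rho * z.1 + sd rho * z.2)%R).
  by apply: measurable_funD; apply: measurable_funM.
exact: mf.
Qed.

Lemma measurable_cond_law rho B : measurable B ->
  measurable_fun setT (cond_law rho B : measurableTypeR R -> \bar R).
Proof.
move=> mB.
have := measurable_fun_xsection gauss (measurable_gaussian2_preimage rho measurableT mB).
apply: eq_measurable_fun => s _ /=; rewrite /cond_law; congr (normal_prob _ _ _).
by apply/seteqP; split => z /=; rewrite /xsection/= inE/=; [case|].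
Qed.

Lemma gaussian2E rho A B : measurable A -> measurable B ->
  gaussian2 rho (A `*` B) = \int[gauss]_(s in A) cond_law rho B s.
Proof.
move=> mA mB; rewrite gaussian2_preimage /product_measure1 [RHS]integral_mkcond.
apply: eq_integral => s _; rewrite patchE /cond_law.
case: ifPn => [sA|sA].
  rewrite inE in sA; congr (normal_prob _ _ _).
  by apply/seteqP; split => z /=; rewrite /xsection/= inE/=; [case|].
rewrite notin_setE in sA; rewrite /= (_ : xsection _ _ = set0) ?measure0//.
by apply/seteqP; split => z //=; rewrite /xsection/= inE/= => -[].
Qed.

Lemma cond_law_ge0 rho B s : 0 <= cond_law rho B s.
Proof. exact: measure_ge0. Qed.

Lemma sd_gt0 rho : (0 <= rho < 1)%R -> (0 < sd rho)%R.
Proof. by move=> /andP[r0 r1]; rewrite sqrtr_gt0 subr_gt0 expr_lt1. Qed.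

Lemma measurable_joint_density rho : (0 <= rho < 1)%R ->
  measurable_fun setT (fun z : measurableTypeR R * measurableTypeR R =>
    (normal_pdf 0 1 z.1 * normal_pdf (rho * z.1) (sd rho) z.2)%R).
Proof.
move=> r01; apply: measurable_funM => /=.
  by apply: measurableT_comp => //; exact: measurable_normal_pdf.
rewrite (_ : (fun z => _) = fun z : measurableTypeR R * measurableTypeR R =>
   ((sd rho * gauss_norm)^-1 * expR (- ((z.2 - rho * z.1) ^+ 2 * (2 * sd rho ^+ 2)^-1)))%R).
  apply: measurable_funM => //; apply: measurableT_comp => //.
  apply: measurableT_comp => //; apply: measurable_funM => //.
  apply: measurable_funX; apply: measurable_funB => //.
  exact: measurable_funM.
by apply/funext => z; rewrite normal_pdf_posE// sd_gt0.
Qed.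

Lemma gaussian2_density rho a b : (0 <= rho < 1)%R ->
  gaussian2 rho (lower_ray a `*` lower_ray b) =
  \int[mu]_s \int[mu]_t (normal_pdf 0 1 s * normal_pdf (rho * s) (sd rho) t *
     (\1_(lower_ray a) s * \1_(lower_ray b) t))%:E.
Proof.
move=> r01; have mb := measurable_lower_ray b.
rewrite gaussian2E//; [|exact: measurable_lower_ray..].
have ma := measurable_lower_ray a.
have mc : measurable_fun (lower_ray a) (cond_law rho (lower_ray b)).
  by apply: measurable_funTS; exact: measurable_cond_law.
rewrite (integral_normal_prob _ _ ma mc (cond_law_ge0 rho (lower_ray b))).
rewrite integral_mkcond; apply: eq_integral => s _.
have mp : measurable_fun setT (fun t => (normal_pdf (rho * s) (sd rho) t)%:E).
  by apply/measurable_EFinP; exact: measurable_normal_pdf.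
transitivity (\int[mu]_t ((normal_pdf 0 1 s * \1_(lower_ray a) s)%:E *
   ((normal_pdf (rho * s) (sd rho) t)%:E * (\1_(lower_ray b) t)%:E))); last first.
  by apply: eq_integral => t _; rewrite -!EFinM; congr EFin; ring.
have mpi : measurable_fun setT (fun t => (normal_pdf (rho * s) (sd rho) t)%:E * (\1_(lower_ray b) t)%:E).
  by apply: emeasurable_funM => //; apply/measurable_EFinP; exact: measurable_indic.
have pi0 t : 0 <= (normal_pdf (rho * s) (sd rho) t)%:E * (\1_(lower_ray b) t)%:E.
  by rewrite mule_ge0// lee_fin normal_pdf_ge0.
have k0 : 0 <= (normal_pdf 0 1 s * \1_(lower_ray a) s)%:E.
  by rewrite lee_fin mulr_ge0// normal_pdf_ge0.
have EZ := ge0_integralZl mu measurableT mpi (fun t _ => pi0 t) k0; rewrite /= in EZ; rewrite EZ {EZ}.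
have -> : \int[mu]_t ((normal_pdf (rho * s) (sd rho) t)%:E * (\1_(lower_ray b) t)%:E) =
    cond_law rho (lower_ray b) s.
  rewrite /cond_law normal_prob_affine ?sd_gt0// /normal_prob [RHS]integral_mkcond.
  apply: eq_integral => t _; rewrite patchE indicE.
  by case: ifPn => _; rewrite ?mule1 ?mule0.
rewrite patchE indicE; case: ifPn => _; first by rewrite mulr1 muleC.
by rewrite mulr0 mul0e.
Qed.

(** Tonelli on the symmetric density. It transfers every statement on one argument of [joint_cdf] to
    the other. *)
Lemma gaussian2_sym rho a b : (0 <= rho < 1)%R ->
  gaussian2 rho (lower_ray a `*` lower_ray b) = gaussian2 rho (lower_ray b `*` lower_ray a).
Proof.
move=> r01; rewrite (gaussian2_density a b r01) (gaussian2_density b a r01).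
pose f (z : measurableTypeR R * measurableTypeR R) : \bar R := (normal_pdf 0 1 z.1 * normal_pdf (rho * z.1) (sd rho) z.2 *
     (\1_(lower_ray a) z.1 * \1_(lower_ray b) z.2))%:E.
have mf : measurable_fun setT f.
  apply/measurable_EFinP; apply: measurable_funM.
    exact: measurable_joint_density.
  apply: measurable_funM; apply: measurableT_comp => //; apply: measurable_indic.
  - exact: measurable_lower_ray.
  - exact: measurable_lower_ray.
have f0 z : 0 <= f z by rewrite lee_fin !mulr_ge0// normal_pdf_ge0.
have := @fubini_tonelli _ _ (measurableTypeR R) (measurableTypeR R) R mu mu f mf f0.
rewrite /f/= => ->; apply: eq_integral => t _; apply: eq_integral => s _.
congr EFin; rewrite gauss_density_sym// [X in (_ * X)%R]mulrC.
by [].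
Qed.

End JointLaw.

(** * The normal distribution function and its inverse *)

Section NormalDistributionFunction.
Import numFieldTopology.Exports numFieldNormedType.Exports.
Context {R : realType}.
Local Open Scope classical_set_scope.
Local Open Scope ereal_scope.
Local Notation mu := (@lebesgue_measure R).
Local Notation gauss := (normal_prob (0 : R) 1).
Implicit Types (s t : R) (a b : \bar R).

Lemma gauss_lower_ray a : gauss (lower_ray a) = (Phi a)%:E.
Proof. by rewrite /Phi fineK// fin_num_measure//; exact: measurable_lower_ray. Qed.

Lemma Phi_ge0 a : (0 <= Phi a)%R.
Proof. by rewrite fine_ge0. Qed.

Lemma Phi_le1 a : (Phi a <= 1)%R.
Proof.
by rewrite -lee_fin -gauss_lower_ray probability_le1//; exact: measurable_lower_ray.
Qed.

Lemma Phiy : Phi +oo = 1%R :> R.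
Proof.
have := gauss_lower_ray +oo; rewrite lower_rayy probability_setT => h.
by apply: EFin_inj; rewrite -h.
Qed.

Lemma PhiNy : Phi -oo = 0%R :> R.
Proof.
have := gauss_lower_ray -oo; rewrite lower_rayNy measure0 => h.
by apply: EFin_inj; rewrite -h.
Qed.

Lemma lower_ray_subset a b : a <= b -> lower_ray a `<=` lower_ray b.
Proof. by move=> ab y /= ya; exact: le_trans ya ab. Qed.

Lemma Phi_le a b : a <= b -> (Phi a <= Phi b)%R.
Proof.
move=> ab; rewrite -lee_fin -!gauss_lower_ray le_measure ?inE//.
- exact: measurable_lower_ray.
- exact: measurable_lower_ray.
- exact: lower_ray_subset.
Qed.

Lemma Phi_derive (x : R) : is_derive (x : R^o) 1%R (fun t : R => Phi t%:E) (normal_pdf 0 1 x).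
Proof.
have intg (A : set R) : measurable A -> mu.-integrable A (EFin \o normal_pdf 0 1).
  by move=> mA; apply: (integrableS measurableT) => //; exact: integrable_normal_pdf.
have x1 : (x < x + 1)%R by rewrite ltrDl.
have [] := @continuous_FTC1 R (normal_pdf 0 1) -oo%O x (x + 1) x1
  (intg _ (measurable_itv _)) (ltNyr _) (@continuous_normal_pdf R 0 1 (oner_neq0 _) x).
rewrite (_ : (fun y : R => (\int[mu]_(t in [set` Interval -oo%O (BRight y)]) normal_pdf 0 1 t)%R) =
    (fun t : R => Phi t%:E)); last first.
  by apply/funext => y; rewrite /Phi /normal_prob -/(lower_ray _) lower_rayE.
by move=> dF; rewrite derive1E => F'; rewrite -F'; exact: derivableP.
Qed.

Lemma normal_pdf01E (x : R) : (normal_pdf 0 1 x = gauss_norm^-1 * expR (- (x ^+ 2 / 2)))%R.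
Proof. by rewrite normal_pdf_posE// mul1r subr0 expr1n mulr1. Qed.

Lemma normal_pdf01_gt0 (x : R) : (0 < normal_pdf 0 1 x)%R.
Proof. by rewrite normal_pdf01E mulr_gt0 ?expR_gt0// invr_gt0 gauss_norm_gt0. Qed.

Lemma gauss_norm_ge1 : (1 <= @gauss_norm R)%R.
Proof.
have h : (1 <= pi *+ 2 :> R)%R by have := @pi_ge2 R; lra.
by rewrite -sqrtr1 ler_sqrt// (le_trans _ h).
Qed.

Lemma normal_pdf01_le1 (x : R) : (normal_pdf 0 1 x <= 1)%R.
Proof.
rewrite normal_pdf01E mulr_ile1 ?invr_ge0 ?expR_ge0 ?(ltW gauss_norm_gt0)//.
  by rewrite invf_le1 ?gauss_norm_gt0// gauss_norm_ge1.
by rewrite -expR0 ler_expR oppr_le0 mulr_ge0 ?sqr_ge0.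
Qed.

Lemma normal_pdf01_ge (M x : R) : (`|x| <= M -> normal_pdf 0 1 M <= normal_pdf 0 1 x)%R.
Proof.
move=> xM; rewrite !normal_pdf01E ler_wpM2l ?invr_ge0 ?(ltW gauss_norm_gt0)//.
rewrite ler_expR lerN2 ler_wpM2r// -[(x ^+ 2)%R]real_normK ?num_real//.
by rewrite ler_pXn2r// nnegrE// (le_trans _ xM).
Qed.

Lemma MVT_between (f df : R -> R) (x y : R) :
  (forall z, is_derive (z : R^o) 1%R f (df z)) ->
  exists2 z, (Num.min x y <= z <= Num.max x y)%R & (f y - f x = df z * (y - x))%R.
Proof.
move=> fd.
have cf z : {for z, continuous f}.
  by apply: differentiable_continuous; apply/derivable1_diffP; exact: (@ex_derive _ _ _ _ _ _ _ (fd z)).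
have [xy|/ltW yx] := leP x y.
  have [|z] := @MVT_segment R f df x y xy (fun z _ => fd z).
    exact: continuous_subspaceT.
  by rewrite in_itv/= => zxy e; exists z.
have [|z] := @MVT_segment R f df y x yx (fun z _ => fd z).
  exact: continuous_subspaceT.
rewrite in_itv/= => zxy e; exists z => //.
by rewrite -opprB e; ring.
Qed.

Lemma Phi_lipschitz (x y : R) : (`|Phi y%:E - Phi x%:E| <= `|y - x|)%R.
Proof.
have [z _ ->] := MVT_between x y Phi_derive.
rewrite normrM ler_piMl// ger0_norm ?normal_pdf01_le1// ltW//.
exact: normal_pdf01_gt0.
Qed.

(** A converse Lipschitz bound on [[-M, M]], which later turns remainders in [a' - a] into
    remainders in [Phi a' - Phi a]. *)
Lemma Phi_expansion (M x y : R) : (`|x| <= M -> `|y| <= M ->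
  normal_pdf 0 1 M * `|y - x| <= `|Phi y%:E - Phi x%:E|)%R.
Proof.
rewrite !ler_norml => /andP[xM Mx] /andP[yM My].
have [z zxy ->] := MVT_between x y Phi_derive.
rewrite normrM ler_wpM2r// ger0_norm ?(ltW (normal_pdf01_gt0 _))//.
apply: normal_pdf01_ge; rewrite ler_norml; case/andP: zxy.
by rewrite ge_min le_max => /orP[] h1 /orP[] h2; apply/andP; split; lra.
Qed.

Lemma Phi_lt (x y : R) : (x < y)%R -> (Phi x%:E < Phi y%:E)%R.
Proof.
move=> xy; rewrite lt_neqAle Phi_le ?lee_fin 1?ltW// andbT; apply/eqP => e.
have := @Phi_expansion (`|x| + `|y|)%R x y; rewrite lerDl lerDr !normr_ge0 => /(_ isT isT).
rewrite e subrr normr0 => h; have := normal_pdf01_gt0 (`|x| + `|y|)%R => p0.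
have : (0 < normal_pdf 0 1 (`|x| + `|y|) * `|y - x|)%R.
  by rewrite mulr_gt0// normr_gt0 subr_eq0 gt_eqF.
by rewrite ltNge h.
Qed.

Let idTR : measurableTypeR R -> R := idfun.

#[local] HB.instance Definition _ :=
  @isMeasurableFun.Build _ _ _ _ idTR (@measurable_id _ _ setT).

Lemma Phi_tail (e : R) : (0 < e)%R ->
  exists M : R, [/\ (0 < M)%R, (1 - e <= Phi M%:E)%R & (Phi (- M)%:E <= e)%R].
Proof.
move=> e0; pose P : probability (measurableTypeR R) R := gauss.
have cdfE r : cdf (idTR : {RV P >-> R}) r = (Phi r%:E)%:E.
  by rewrite -gauss_lower_ray lower_rayE.
have h1 : (fun r : R => Phi r%:E) @ +oo%R --> (1%R : R).
  have := @cvg_cdfy1 _ _ _ _ (idTR : {RV P >-> R}).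
  rewrite (_ : cdf _ = EFin \o (fun r : R => Phi r%:E)); last by apply/funext => r; rewrite cdfE.
  by move/fine_cvgP => [].
have h2 : (fun r : R => Phi r%:E) @ -oo%R --> (0%R : R).
  have := @cvg_cdfNy0 _ _ _ _ (idTR : {RV P >-> R}).
  rewrite (_ : cdf _ = EFin \o (fun r : R => Phi r%:E)); last by apply/funext => r; rewrite cdfE.
  by move/fine_cvgP => [].
have : \forall r \near +oo%R, (`|1 - Phi r%:E| < e)%R.
  by move/cvgrPdist_lt: h1; apply.
have : \forall r \near -oo%R, (`|0 - Phi r%:E| < e)%R.
  by move/cvgrPdist_lt: h2; apply.
move=> [M1 [_ H1]] [M2 [_ H2]].
exists (`|M1| + `|M2| + 1)%R; split.
- by have := normr_ge0 M1; have := normr_ge0 M2; lra.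
- have : (M2 < `|M1| + `|M2| + 1)%R by have := ler_norm M2; have := normr_ge0 M1; lra.
  by move/H2; rewrite ltr_norml => /andP[_ /ltW]; lra.
- have : (- (`|M1| + `|M2| + 1) < M1)%R.
    by have := ler_norm (- M1); rewrite normrN; have := normr_ge0 M2; lra.
  by move/H1; rewrite sub0r normrN => /ltW; apply: le_trans; exact: ler_norm.
Qed.

Lemma Phi_surj (x : R) : (0 < x < 1)%R -> exists t : R, Phi t%:E = x.
Proof.
move=> /andP[x0 x1].
have m0 : (0 < Num.min x (1 - x))%R by rewrite lt_min x0 subr_gt0.
have [M [M0 h1 h2]] := Phi_tail m0.
have [|||t _ tx] := @IVT R (fun t : R => Phi t%:E) (- M) M x.
- by rewrite lerNl; lra.
- apply: continuous_subspaceT => z.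
  apply: differentiable_continuous; apply/derivable1_diffP.
  exact: (@ex_derive _ _ _ _ _ _ _ (Phi_derive z)).
- rewrite ge_min le_max; move: h1 h2; rewrite le_min => h1 /andP[h2 h3].
  rewrite h2/=; apply/orP; right; apply: le_trans h1.
  by rewrite lerBrDr -lerBrDl ge_min lexx orbT.
- by exists t.
Qed.

Lemma Phi_Phi_inv (x : R) : (0 <= x <= 1)%R -> Phi (Phi_inv x) = x.
Proof.
move=> /andP[x0 x1]; apply: (@xgetPex _ -oo [set a | Phi a = x]).
move: x0; rewrite le_eqVlt => /predU1P[<-|x0]; first by exists -oo; exact: PhiNy.
move: x1; rewrite le_eqVlt => /predU1P[->|x1]; first by exists +oo; exact: Phiy.
by have [|t tx] := @Phi_surj x; [rewrite x0|exists t%:E].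
Qed.

Lemma Phi_inv_real (x : R) : (0 < x < 1)%R -> exists t : R, Phi_inv x = t%:E /\ Phi t%:E = x.
Proof.
move=> /andP[x0 x1]; have := @Phi_Phi_inv x; rewrite !ltW// => /(_ isT).
case: (Phi_inv x) => [t tx| |]; first by exists t.
- by rewrite Phiy => h; move: x1; rewrite -h ltxx.
- by rewrite PhiNy => h; move: x0; rewrite -h ltxx.
Qed.

Lemma Phi_inv0 : Phi_inv 0 = -oo :> \bar R.
Proof.
have := @Phi_Phi_inv 0; rewrite lexx ler01 => /(_ isT).
case: (Phi_inv 0) => [t| |] //; last by rewrite Phiy => /eqP; rewrite oner_eq0.
move=> t0; have /Phi_lt : (t - 1 < t)%R by rewrite ltrBlDr ltrDl.
by rewrite t0 ltNge Phi_ge0.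
Qed.

Lemma Phi_inv1 : Phi_inv 1 = +oo :> \bar R.
Proof.
have := @Phi_Phi_inv 1; rewrite lexx ler01 => /(_ isT).
case: (Phi_inv 1) => [t| |] //; last by rewrite PhiNy => /esym/eqP; rewrite oner_eq0.
move=> t0; have /Phi_lt : (t < t + 1)%R by rewrite ltrDl.
by rewrite t0 ltNge Phi_le1.
Qed.

Lemma Phi_inv_bounded (d : R) : (0 < d)%R ->
  exists M : R, (0 < M)%R /\ forall x t : R, (d <= x <= 1 - d)%R -> Phi t%:E = x -> (`|t| <= M)%R.
Proof.
move=> d0; have [|M [M0 h1 h2]] := @Phi_tail (d / 2); first by rewrite divr_gt0.
exists M; split=> // x t /andP[dx xd] tx; rewrite ler_norml; apply/andP; split.
  rewrite leNgt; apply/negP => /Phi_lt; rewrite tx => h; lra.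
by rewrite leNgt; apply/negP => /Phi_lt; rewrite tx => h; lra.
Qed.

End NormalDistributionFunction.

(** * Concavity of the joint distribution function *)

Section JointDistributionFunction.
Import numFieldTopology.Exports numFieldNormedType.Exports.
Context {R : realType}.
Local Open Scope classical_set_scope.
Local Open Scope ereal_scope.
Local Notation mu := (@lebesgue_measure R).
Local Notation gauss := (normal_prob (0 : R) 1).
Local Notation sd rho := (Num.sqrt (1 - rho ^+ 2)%R).
Implicit Types (rho s t k : R) (a b : \bar R).

Definition joint_cdf rho a b : R := fine (gaussian2 rho (lower_ray a `*` lower_ray b)).

Definition cond_cdf rho b s : R := fine (cond_law rho (lower_ray b) s).

Lemma Gamma_upperE rho x y : Gamma_upper rho x y = joint_cdf rho (Phi_inv x) (Phi_inv y).
Proof. by []. Qed.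

Lemma measurable_section rho (B : set (measurableTypeR R)) s : measurable B ->
  measurable [set z : measurableTypeR R | B (rho * s + sd rho * z)%R].
Proof.
move=> mB; rewrite -[X in measurable X]setTI.
have mf : measurable_fun setT (fun z : measurableTypeR R => (rho * s + sd rho * z)%R).
  by apply: measurable_funD => //; exact: measurable_funM.
exact: mf.
Qed.

Lemma cond_lawE rho b s : cond_law rho (lower_ray b) s = (cond_cdf rho b s)%:E.
Proof.
rewrite /cond_cdf fineK// fin_num_measure//.
by apply: measurable_section; exact: measurable_lower_ray.
Qed.

Lemma cond_cdf_ge0 rho b s : (0 <= cond_cdf rho b s)%R.
Proof. by rewrite fine_ge0// cond_law_ge0. Qed.

Lemma cond_cdf_le1 rho b s : (cond_cdf rho b s <= 1)%R.
Proof.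
rewrite -lee_fin -cond_lawE probability_le1//.
by apply: measurable_section; exact: measurable_lower_ray.
Qed.

Lemma cond_cdf_anti rho b s t : (0 <= rho)%R -> (s <= t)%R ->
  (cond_cdf rho b t <= cond_cdf rho b s)%R.
Proof.
move=> r0 st; rewrite -lee_fin -!cond_lawE le_measure ?inE//.
- by apply: measurable_section; exact: measurable_lower_ray.
- by apply: measurable_section; exact: measurable_lower_ray.
move=> z /=; apply: le_trans; rewrite lee_fin lerD2r ler_wpM2l//.
Qed.

Lemma cond_cdf_real rho (b : R) s : (0 <= rho < 1)%R ->
  cond_cdf rho b%:E s = Phi (((b - rho * s) / sd rho)%R%:E).
Proof.
move=> r01; rewrite /cond_cdf /Phi /cond_law; congr (fine (normal_prob _ _ _)).
apply/seteqP; split => z /=; rewrite /lower_ray/= !lee_fin.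
  by rewrite ler_pdivlMr ?sd_gt0// lerBrDl [(z * _)%R]mulrC.
by rewrite ler_pdivlMr ?sd_gt0// lerBrDl [(z * _)%R]mulrC.
Qed.

Lemma cond_cdfy rho s : cond_cdf rho +oo s = 1%R.
Proof.
rewrite /cond_cdf lower_rayy /cond_law (_ : [set z | _] = setT) ?probability_setT//.
Qed.

Lemma gaussian2_joint_cdf rho a b :
  gaussian2 rho (lower_ray a `*` lower_ray b) = (joint_cdf rho a b)%:E.
Proof.
rewrite /joint_cdf fineK// gaussian2_preimage.
have mA := measurable_gaussian2_preimage rho (measurable_lower_ray a) (measurable_lower_ray b).
rewrite ge0_fin_numE//; apply: (@le_lt_trans _ _ 1); last by rewrite ltry.
have <- : (gauss \x gauss) setT = 1.
  rewrite -setXTT; apply: eq_trans (product_measure1E gauss gauss measurableT measurableT) _.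
  have g1 : gauss setT = 1 by exact: probability_setT.
  by transitivity (1 * 1 : \bar R); [congr (_ * _); exact: g1|rewrite mule1].
by apply: le_measure; rewrite ?inE.
Qed.

Lemma joint_cdf_ge0 rho a b : (0 <= joint_cdf rho a b)%R.
Proof. by rewrite fine_ge0// gaussian2_preimage measure_ge0. Qed.

Lemma gauss_strip a a' : a <= a' ->
  gauss (lower_ray a' `\` lower_ray a) = (Phi a' - Phi a)%:E.
Proof.
move=> aa; rewrite measureD//=; [|exact: measurable_lower_ray..|]; last first.
  by rewrite -ge0_fin_numE// fin_num_measure//; exact: measurable_lower_ray.
rewrite (_ : _ `&` _ = lower_ray a); last by apply/setIidPr; exact: lower_ray_subset.
by rewrite EFinB -!gauss_lower_ray.
Qed.

Lemma joint_cdf_strip rho a a' b : a <= a' ->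
  (joint_cdf rho a' b)%:E = (joint_cdf rho a b)%:E +
    \int[gauss]_(s in lower_ray a' `\` lower_ray a) (cond_cdf rho b s)%:E.
Proof.
move=> aa; have ma := measurable_lower_ray a; have ma' := measurable_lower_ray a'.
have mb := measurable_lower_ray b.
apply: eq_trans (esym (gaussian2_joint_cdf rho a' b)) _.
apply: eq_trans _ (congr1 (+%E^~ _) (gaussian2_joint_cdf rho a b)).
rewrite (gaussian2E rho ma mb) (gaussian2E rho ma' mb).
under [X in _ = _ + X]eq_integral do rewrite -cond_lawE.
have mS : measurable (lower_ray a' `\` lower_ray a : set (measurableTypeR R)) by exact: measurableD.
have dis : [disjoint lower_ray a & lower_ray a' `\` lower_ray a].
  by rewrite disj_set2E setDIK.
have mf : measurable_fun (lower_ray a `|` (lower_ray a' `\` lower_ray a)) (cond_law rho (lower_ray b)).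
  by apply: measurable_funTS; exact: measurable_cond_law.
have := ge0_integral_setU gauss ma mS mf (fun s _ => cond_law_ge0 rho _ s) dis.
by rewrite setDUK//; exact: lower_ray_subset.
Qed.

Lemma measurable_cond_cdf rho b (D : set (measurableTypeR R)) :
  measurable_fun D (fun s => (cond_cdf rho b s)%:E).
Proof.
apply: measurable_funTS.
apply: eq_measurable_fun (measurable_cond_law rho (measurable_lower_ray b)) => s _.
exact: cond_lawE.
Qed.

Lemma measurable_strip a a' :
  measurable (lower_ray a' `\` lower_ray a : set (measurableTypeR R)).
Proof. by apply: measurableD; exact: measurable_lower_ray. Qed.

Lemma joint_cdf_increment_le rho a a' b k : a <= a' -> (0 <= k)%R ->
  (forall s, a < s%:E <= a' -> (cond_cdf rho b s <= k)%R) ->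
  (joint_cdf rho a' b - joint_cdf rho a b <= k * (Phi a' - Phi a))%R.
Proof.
move=> aa k0 sk; have := joint_cdf_strip rho b aa.
set X := \int[_]_(_ in _) _ => eX.
have mS := measurable_strip a a'.
have : X <= (k * (Phi a' - Phi a))%:E.
  rewrite EFinM -gauss_strip// -integral_cst//; apply: ge0_le_integral => //.
  - by move=> s _; rewrite lee_fin cond_cdf_ge0.
  - exact: measurable_cond_cdf.
  - by move=> s [/= sa' /negP]; rewrite -ltNge lee_fin => sa; apply: sk; rewrite sa.
move: eX; case: X => [x| |] //; rewrite -EFinD => -[->]; rewrite lee_fin.
by rewrite addrAC subrr add0r.
Qed.

Lemma joint_cdf_increment_ge rho a a' b k : a <= a' -> (0 <= k)%R ->
  (forall s, a < s%:E <= a' -> (k <= cond_cdf rho b s)%R) ->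
  (k * (Phi a' - Phi a) <= joint_cdf rho a' b - joint_cdf rho a b)%R.
Proof.
move=> aa k0 sk; have := joint_cdf_strip rho b aa.
set X := \int[_]_(_ in _) _ => eX.
have mS := measurable_strip a a'.
have : (k * (Phi a' - Phi a))%:E <= X.
  rewrite EFinM -gauss_strip// -integral_cst//; apply: ge0_le_integral => //.
  - exact: measurable_cond_cdf.
  - by move=> s [/= sa' /negP]; rewrite -ltNge lee_fin => sa; apply: sk; rewrite sa.
move: eX; case: X => [x| |] //; rewrite -EFinD => -[->]; rewrite lee_fin.
by rewrite addrAC subrr add0r.
Qed.

(** In the variable [Phi a] the slope is [cond_cdf rho b a], which is nonincreasing for [rho >= 0]:
    this is concavity, up to the infinite endpoints. *)
Lemma joint_cdf_tangent rho (a : R) a' b : (0 <= rho)%R ->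
  (joint_cdf rho a' b <= joint_cdf rho a%:E b + cond_cdf rho b a * (Phi a' - Phi a%:E))%R.
Proof.
move=> r0; have k0 := cond_cdf_ge0 rho b a.
have [aa|/ltW aa] := leP a%:E a'.
  rewrite -lerBlDl; apply: joint_cdf_increment_le => // s /andP[/ltW + _].
  by rewrite lee_fin; exact: cond_cdf_anti.
have : (cond_cdf rho b a * (Phi a%:E - Phi a') <= joint_cdf rho a%:E b - joint_cdf rho a' b)%R.
  apply: joint_cdf_increment_ge => // s /andP[_].
  by rewrite lee_fin; exact: cond_cdf_anti.
by rewrite lerBrDr -lerBrDl -mulrN opprB.
Qed.

Lemma joint_cdf_le rho a a' b : a <= a' ->
  (joint_cdf rho a b <= joint_cdf rho a' b)%R.
Proof.
move=> aa; have := @joint_cdf_increment_ge rho a a' b 0 aa (lexx _).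
by move=> /(_ (fun s _ => cond_cdf_ge0 rho b s)); rewrite mul0r subr_ge0.
Qed.

Lemma joint_cdf_increment_le1 rho a a' b : a <= a' ->
  (joint_cdf rho a' b - joint_cdf rho a b <= Phi a' - Phi a)%R.
Proof.
move=> aa; rewrite -[leRHS]mul1r; apply: joint_cdf_increment_le => // s _.
exact: cond_cdf_le1.
Qed.

Lemma joint_cdfNy rho b : joint_cdf rho -oo b = 0%R.
Proof.
by have := gaussian2_joint_cdf rho -oo b; rewrite gaussian2E ?lower_rayNy ?integral_set0 => [[->]||]//; exact: measurable_lower_ray.
Qed.

Lemma joint_cdf_yr rho a : joint_cdf rho a +oo = Phi a.
Proof.
have h1 := @joint_cdf_increment_ge rho -oo a +oo 1 (leNye _) ler01.
have h2 := @joint_cdf_increment_le1 rho -oo a +oo (leNye _).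
move: h1 h2; rewrite joint_cdfNy PhiNy !subr0 mul1r => h1 h2.
by apply: le_anti; rewrite h2 h1// => s _; rewrite cond_cdfy.
Qed.

Lemma joint_cdf_sym rho a b : (0 <= rho < 1)%R -> joint_cdf rho a b = joint_cdf rho b a.
Proof. by move=> r01; rewrite /joint_cdf gaussian2_sym. Qed.

Lemma joint_cdf_yl rho b : (0 <= rho < 1)%R -> joint_cdf rho +oo b = Phi b.
Proof. by move=> r01; rewrite joint_cdf_sym// joint_cdf_yr. Qed.

End JointDistributionFunction.

(** * Second-order expansion of the joint distribution function *)

Section JointTaylor.
Import numFieldTopology.Exports numFieldNormedType.Exports.
Context {R : realType}.
Local Open Scope classical_set_scope.
Local Open Scope ring_scope.
Local Notation phi := (normal_pdf (0 : R) 1).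
Local Notation PhiR := (fun t : R => Phi t%:E).
Local Notation sd rho := (Num.sqrt (1 - rho ^+ 2)).
Implicit Types (rho s t M : R).

Lemma is_derive_flat (f : R -> R) (x C : R) :
  (forall y, `|f y - f x| <= C * `|y - x| ^+ 2) -> is_derive (x : R^o) 1 f 0.
Proof.
move=> fC.
have C0 : 0 <= C.
  have := fC (x + 1); rewrite addrAC subrr add0r normr1 expr1n mulr1.
  exact: le_trans.
have cv : h^-1 *: (f (h *: 1 + x) - f x) @[h --> (0 : R)^'] --> (0 : R).
  apply/cvgrPdist_le => e e0; near=> h.
  have h0 : h != 0 by near: h; exact: nbhs_dnbhs_neq.
  rewrite sub0r normrN [_ *: _]mulrC normrM normfV ler_pdivrMr ?normr_gt0//.
  apply: le_trans (fC _) _; rewrite [h *: 1]mulr1 addrK expr2 mulrA ler_wpM2r//.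
  have : `|h| <= e / (C + 1).
    near: h; apply: dnbhs0_le; rewrite divr_gt0//; lra.
  rewrite ler_pdivlMr; last by lra.
  have := normr_ge0 h; nra.
by apply: DeriveDef; [apply/cvg_ex; exists 0|apply/cvg_lim].
Unshelve. all: by end_near. Qed.

Lemma between_bounds (M a b z : R) : `|a| <= M -> `|b| <= M ->
  Num.min a b <= z <= Num.max a b -> `|z| <= M /\ `|z - a| <= `|b - a|.
Proof.
move=> + + /andP[]; rewrite ge_min le_max !ler_norml => /andP[aM1 aM2] /andP[bM1 bM2] h1 h2.
split; first by apply/andP; split; case/orP: h1; case/orP: h2; lra.
have [ab|ba] := leP a b.
  by rewrite ger0_norm ?subr_ge0//; apply/andP; split; case/orP: h1; case/orP: h2; lra.
by rewrite ltr0_norm ?subr_lt0//; apply/andP; split; case/orP: h1; case/orP: h2; lra.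
Qed.

(** Taylor's formula in the variable [Phi s]: a derivative divided by [phi] is a derivative with
    respect to [Phi], so [kappa] is the slope of [g]. The remainder stays in terms of [b - a]. *)
Lemma first_order_expansion (g kappa : R -> R) (M L a b : R) :
  (forall s, is_derive (s : R^o) 1 g (phi s * kappa s)) ->
  `|a| <= M -> 0 <= L ->
  (forall s, `|s| <= M -> `|kappa s - kappa a| <= L * `|s - a|) ->
  `|b| <= M ->
  `|g b - g a - kappa a * (PhiR b - PhiR a)| <= L * `|b - a| ^+ 2.
Proof.
move=> dg aM L0 kL bM; pose chi s := g s - kappa a * PhiR s.
have dchi s : is_derive (s : R^o) 1 chi (phi s * (kappa s - kappa a)).
  have d1 := dg s; have d2 := @Phi_derive R s.
  apply: is_derive_eq; rewrite /GRing.scale/=; ring.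
have [z zab e] := MVT_between a b dchi.
have [zM za] := between_bounds aM bM zab.
rewrite (_ : g b - g a - _ = chi b - chi a); last by rewrite /chi; ring.
rewrite e normrM expr2 mulrA ler_wpM2r// normrM.
rewrite ger0_norm ?(ltW (normal_pdf01_gt0 _))//.
apply: le_trans (ler_piMl _ (normal_pdf01_le1 _)) _ => //.
by apply: le_trans (kL z zM) _; rewrite ler_wpM2l.
Qed.

Lemma second_order_expansion (f g kappa : R -> R) (M L a b : R) :
  (forall s, is_derive (s : R^o) 1 f (phi s * g s)) ->
  (forall s, is_derive (s : R^o) 1 g (phi s * kappa s)) ->
  `|a| <= M -> 0 <= L ->
  (forall s, `|s| <= M -> `|kappa s - kappa a| <= L * `|s - a|) ->
  `|b| <= M ->
  `|f b - f a - g a * (PhiR b - PhiR a) - 2^-1 * kappa a * (PhiR b - PhiR a) ^+ 2|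
     <= L * `|b - a| ^+ 3.
Proof.
move=> df dg aM L0 kL bM.
pose psi s := f s - g a * PhiR s - 2^-1 * kappa a * (PhiR s - PhiR a) ^+ 2.
have dpsi s : is_derive (s : R^o) 1 psi (phi s * (g s - g a - kappa a * (PhiR s - PhiR a))).
  have d1 := df s; have d2 := @Phi_derive R s.
  have d3 : is_derive (s : R^o) 1 (fun s => (PhiR s - PhiR a) ^+ 2) (2 * (PhiR s - PhiR a) * phi s).
    apply: is_derive_eq; rewrite /GRing.scale/=; ring.
  by apply: is_derive_eq; rewrite /GRing.scale/=; field.
have [z zab e] := MVT_between a b dpsi.
have [zM za] := between_bounds aM bM zab.
rewrite (_ : f b - f a - _ - _ = psi b - psi a); last by rewrite /psi; ring.
rewrite e normrM (exprSr _ 2) mulrA ler_wpM2r// normrM.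
rewrite ger0_norm ?(ltW (normal_pdf01_gt0 _))//.
apply: le_trans (ler_piMl _ (normal_pdf01_le1 _)) _ => //.
apply: le_trans (first_order_expansion dg aM L0 kL zM) _.
by rewrite ler_wpM2l// ler_pXn2r// nnegrE.
Qed.

(* The density ratio: [phi (u / c) / c = phi z * gauss_ratio c z u]. *)
Definition gauss_ratio c z u : R := c^-1 * expR (z ^+ 2 / 2 - u ^+ 2 / (2 * c ^+ 2)).

Lemma gauss_ratio_gt0 c z u : 0 < c -> 0 < gauss_ratio c z u.
Proof. by move=> c0; rewrite mulr_gt0 ?invr_gt0 ?expR_gt0. Qed.

Lemma phi_gauss_ratio c z u : 0 < c -> phi (u / c) / c = phi z * gauss_ratio c z u.
Proof.
move=> c0; rewrite !normal_pdf01E /gauss_ratio.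
rewrite (_ : - ((u / c) ^+ 2 / 2) = - (z ^+ 2 / 2) + (z ^+ 2 / 2 - u ^+ 2 / (2 * c ^+ 2))).
  by rewrite expRD; ring.
by field; rewrite gt_eqF.
Qed.

Lemma expR_lipschitz (K x y : R) : x <= K -> y <= K ->
  `|expR x - expR y| <= expR K * `|x - y|.
Proof.
wlog yx : x y / y <= x => [hw xK yK|xK yK].
  by have [/hw|/ltW/hw] := leP y x; [exact|rewrite distrC (distrC x); exact].
rewrite !ger0_norm ?subr_ge0 ?ler_expR//.
have -> : expR x - expR y = expR x * (1 - expR (y - x)).
  by rewrite mulrBr mulr1 -expRD addrCA subrr addr0.
rewrite ler_pM ?expR_ge0 ?ler_expR// ?subr_ge0.
  by rewrite -expR0 ler_expR; lra.
by have := expR_ge1Dx (y - x); lra.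
Qed.

Lemma gauss_ratio_lipschitz M c0 c z z' u u' : 0 < c0 -> c0 <= c ->
  `|z| <= M -> `|z'| <= M -> `|u| <= 2 * M -> `|u'| <= 2 * M ->
  `|gauss_ratio c z u - gauss_ratio c z' u'| <=
  c0^-1 * (expR (M ^+ 2 / 2) * (M * `|z - z'| + 2 * M / c0 ^+ 2 * `|u - u'|)).
Proof.
move=> c00 c0c zM z'M uM u'M; have cp : 0 < c by exact: lt_le_trans c0c.
rewrite /gauss_ratio -mulrBr normrM ler_pM//.
  by rewrite gtr0_norm ?invr_gt0// lef_pV2.
have bnd w v : `|w| <= M -> w ^+ 2 / 2 - v ^+ 2 / (2 * c ^+ 2) <= M ^+ 2 / 2.
  move=> wM; have : 0 <= v ^+ 2 / (2 * c ^+ 2).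
    by rewrite divr_ge0 ?sqr_ge0// mulr_ge0// sqr_ge0.
  have : w ^+ 2 <= M ^+ 2.
    by rewrite -real_normK ?num_real// ler_pXn2r// nnegrE// (le_trans _ wM).
  lra.
apply: le_trans (expR_lipschitz (bnd z u zM) (bnd z' u' z'M)) _.
rewrite ler_wpM2l ?expR_ge0//.
rewrite (_ : _ - _ = (z + z') / 2 * (z - z') - (u + u') / (2 * c ^+ 2) * (u - u')); last first.
  by field; rewrite gt_eqF.
apply: le_trans (ler_normB _ _) _; rewrite !normrM; apply: lerD; rewrite ler_wpM2r//.
  rewrite [X in _ * X]ger0_norm ?invr_ge0// ler_pdivrMr//.
  by apply: le_trans (ler_normD _ _) _; lra.
have cc : 0 < c ^+ 2 by rewrite exprn_gt0.
have cc0 : 0 < c0 ^+ 2 by rewrite exprn_gt0.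
have c20 : 0 <= (2 * c ^+ 2)^-1 by rewrite invr_ge0 mulr_ge0// ltW.
rewrite (ger0_norm c20) invfM mulrA.
rewrite ler_pM ?divr_ge0 ?invr_ge0 ?(ltW cc)//.
  rewrite ler_pdivrMr//; apply: le_trans (ler_normD _ _) _; lra.
by rewrite lef_pV2 ?posrE// ler_pXn2r ?nnegrE// ltW.
Qed.

Lemma is_derive_cond_cdf_s rho (b s : R) : 0 <= rho < 1 ->
  is_derive (s : R^o) 1 (cond_cdf rho b%:E)
    (phi s * (- rho * gauss_ratio (sd rho) s (b - rho * s))).
Proof.
move=> r01; have c0 := sd_gt0 r01.
have -> : cond_cdf rho b%:E = (fun t : R => Phi t%:E) \o (fun s => (b - rho * s) / sd rho).
  by apply/funext => t; rewrite cond_cdf_real.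
have d1 := Phi_derive ((b - rho * s) / sd rho).
have d2 : is_derive (s : R^o) 1 (fun s : R => (b - rho * s) / sd rho) (- rho / sd rho).
  apply: is_derive_eq; rewrite /GRing.scale/=; ring.
apply: (is_derive_eq (@is_derive1_comp _ (fun t : R => Phi t%:E) (fun s => (b - rho * s) / sd rho) s _ _ d1 d2)).
transitivity (- rho * (phi ((b - rho * s) / sd rho) / sd rho)); first by ring.
by rewrite (phi_gauss_ratio s)//; ring.
Qed.

Lemma is_derive_cond_cdf_b rho (b s : R) : 0 <= rho < 1 ->
  is_derive (b : R^o) 1 (fun b : R => cond_cdf rho b%:E s)
    (phi b * gauss_ratio (sd rho) b (b - rho * s)).
Proof.
move=> r01; have c0 := sd_gt0 r01.
have -> : (fun b : R => cond_cdf rho b%:E s) = (fun t : R => Phi t%:E) \o (fun b => (b - rho * s) / sd rho).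
  by apply/funext => t; rewrite cond_cdf_real.
have d1 := Phi_derive ((b - rho * s) / sd rho).
have d2 : is_derive (b : R^o) 1 (fun b : R => (b - rho * s) / sd rho) (1 / sd rho).
  apply: is_derive_eq; rewrite /GRing.scale/=; ring.
apply: (is_derive_eq (@is_derive1_comp _ (fun t : R => Phi t%:E) (fun b => (b - rho * s) / sd rho) b _ _ d1 d2)).
by rewrite mul1r (phi_gauss_ratio b).
Qed.

Lemma cond_cdf_lipschitz rho (b s t : R) : 0 <= rho < 1 ->
  `|cond_cdf rho b%:E s - cond_cdf rho b%:E t| <= (sd rho)^-1 * `|s - t|.
Proof.
move=> r01; have c0 := sd_gt0 r01; rewrite !cond_cdf_real//.
apply: le_trans (Phi_lipschitz _ _) _.
have -> : (b - rho * s) / sd rho - (b - rho * t) / sd rho = (sd rho)^-1 * (- rho * (s - t)).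
  by ring.
rewrite normrM gtr0_norm ?invr_gt0// ler_wpM2l ?invr_ge0 ?(ltW c0)//.
by case/andP: r01 => r0 r1; rewrite normrM normrN (ger0_norm r0) ler_piMl// ltW.
Qed.

(** The tangent lines at [s] and at [t] enclose the increment, and their slopes differ by a multiple
    of [s - t]. The deviation from linearity in [Phi] is therefore quadratic, and [is_derive_flat]
    applies. *)
Lemma is_derive_joint_cdf rho (b s : R) : 0 <= rho < 1 ->
  is_derive (s : R^o) 1 (fun s : R => joint_cdf rho s%:E b%:E) (phi s * cond_cdf rho b%:E s).
Proof.
move=> r01; have r0 : 0 <= rho by case/andP: r01.
pose k := cond_cdf rho b%:E s.
have d1 : is_derive (s : R^o) 1 (fun t : R => joint_cdf rho t%:E b%:E - k * Phi t%:E) 0.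
  apply: (@is_derive_flat _ _ (sd rho)^-1) => t.
  have h1 := joint_cdf_tangent s t%:E b%:E r0.
  have h2 := joint_cdf_tangent t s%:E b%:E r0.
  rewrite -/k in h1.
  have h3 := cond_cdf_lipschitz b s t r01.
  have h4 := Phi_lipschitz s t.
  set J1 := joint_cdf _ _ _ in h1 h2 *; set J2 := joint_cdf _ _ _ in h1 h2 *.
  set k' := cond_cdf _ _ t in h2 h3.
  have h5 : `|(J1 - k * Phi t%:E) - (J2 - k * Phi s%:E)| <= `|(k' - k) * (Phi t%:E - Phi s%:E)|.
    rewrite ler0_norm.
      by rewrite -[leRHS]normrN; apply: le_trans (ler_norm _); lra.
    by lra.
  apply: le_trans h5 _; rewrite normrM expr2 mulrA ler_pM//.
  by rewrite distrC (distrC t).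
have d2 := Phi_derive s.
have -> : (fun s : R => joint_cdf rho s%:E b%:E) =
   (fun t : R => (joint_cdf rho t%:E b%:E - k * Phi t%:E) + k * Phi t%:E).
  by apply/funext => t; rewrite subrK.
by apply: is_derive_eq; rewrite /GRing.scale/= add0r mulrC.
Qed.

(** The bookkeeping of the four error terms, isolated so that [lra] meets opaque reals; [t^-1]
    enters as a free variable. *)
Lemma taylor_combine (J11 J01 J00 h1 h0 ha r t k1 rho x y X Y e1 e2 e3 e4 : R) :
  J11 - J01 - h1 * x - 2^-1 * k1 * X <= e1 ->
  J01 - J00 - ha * y - 2^-1 * (- rho * (r / t)) * Y <= e2 ->
  (h1 - h0 - r * y) * x <= e3 -> (k1 - - rho * (r * t)) * X <= e4 -> 0 <= e4 ->
  J11 <= J00 + h0 * x + ha * y +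
    2^-1 * r * (2 * (x * y) - rho * (t * X + t^-1 * Y)) + (e1 + e3 + e4 + e2).
Proof. move: t^-1 => t'; lra. Qed.

(** With respect to [Phi a] and [Phi b] the mixed second derivative is [r] and the pure ones are
    [- rho r t] and [- rho r / t], where [t = phi b / phi a]. The product of the pure ones is
    [rho^2 r^2], which matches increments of correlation at most [rho]. [C] depends on [rho1] and
    [M] only. *)
Lemma joint_cdf_taylor (rho1 M : R) : 0 <= rho1 < 1 -> 0 < M ->
  exists C : R, 0 <= C /\
  forall rho (a b : R), 0 <= rho <= rho1 -> `|a| <= M -> `|b| <= M ->
  exists p q r t : R, [/\ 0 <= r, 0 < t &
  forall a' b' : R, `|a'| <= M -> `|b'| <= M ->
  let x := Phi a'%:E - Phi a%:E in let y := Phi b'%:E - Phi b%:E in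
  joint_cdf rho a'%:E b'%:E <= joint_cdf rho a%:E b%:E + p * x + q * y
    + 2^-1 * r * (2 * (x * y) - rho * (t * x ^+ 2 + t^-1 * y ^+ 2))
    + C * (`|x| ^+ 3 + `|x| * `|y| ^+ 2 + `|x| ^+ 2 * `|y| + `|y| ^+ 3)].
Proof.
move=> r101 M0; have c0 := sd_gt0 r101; set c1 := sd rho1 in c0.
(* By [Phi_expansion], [K] bounds [a' - a] by a multiple of [Phi a' - Phi a]; as [K >= 1], the
   factor [K ^+ 3] serves all degrees. *)
pose K := (phi M)^-1.
have p0 : 0 < phi M by exact: normal_pdf01_gt0.
have K0 : 0 < K by rewrite invr_gt0.
have K1 : 1 <= K by rewrite invf_ge1// normal_pdf01_le1.
pose L := c1^-1 * (expR (M ^+ 2 / 2) * (M + 2 * M / c1 ^+ 2)).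
have L0 : 0 <= L.
  rewrite mulr_ge0 ?invr_ge0 ?(ltW c0)// mulr_ge0 ?expR_ge0// addr_ge0 ?(ltW M0)//.
  by rewrite divr_ge0 ?sqr_ge0// mulr_ge0// ltW.
exists (L * K ^+ 3); split; first by rewrite mulr_ge0// exprn_ge0// ltW.
move=> rho a b /andP[r0 rr1] aM bM.
have r01 : 0 <= rho < 1 by rewrite r0 (le_lt_trans rr1)//; case/andP: r101.
have cc : c1 <= sd rho.
  by rewrite ler_sqrt ?subr_ge0 ?lerD2l ?lerN2 ?ler_pXn2r ?nnegrE ?(le_trans r0)// expr_le1// ltW//; case/andP: r01.
have c0' := sd_gt0 r01.
have rho1' : rho <= 1 by case/andP: r01 => _ /ltW.
have Wlip z z' u u' d : `|z| <= M -> `|z'| <= M -> `|u| <= 2 * M -> `|u'| <= 2 * M ->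
    `|z - z'| <= d -> `|u - u'| <= d ->
    `|gauss_ratio (sd rho) z u - gauss_ratio (sd rho) z' u'| <= L * d.
  move=> zM z'M uM u'M zd ud.
  apply: le_trans (gauss_ratio_lipschitz c0 cc zM z'M uM u'M) _.
  rewrite (_ : L * d = c1^-1 * (expR (M ^+ 2 / 2) * ((M + 2 * M / c1 ^+ 2) * d))); last first.
    by rewrite /L; ring.
  rewrite ler_wpM2l ?invr_ge0 ?(ltW c0)// ler_wpM2l ?expR_ge0// [leRHS]mulrDl.
  have k0 : 0 <= 2 * M / c1 ^+ 2 by rewrite divr_ge0 ?sqr_ge0// mulr_ge0// ltW.
  by apply: lerD; rewrite ler_wpM2l// ltW.
have arg z u : `|z| <= M -> `|u| <= M -> `|z - rho * u| <= 2 * M.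
  move=> zM uM; apply: le_trans (ler_normB _ _) _; rewrite normrM (ger0_norm r0).
  have : rho * `|u| <= `|u| by rewrite ler_piMl.
  lra.
have dexp x y : `|x| <= M -> `|y| <= M -> `|y - x| <= K * `|Phi y%:E - Phi x%:E|.
  move=> xM yM; rewrite -ler_pdivrMl ?invr_gt0// invrK; exact: Phi_expansion.
pose h := cond_cdf rho.
pose kap u s := - rho * gauss_ratio (sd rho) s (u - rho * s).
have kapL u s s' : `|u| <= M -> `|s| <= M -> `|s'| <= M ->
    `|kap u s - kap u s'| <= L * `|s - s'|.
  move=> uM sM s'M; rewrite /kap -mulrBr normrM normrN (ger0_norm r0).
  apply: le_trans (_ : 1 * (L * `|s - s'|) <= _); last by rewrite mul1r.
  rewrite ler_pM//; apply: Wlip => //; [exact: arg|exact: arg|].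
  rewrite [X in `|X| <= _](_ : _ = rho * (s' - s)); last by ring.
  by rewrite normrM (ger0_norm r0) distrC ler_piMl.
have kapLu u u' s : `|u| <= M -> `|u'| <= M -> `|s| <= M ->
    `|kap u s - kap u' s| <= L * `|u - u'|.
  move=> uM u'M sM; rewrite /kap -mulrBr normrM normrN (ger0_norm r0).
  apply: le_trans (_ : 1 * (L * `|u - u'|) <= _); last by rewrite mul1r.
  rewrite ler_pM//; apply: Wlip => //; [exact: arg|exact: arg|by rewrite subrr normr0|].
  by rewrite [X in `|X| <= _](_ : _ = u - u')//; ring.
pose r := gauss_ratio (sd rho) b (b - rho * a).
pose t := expR ((a ^+ 2 - b ^+ 2) / 2).
have t0 : 0 < t by exact: expR_gt0.
have kab : kap b a = - rho * (r * t).
  rewrite /kap /r /t /gauss_ratio -[in RHS]mulrA -expRD; congr (_ * (_ * expR _)); ring.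
have kba : kap a b = - rho * (r * t^-1).
  rewrite /kap /r /t /gauss_ratio -[in RHS]mulrA -expRN -expRD; congr (_ * (_ * expR _)).
  have c20 : 0 < 1 - rho ^+ 2 by rewrite subr_gt0 expr_lt1//; case/andP: r01.
  by rewrite sqr_sqrtr ?(ltW c20)//; field; rewrite gt_eqF.
exists (h b%:E a), (h a%:E b), r, t; split=> //; first by rewrite ltW// gauss_ratio_gt0.
move=> a' b' a'M b'M /=.
(* First [a] moves to [a'] at level [b'], then [b] to [b'] at level [a], the latter by symmetry.
   [E3] and [E4] bring the coefficients of the first move from [b'] back to [b]. *)
have E1 := second_order_expansion (fun s => is_derive_joint_cdf b' s r01)
  (fun s => is_derive_cond_cdf_s b' s r01) aM L0 (fun s sM => kapL b' s a b'M sM aM) a'M.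
have E2 := second_order_expansion (fun s => is_derive_joint_cdf a s r01)
  (fun s => is_derive_cond_cdf_s a s r01) bM L0 (fun s sM => kapL a s b aM sM bM) b'M.
have rL s : `|s| <= M -> `|gauss_ratio (sd rho) s (s - rho * a) - r| <= L * `|s - b|.
  move=> sM; apply: Wlip => //; [exact: arg|exact: arg|].
  by rewrite [X in `|X| <= _](_ : _ = s - b)//; ring.
have gL s : is_derive (s : R^o) 1 (fun b : R => cond_cdf rho b%:E a)
    (phi s * gauss_ratio (sd rho) s (s - rho * a)) := is_derive_cond_cdf_b s a r01.
have E3 := first_order_expansion gL bM L0 rL b'M.
have E4 := kapLu b' b a b'M bM aM.
have Dx := dexp a a' aM a'M; have Dy := dexp b b' bM b'M.
move: E1 E2 E3 E4 Dx Dy; rewrite -/(kap b' a) -/(kap a b) -/r -/(h b'%:E a) -/(h b%:E a) -/(h a%:E b) /=.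
rewrite ![joint_cdf rho _ a%:E]joint_cdf_sym// [joint_cdf rho a%:E b'%:E]joint_cdf_sym//.
set x := Phi a'%:E - _; set y := Phi b'%:E - _.
move: `|a' - a| (normr_ge0 (a' - a)) => dx dx0.
move: `|b' - b| (normr_ge0 (b' - b)) => dy dy0.
move=> /(le_trans (ler_norm _)) E1 /(le_trans (ler_norm _)) E2 E3 E4 Dx Dy.
rewrite kab kba in E1 E2 E4.
have X0 := normr_ge0 x; have Y0 := normr_ge0 y.
have x2 : x ^+ 2 = `|x| ^+ 2 by rewrite real_normK ?num_real.
have F3 : (h b'%:E a - h b%:E a - r * y) * x <= L * dy ^+ 2 * `|x|.
  by apply: le_trans (ler_norm _) _; rewrite normrM ler_wpM2r.
have F4 : (kap b' a - - rho * (r * t)) * x ^+ 2 <= L * dy * `|x| ^+ 2.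
  by apply: le_trans (ler_norm _) _; rewrite normrM normrX ler_wpM2r// sqr_ge0.
have K12 : K <= K ^+ 3 by rewrite ler_eXnr.
have K23 : K ^+ 2 <= K ^+ 3 by rewrite ler_weXn2l.
have pw n d z : 0 <= d -> d <= K * z -> d ^+ n <= K ^+ n * z ^+ n.
  by move=> d0 dz; rewrite -exprMn lerXn2r// nnegrE// (le_trans d0).
have B1 : L * dx ^+ 3 <= L * K ^+ 3 * `|x| ^+ 3.
  by rewrite -mulrA ler_wpM2l// pw.
have B2 : L * dy ^+ 3 <= L * K ^+ 3 * `|y| ^+ 3.
  by rewrite -mulrA ler_wpM2l// pw.
have B3 : L * dy ^+ 2 * `|x| <= L * K ^+ 3 * (`|x| * `|y| ^+ 2).
  have q2 : dy ^+ 2 <= K ^+ 3 * `|y| ^+ 2.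
    by apply: le_trans (pw 2 _ _ dy0 Dy) _; rewrite ler_wpM2r// exprn_ge0.
  rewrite [leRHS](_ : _ = L * (K ^+ 3 * `|y| ^+ 2) * `|x|); last by ring.
  by rewrite ler_wpM2r// ler_wpM2l.
have B4 : L * dy * `|x| ^+ 2 <= L * K ^+ 3 * (`|x| ^+ 2 * `|y|).
  have q1 : dy <= K ^+ 3 * `|y| by apply: le_trans Dy _; rewrite ler_wpM2r.
  rewrite [leRHS](_ : _ = L * (K ^+ 3 * `|y|) * `|x| ^+ 2); last by ring.
  by rewrite ler_wpM2r ?exprn_ge0// ler_wpM2l.
have B4' : 0 <= L * dy * `|x| ^+ 2 by apply: mulr_ge0; [apply: mulr_ge0|apply: exprn_ge0].
apply: le_trans (taylor_combine E1 E2 F3 F4 B4') _; rewrite lerD2l !mulrDr.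
by apply: lerD => //; apply: lerD => //; exact: lerD.
Qed.

End JointTaylor.

(** * Properties of the Gaussian stability *)

Section GaussianStability.
Import numFieldTopology.Exports numFieldNormedType.Exports.
Context {R : realType}.
Local Open Scope classical_set_scope.
Local Open Scope ereal_scope.
Local Notation mu := (@lebesgue_measure R).
Local Notation gauss := (normal_prob (0 : R) 1).
Local Notation sd rho := (Num.sqrt (1 - rho ^+ 2)%R).
Implicit Types (rho x y e : R) (a b : \bar R).
Local Opaque Phi Phi_inv joint_cdf cond_cdf Gamma_upper.

Lemma joint_cdf_le_shift rho a a' b : (joint_cdf rho a' b <= joint_cdf rho a b + `|Phi a' - Phi a|)%R.
Proof.
have [aa|/ltW aa] := leP a a'.
  rewrite -lerBlDl; apply: le_trans (joint_cdf_increment_le1 rho b aa) _.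
  exact: ler_norm.
by apply: le_trans (joint_cdf_le rho b aa) _; rewrite lerDl.
Qed.

Lemma Gamma_upper_lipschitz rho x y x' y' : (0 <= rho < 1)%R ->
  (0 <= x <= 1)%R -> (0 <= y <= 1)%R -> (0 <= x' <= 1)%R -> (0 <= y' <= 1)%R ->
  (Gamma_upper rho x' y' <= Gamma_upper rho x y + (`|x' - x| + `|y' - y|))%R.
Proof.
move=> r01 hx hy hx' hy'; rewrite !Gamma_upperE.
have h1 := joint_cdf_le_shift rho (Phi_inv x) (Phi_inv x') (Phi_inv y').
have h2 := joint_cdf_le_shift rho (Phi_inv y) (Phi_inv y') (Phi_inv x).
rewrite (Phi_Phi_inv hx') (Phi_Phi_inv hx) in h1.
rewrite (Phi_Phi_inv hy') (Phi_Phi_inv hy) in h2.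
rewrite (joint_cdf_sym (Phi_inv y') _ r01) (joint_cdf_sym (Phi_inv y) _ r01) in h2.
move: (joint_cdf _ _ _) (joint_cdf _ _ _) (joint_cdf _ _ _) h1 h2 => A B D h1 h2.
by lra.
Qed.

Lemma Gamma_upper_sym rho x y : (0 <= rho < 1)%R ->
  Gamma_upper rho x y = Gamma_upper rho y x.
Proof. by move=> r01; rewrite !Gamma_upperE joint_cdf_sym. Qed.

Lemma Gamma_upper_tangent rho x y : (0 <= rho < 1)%R -> (0 < x < 1)%R ->
  exists p, forall x', (0 <= x' <= 1)%R ->
  (Gamma_upper rho x' y <= Gamma_upper rho x y + p * (x' - x))%R.
Proof.
move=> r01 /Phi_inv_real[t [tx xt]]; exists (cond_cdf rho (Phi_inv y) t) => x' hx'.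
have r0 : (0 <= rho)%R by case/andP: r01.
have := joint_cdf_tangent t (Phi_inv x') (Phi_inv y) r0.
by rewrite !Gamma_upperE tx xt Phi_Phi_inv.
Qed.

(** By concavity in [x] the graph lies above its chord, which joins 0 at [x = 0] to [y] at
    [x = 1]. *)
Lemma Gamma_upper_ge_mul rho x y : (0 <= rho < 1)%R ->
  (0 <= x <= 1)%R -> (0 <= y <= 1)%R -> (x * y <= Gamma_upper rho x y)%R.
Proof.
move=> r01 /andP[x0 x1] hy.
have J0 : (0 <= Gamma_upper rho x y)%R by rewrite Gamma_upperE joint_cdf_ge0.
have J1 : Gamma_upper rho 1 y = y by rewrite Gamma_upperE Phi_inv1 joint_cdf_yl// Phi_Phi_inv.
have J00 : Gamma_upper rho 0 y = 0%R by rewrite Gamma_upperE Phi_inv0 joint_cdfNy.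
move: x0; rewrite le_eqVlt => /predU1P[<-|x0]; first by rewrite mul0r J00.
move: x1; rewrite le_eqVlt => /predU1P[->|x1]; first by rewrite mul1r J1.
have [|p Hp] := @Gamma_upper_tangent rho x y r01; first by rewrite x0.
have := Hp 0%R; have := Hp 1%R; rewrite J1 J00 !lexx ler01 => /(_ isT) h1 /(_ isT) h0.
move: (Gamma_upper rho x y) h0 h1 {J0 J1 J00 Hp} => J h0 h1.
have k1 : (0 <= x * (J + p * (1 - x) - y))%R by rewrite mulr_ge0 ?(ltW x0)// subr_ge0.
have k2 : (0 <= (1 - x) * (J + p * (0 - x)))%R by rewrite mulr_ge0 ?subr_ge0 ?(ltW x1).
by lra.
Qed.

Lemma Gamma_upper_taylor (rho1 d : R) : (0 <= rho1 < 1)%R -> (0 < d)%R ->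
  exists C : R, (0 <= C)%R /\
  forall rho x y, (0 <= rho <= rho1)%R -> (d <= x <= 1 - d)%R -> (d <= y <= 1 - d)%R ->
  exists p q r t : R, [/\ (0 <= r)%R, (0 < t)%R &
  forall x' y', (d <= x' <= 1 - d)%R -> (d <= y' <= 1 - d)%R ->
  (Gamma_upper rho x' y' <= Gamma_upper rho x y + p * (x' - x) + q * (y' - y)
    + 2^-1 * r * (2 * ((x' - x) * (y' - y)) - rho * (t * (x' - x) ^+ 2 + t^-1 * (y' - y) ^+ 2))
    + C * (`|x' - x| ^+ 3 + `|x' - x| * `|y' - y| ^+ 2 +
           `|x' - x| ^+ 2 * `|y' - y| + `|y' - y| ^+ 3))%R].
Proof.
move=> r101 d0; have [M [M0 HM]] := @Phi_inv_bounded R d d0.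
have [C [C0 HC]] := joint_cdf_taylor r101 M0.
have inv z : (d <= z <= 1 - d)%R -> exists t : R, [/\ Phi_inv z = t%:E, Phi t%:E = z & (`|t| <= M)%R].
  move=> hz; have [|t [tz zt]] := @Phi_inv_real R z.
    by case/andP: hz => h1 h2; apply/andP; split; lra.
  by exists t; split=> //; exact: HM hz zt.
exists C; split=> // rho x y hr /inv[s [sx xs sM]] /inv[t [ty yt tM]].
have [p [q [r [u [r0 u0 H]]]]] := HC rho s t hr sM tM.
exists p, q, r, u; split=> // x' y' /inv[s' [sx' xs' sM']] /inv[t' [ty' yt' tM']].
by have := H s' t' sM' tM'; rewrite !Gamma_upperE sx ty sx' ty' xs yt xs' yt'.
Qed.

(** The drift [- (1 - rho) s] is at most [w M] because [s >= - M], and so is [c z]; together they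
    use up the gap [e]. *)
Lemma affine_below (rho c w M e s t z : R) : (0 <= M)%R -> (0 <= c <= w)%R ->
  (0 <= 1 - rho <= w)%R -> (w * (2 * M) <= e)%R ->
  (- M <= s)%R -> (s <= t - e)%R -> (z <= M)%R -> (rho * s + c * z <= t)%R.
Proof.
move=> M0 /andP[c0 cw] /andP[r0 rw] wM Ms st zM.
have cz : (c * z <= w * M)%R by apply: le_trans (ler_wpM2l c0 zM) _; rewrite ler_wpM2r.
have q1 : ((1 - rho) * (- M) <= (1 - rho) * s)%R by rewrite ler_wpM2l.
have q2 : ((1 - rho) * M <= w * M)%R by rewrite ler_wpM2r.
by lra.
Qed.

Lemma Gamma_upper_near1 e : (0 < e)%R ->
  exists rho1 : R, (0 <= rho1 < 1)%R /\
  forall rho x y, (rho1 <= rho <= 1)%R -> (0 <= x <= 1)%R -> (0 <= y <= 1)%R ->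
  (Num.min x y - e <= Gamma_upper rho x y)%R.
Proof.
move=> e0; have [|M [M0 M1 M2]] := @Phi_tail R (e / 4); first by rewrite divr_gt0.
pose w : R := Num.min 1%R (e / 4 / (2 * M))%R.
have w0 : (0 < w)%R by rewrite lt_min ltr01 divr_gt0 ?divr_gt0 ?mulr_gt0.
have w1 : (w <= 1)%R by rewrite ge_min lexx.
have wM : (w * (2 * M) <= e / 4)%R.
  by rewrite -ler_pdivlMr ?mulr_gt0// ge_min lexx orbT.
have w2 : (w ^+ 2 <= w)%R by rewrite expr2 ler_piMl// ltW.
have w20 : (0 < w ^+ 2)%R by rewrite exprn_gt0.
(* Then [1 - rho ^+ 2 <= 2 (1 - rho) <= w ^+ 2], so the conditional standard deviation is at most
   [w]. *)
exists (1 - w ^+ 2 / 2)%R; split; first by apply/andP; split; lra.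
move=> rho x y /andP[r1 r2] hx hy.
have r0 : (0 <= rho)%R by lra.
have c0 : (0 <= sd rho)%R by exact: sqrtr_ge0.
have cw : (sd rho <= w)%R.
  have rr : (0 <= (1 - rho) ^+ 2)%R by rewrite sqr_ge0.
  have r3 : (0 <= 1 - rho ^+ 2)%R by rewrite subr_ge0 expr_le1.
  rewrite -(@ler_pXn2r _ 2)// ?nnegrE ?(ltW w0)// sqr_sqrtr//; lra.
have rw : (0 <= 1 - rho <= w)%R by apply/andP; split; lra.
(* For [Y = rho X + sd rho Z], the conditions [- M < X <= t - e / 4] and [Z <= M] force [Y <= t].
   Compared with [X <= t], each of the three restrictions loses at most [e / 4]. *)
have main (t : R) b : t%:E <= b -> (Phi t%:E - e <= joint_cdf rho t%:E b)%R.
  move=> tb.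
  have h4 : (Phi t%:E - Phi (t - e / 4)%:E <= e / 4)%R.
    apply: le_trans (ler_norm _) _; apply: le_trans (Phi_lipschitz _ _) _.
    by rewrite opprB addrC subrK ger0_norm// divr_ge0// ltW.
  have h3 := joint_cdf_ge0 rho (- M)%:E b.
  have [tM|tM] := leP (t - e / 4)%R (- M)%R.
    have h2 : (Phi (t - e / 4)%:E <= Phi (- M)%:E)%R by rewrite Phi_le// lee_fin.
    have h5 := joint_cdf_ge0 rho t%:E b.
    move: (joint_cdf _ _ _) (Phi _) (Phi _) (Phi _) h2 h4 h5 M2 => ? ? ? ?; lra.
  have le1 : (t - e / 4)%:E <= t%:E by rewrite lee_fin; lra.
  have le2 : (- M)%:E <= (t - e / 4)%:E by rewrite lee_fin ltW.
  have h1 := joint_cdf_le rho b le1.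
  have h2 : ((1 - e / 4) * (Phi (t - e / 4)%:E - Phi (- M)%:E) <=
      joint_cdf rho (t - e / 4)%:E b - joint_cdf rho (- M)%:E b)%R.
    have [k0|k0] := leP 0%R (1 - e / 4)%R; last first.
      apply: (@le_trans _ _ 0%R).
        by rewrite mulr_le0_ge0 ?(ltW k0)// subr_ge0 Phi_le.
      by rewrite subr_ge0 joint_cdf_le.
    apply: joint_cdf_increment_ge => // s /andP[]; rewrite lte_fin lee_fin => s1 s2.
    apply: le_trans M1 _; rewrite -lee_fin -gauss_lower_ray -cond_lawE le_measure ?inE//.
    - exact: measurable_lower_ray.
    - by apply: measurable_section; exact: measurable_lower_ray.
    move=> z /=; rewrite /lower_ray/= lee_fin => zM; apply: le_trans tb; rewrite lee_fin.
    by apply: (affine_below (ltW M0) _ rw wM (ltW s1) s2 zM); rewrite c0 cw.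
  have h6 := Phi_le1 (t - e / 4)%:E; have h7 := Phi_ge0 (- M)%:E.
  move: (joint_cdf rho t%:E b) (joint_cdf rho (- M)%:E b) (joint_cdf rho (t - e / 4)%:E b) h1 h2 h3.
  move: (Phi t%:E) (Phi (- M)%:E) (Phi (t - e / 4)%:E) h4 h6 h7 M2 => p1 p2 p3 h4 h6 h7 M2' j1 j2 j3 h1 h2 h3.
  have h8 : (e / 4 * (p3 - p2) <= e / 4 * 1)%R.
    by apply: ler_wpM2l; [rewrite divr_ge0// ltW|lra].
  by lra.
rewrite Gamma_upperE; have J0 := joint_cdf_ge0 rho (Phi_inv x) (Phi_inv y).
have x_min : (Num.min x y <= x)%R by rewrite ge_min lexx.
have y_min : (Num.min x y <= y)%R by rewrite ge_min lexx orbT.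
have px := Phi_Phi_inv hx; have py := Phi_Phi_inv hy.
have [xy|/ltW yx] := leP (Phi_inv x) (Phi_inv y).
  move: xy px J0; case: (Phi_inv x) => [t| |] xy px J0.
  - by apply: le_trans (main t _ xy); rewrite px lerD2r.
  - move: xy; rewrite leye_eq => /eqP ->; rewrite joint_cdf_yr px.
    by rewrite lerBlDr (le_trans x_min)// lerDl ltW.
  - by move: px; rewrite PhiNy => x0; apply: le_trans J0; rewrite lerBlDr add0r (le_trans x_min)// -x0 ltW.
apply: le_trans (joint_cdf_le rho (Phi_inv y) yx).
move: yx py; case: (Phi_inv y) => [t| |] yx py.
- by apply: le_trans (main t _ (lexx _)); rewrite py lerD2r.
- by rewrite joint_cdf_yr py lerBlDr (le_trans y_min)// lerDl ltW.
- move: py; rewrite PhiNy => y0; apply: le_trans (joint_cdf_ge0 rho -oo -oo).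
  by rewrite lerBlDr add0r (le_trans y_min)// -y0 ltW.
Qed.

End GaussianStability.

(** * From upper to lower stability *)

Section LowerStability.
Import numFieldTopology.Exports numFieldNormedType.Exports.
Context {R : realType}.
Local Open Scope classical_set_scope.
Local Open Scope ereal_scope.
Local Notation mu := (@lebesgue_measure R).
Local Notation gauss := (normal_prob (0 : R) 1).
Local Notation sd rho := (Num.sqrt (1 - rho ^+ 2)%R).
Implicit Types (rho : R) (a b : \bar R).

Lemma gauss_set1 (x : R) : gauss [set x] = 0.
Proof.
have /null_content_dominatesP dom : gauss `<< mu by exact: normal_prob_dominates.
by apply: dom; [exact: measurable_set1|exact: lebesgue_measure_set1].
Qed.

(** The events defining [Gamma_lower] and [Gamma_upper] overlap on such a line. For [rho = 1] the
    conditional law is a point mass at [s], and it is the law of the first variable that has no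
    atoms. *)
Lemma gaussian2_line rho (b : R) : (0 <= rho <= 1)%R ->
  gaussian2 rho (setT `*` [set b]) = 0.
Proof.
move=> /andP[r0]; rewrite le_eqVlt => r1.
have m1 : measurable ([set b] : set (measurableTypeR R)) by exact: measurable_set1.
rewrite gaussian2E//.
have [r1'|r1'] := predU1P r1.
  have -> : cond_law rho [set b] = fun s => (\1_([set b] : set R) s)%:E.
    apply/funext => s; rewrite /cond_law r1' expr1n subrr sqrtr0.
    rewrite indicE; have [sb|sb] := pselect (s = b).
      rewrite mem_set// (_ : [set z | _] = setT) ?probability_setT//.
      by apply/seteqP; split => // z _ /=; rewrite mul1r mul0r addr0.
    rewrite memNset// (_ : [set z | _] = set0) ?measure0//.
    by apply/seteqP; split => // z /=; rewrite mul1r mul0r addr0.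
  by rewrite integral_indic// setIT; exact: gauss_set1.
rewrite -[RHS](@integral0 _ _ _ gauss setT); apply: eq_integral => s _.
have c0 := sd_gt0 (introT andP (conj r0 r1')); rewrite /cond_law.
rewrite (_ : [set z | _] = [set ((b - rho * s) / sd rho)%R]) ?gauss_set1//.
apply/seteqP; split => z /=.
  by move=> <-; rewrite addrAC subrr add0r mulrAC mulfV ?mul1r// gt_eqF.
by move=> ->; rewrite mulrCA mulfV ?gt_eqF// mulr1 addrC subrK.
Qed.

Lemma Gamma_lower_le rho x y : (0 <= rho <= 1)%R -> (0 <= x <= 1)%R ->
  (Gamma_lower rho x y <= x - Gamma_upper rho x (1 - y))%R.
Proof.
move=> r01 hx; rewrite /Gamma_lower Gamma_upperE.
set a := Phi_inv x; set b := Phi_inv (1 - y)%R.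
pose pre (A B : set R) := [set z : measurableTypeR R * measurableTypeR R | A z.1 /\ B (rho * z.1 + sd rho * z.2)%R].
have ma := measurable_lower_ray a; have mb := measurable_lower_ray b.
pose N := [set y : R | y%:E = b].
have [mN N0] : measurable (N : set (measurableTypeR R)) /\ (gauss \x gauss) (pre setT N) = 0.
  rewrite /N; case: (b) => [r| |].
  - rewrite (_ : [set y : R | _] = [set r]); last first.
      by apply/seteqP; split => z /= => [[]|->].
    by split; [exact: measurable_set1|exact: (gaussian2_line r r01)].
  - rewrite (_ : [set y : R | _] = set0); last by apply/seteqP; split.
    by split=> //; rewrite (_ : pre _ _ = set0) ?measure0//; apply/seteqP; split => // z [].
  - rewrite (_ : [set y : R | _] = set0); last by apply/seteqP; split.
    by split=> //; rewrite (_ : pre _ _ = set0) ?measure0//; apply/seteqP; split => // z [].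
pose U := [set y : R | b <= y%:E].
have mU : measurable (U : set (measurableTypeR R)).
  have -> : U = ~` (lower_ray b) `|` N.
    apply/seteqP; split => z; rewrite /U /N /lower_ray /=.
      by rewrite le_eqVlt => /predU1P[->|bz]; [right|left; apply/negP; rewrite -ltNge].
    by move=> [/negP|->//]; rewrite -ltNge => /ltW.
  by apply: measurableU => //; exact: measurableC.
have m0 := measurable_gaussian2_preimage rho ma measurableT.
have m1 := measurable_gaussian2_preimage rho ma mb.
have m2 := measurable_gaussian2_preimage rho ma mU.
have m3 := measurable_gaussian2_preimage rho measurableT mN.
have e0 : (gauss \x gauss) (pre (lower_ray a) setT) = x%:E.
  by rewrite -(Phi_Phi_inv hx) -(joint_cdf_yr rho) -gaussian2_joint_cdf lower_rayy.
have e1 : (gauss \x gauss) (pre (lower_ray a) (lower_ray b)) = (joint_cdf rho a b)%:E.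
  by rewrite -gaussian2_joint_cdf.
have : (gauss \x gauss) (pre (lower_ray a) U) <= (x - joint_cdf rho a b)%:E.
  apply: (@le_trans _ _ ((gauss \x gauss)
     ((pre (lower_ray a) setT `\` pre (lower_ray a) (lower_ray b)) `|` pre setT N))).
    apply: le_measure; rewrite ?inE//.
      by apply: measurableU => //; exact: measurableD.
    move=> z [za]; rewrite /U /= => bz.
    have [zb|zb] := pselect ((rho * z.1 + sd rho * z.2)%R%:E = b); first by right.
    left; split=> //; rewrite /pre /= => -[_]; rewrite /lower_ray /= => zb'.
    by apply: zb; apply/eqP; rewrite eq_le bz zb'.
  apply: le_trans (measureU2 _ _ _) _ => //; first exact: measurableD.
  have me : (gauss \x gauss) (pre (lower_ray a) setT) < +oo by rewrite e0 ltry.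
  rewrite [X in _ + X]N0 adde0 (measureD m0 m1 me).
  rewrite (_ : _ `&` _ = pre (lower_ray a) (lower_ray b)); last first.
    by apply/setIidPr => z [].
  by rewrite [X in X - _]e0 [X in _ - X]e1.
move=> le; rewrite -lee_fin fineK; first exact: le.
rewrite ge0_fin_numE; first exact: (le_lt_trans le (ltry _)).
exact: (measure_ge0 (gauss \x gauss) (pre (lower_ray a) U)).
Qed.

End LowerStability.

(** * Products of two functions *)

Section StabilityFunction.
Context {R : realType}.
Implicit Types (St : R -> R -> R) (rho d C : R).

(* When [x'] and [y'] are random with means [x] and [y] and correlation at most
   [rho], the quadratic term has nonpositive mean by Cauchy-Schwarz. *)
Definition taylor_bound St rho d C : Prop :=
  forall x y, d <= x <= 1 - d -> d <= y <= 1 - d ->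
  exists p q r t : R, [/\ 0 <= r, 0 < t &
  forall x' y', d <= x' <= 1 - d -> d <= y' <= 1 - d ->
  St x' y' <= St x y + p * (x' - x) + q * (y' - y)
    + 2^-1 * r * (2 * ((x' - x) * (y' - y)) - rho * (t * (x' - x) ^+ 2 + t^-1 * (y' - y) ^+ 2))
    + C * (`|x' - x| ^+ 3 + `|x' - x| * `|y' - y| ^+ 2 +
           `|x' - x| ^+ 2 * `|y' - y| + `|y' - y| ^+ 3)].

Definition lipschitz1 St : Prop := forall x y x' y',
  0 <= x <= 1 -> 0 <= y <= 1 -> 0 <= x' <= 1 -> 0 <= y' <= 1 ->
  St x' y' <= St x y + (`|x' - x| + `|y' - y|).

(** Concavity in the first variable, in the form in which Jensen's inequality uses it. *)
Definition supporting_lines St : Prop := forall x y, 0 < x < 1 ->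
  exists p, forall x', 0 <= x' <= 1 -> St x' y <= St x y + p * (x' - x).

End StabilityFunction.

Section StabilityStep.
Context {R : realType} {T : finType}.
Variable St : R -> R -> R.
Variable Q : T -> R.
Hypothesis probQ : is_prob Q.
Implicit Types (u v : T -> R) (rho d : R).

(** [2 c <= 2 rho sqrt (V W) <= rho (t V + W / t)], proved after squaring. *)
Lemma young_covariance (rho c V W t : R) : 0 <= rho -> 0 < t -> 0 <= V -> 0 <= W ->
  c ^+ 2 <= rho ^+ 2 * (V * W) -> 2 * c <= rho * (t * V + t^-1 * W).
Proof.
move=> r0 t0 V0 W0 hc.
have t1 : 0 <= t^-1 by rewrite invr_ge0 ltW.
have A0 : 0 <= t * V by rewrite mulr_ge0// ltW.
have B0 : 0 <= t^-1 * W by rewrite mulr_ge0.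
have AB : V * W = (t * V) * (t^-1 * W) by rewrite mulrACA mulfV ?mul1r// gt_eqF.
rewrite AB in hc; move: (t * V) (t^-1 * W) A0 B0 hc => A B A0 B0 hc.
have s0 : 0 <= rho * (A + B) by rewrite mulr_ge0// addr_ge0.
apply: le_trans (ler_norm _) _.
rewrite -(@ler_pXn2r _ 2)// ?nnegrE// real_normK ?num_real// !exprMn.
have h : 0 <= rho ^+ 2 * (A - B) ^+ 2 by rewrite mulr_ge0 ?sqr_ge0.
by lra.
Qed.

Lemma Ex_range u (a b : R) : (forall x, a <= u x <= b) -> a <= Ex Q u <= b.
Proof.
move=> hu; apply/andP; split.
  by rewrite -[leLHS](Ex_cst a probQ) (posf_le (Ex_prob probQ))// => x; case/andP: (hu x).
by rewrite -[leRHS](Ex_cst b probQ) (posf_le (Ex_prob probQ))// => x; case/andP: (hu x).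
Qed.

Lemma Ex_taylor_bound rho d C u v : 0 <= rho ->
  taylor_bound St rho d C ->
  (forall x, d <= u x <= 1 - d) -> (forall x, d <= v x <= 1 - d) ->
  Cov Q u v ^+ 2 <= rho ^+ 2 * (Var Q u * Var Q v) ->
  Ex Q (fun x => St (u x) (v x)) <= St (Ex Q u) (Ex Q v) +
    C * Ex Q (fun x => `|u x - Ex Q u| ^+ 3 + `|u x - Ex Q u| * `|v x - Ex Q v| ^+ 2 +
           `|u x - Ex Q u| ^+ 2 * `|v x - Ex Q v| + `|v x - Ex Q v| ^+ 3).
Proof.
move=> r0 taylor hu hv cov.
have [p [q [r [t [rr0 t0 H]]]]] := taylor _ _ (Ex_range hu) (Ex_range hv).
have pE := Ex_prob probQ.
set a := Ex Q u in H *; set b := Ex Q v in H *.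
apply: (le_trans (posf_le pE (fun x => H _ _ (hu x) (hv x)))).
rewrite !(posfD pE) !(posfZ pE) !(posfB pE) !(posfZ pE) !(posfD pE) !(posfZ pE) !Ex_cst// !subrr !mulr0 !addr0.
rewrite lerD2r gerDl mulr_ge0_le0//; first by rewrite mulr_ge0// invr_ge0.
rewrite subr_le0 -!VarE -/(Cov Q u v).
by apply: young_covariance => //; exact: Var_ge0.
Qed.

(** Only the increments of [v] enter the error: those of [u] are removed by a supporting line, whose
    linear term has mean zero. *)
Lemma Ex_lipschitz u v : lipschitz1 St -> supporting_lines St ->
  (forall x, 0 <= u x <= 1) -> (forall x, 0 <= v x <= 1) -> 0 < Ex Q u < 1 ->
  Ex Q (fun x => St (u x) (v x)) <=
  St (Ex Q u) (Ex Q v) + Ex Q (fun x => `|v x - Ex Q v|).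
Proof.
move=> lip supp hu hv e01; have pE := Ex_prob probQ.
have [p Hp] := supp _ (Ex Q v) e01.
have hv' := Ex_range hv.
apply: (@le_trans _ _ (Ex Q (fun x => St (Ex Q u) (Ex Q v) + p * (u x - Ex Q u) + `|v x - Ex Q v|))).
  apply: (posf_le pE) => x.
  have h1 := lip (u x) (Ex Q v) (u x) (v x) (hu x) hv' (hu x) (hv x).
  by apply: le_trans h1 _; rewrite subrr normr0 add0r lerD2r; exact: Hp.
by rewrite !(posfD pE) !(posfZ pE) !(posfB pE) !Ex_cst// subrr mulr0 addr0.
Qed.

End StabilityStep.

Section CoordinateStep.
Context {R : realType} {I J : finType} {T : I -> J -> finType}.
Local Notation W := (fun i => {dffun forall j, T i j}).
Local Notation Om := ({dffun forall i, W i}).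
Variable P : forall i, W i -> R.
Arguments P : clear implicits.
Hypothesis probP : forall i, is_prob (P i).
Local Notation Exp := (Ex (prod_prob P)).
Let posE : pos_functional Exp := Exp_pos probP.
Variable St : R -> R -> R.
Hypothesis (St_lip : lipschitz1 St) (St_supp : supporting_lines St).
Hypothesis St_sym : forall x y, St x y = St y x.
Implicit Types (F G : Om -> R) (rho d : R) (S : {set J}).

Local Notation stab F G := (Exp (fun w => St (F w) (G w))).

Lemma Exp_norm_le g : Exp (fun w => `|g w|) <= Num.sqrt (nrm2 Exp g).
Proof.
have := posf_CS_le posE (f := fun w => `|g w|) (g := fun=> 1) (sqrtr_ge0 (nrm2 Exp g)) ler01.
rewrite mulr1 sqr_sqrtr ?nrm2_ge0// => H; rewrite -[X in Exp X](_ : (fun w => `|g w| * 1) = _); last first.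
  by apply/funext => w; rewrite mulr1.
apply: le_trans (ler_norm _) (H _ _).
  by rewrite (_ : (fun w => `|g w| ^+ 2) = fun w => g w ^+ 2)//; apply/funext => w; rewrite real_normK ?num_real.
by rewrite Ex_cst ?expr1n//; exact: prod_prob_is_prob.
Qed.

Lemma Exp_Av_le i (f g h : Om -> R) (c : R) :
  (forall w, Av P i f w <= g w + c * Av P i h w) -> Exp f <= Exp g + c * Exp h.
Proof.
move=> H; rewrite -(Exp_Av probP i f) -(Exp_Av probP i h) -(posfZ posE) -(posfD posE).
exact: (posf_le posE).
Qed.

Lemma stability_step_taylor i rho d C S S' F G : 0 <= rho ->
  taylor_bound St rho d C ->
  (forall w, d <= F w <= 1 - d) -> (forall w, d <= G w <= 1 - d) ->
  coord_depends i S F -> coord_depends i S' G -> correlation2 (P i) S S' <= rho ->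
  stab F G <= stab (Av P i F) (Av P i G) +
    C * (Exp (fun w => `|Dif P i F w| * Dif P i F w ^+ 2) +
         Exp (fun w => `|Dif P i F w| * Dif P i G w ^+ 2) +
         Exp (fun w => `|Dif P i G w| * Dif P i F w ^+ 2) +
         Exp (fun w => `|Dif P i G w| * Dif P i G w ^+ 2)).
Proof.
move=> r0 taylor hF hG dF dG cor.
pose err w := `|Dif P i F w| * Dif P i F w ^+ 2 + `|Dif P i F w| * Dif P i G w ^+ 2 +
  `|Dif P i G w| * Dif P i F w ^+ 2 + `|Dif P i G w| * Dif P i G w ^+ 2.
pose st w := St (F w) (G w).
pose st' w := St (Av P i F w) (Av P i G w).
have <- : Exp err = Exp (fun w => `|Dif P i F w| * Dif P i F w ^+ 2) +
    Exp (fun w => `|Dif P i F w| * Dif P i G w ^+ 2) +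
    Exp (fun w => `|Dif P i G w| * Dif P i F w ^+ 2) +
    Exp (fun w => `|Dif P i G w| * Dif P i G w ^+ 2).
  by rewrite !(posfD posE).
apply: (@Exp_Av_le i st st' err) => w; rewrite /Av /st /st' /err.
have := Ex_taylor_bound (probP i) r0 taylor (fun a => hF (upd w a)) (fun a => hG (upd w a))
  (Cov_correlation2_sqr (probP i) (dF w) (dG w) cor).
rewrite -!/(Av P i _ w) => h; apply: le_trans h _; rewrite lerD2l.
rewrite (_ : (fun a => _ + _ + _ + _) = fun a => `|Dif P i F (upd w a)| * Dif P i F (upd w a) ^+ 2 +
   `|Dif P i F (upd w a)| * Dif P i G (upd w a) ^+ 2 +
   `|Dif P i G (upd w a)| * Dif P i F (upd w a) ^+ 2 +
   `|Dif P i G (upd w a)| * Dif P i G (upd w a) ^+ 2)//.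
apply/funext => a; rewrite /Dif /co !Av_upd.
rewrite -[(F _ - _) ^+ 2]real_normK ?num_real// -[(G _ - _) ^+ 2]real_normK ?num_real//.
by rewrite !exprS expr0; ring.
Qed.

Lemma stability_step_lipschitz i d F G : 0 < d ->
  (forall w, d <= F w <= 1 - d) -> (forall w, d <= G w <= 1 - d) ->
  stab F G <= stab (Av P i F) (Av P i G) +
    Num.sqrt (Num.min (nrm2 Exp (Dif P i F)) (nrm2 Exp (Dif P i G))).
Proof.
move=> d0.
have h01 z : d <= z <= 1 - d -> 0 <= z <= 1 by move=> /andP[? ?]; apply/andP; split; lra.
have o01 z : d <= z <= 1 - d -> 0 < z < 1 by move=> /andP[? ?]; apply/andP; split; lra.
have H F' G' : (forall w, d <= F' w <= 1 - d) -> (forall w, d <= G' w <= 1 - d) ->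
    stab F' G' <= stab (Av P i F') (Av P i G') + Num.sqrt (nrm2 Exp (Dif P i G')).
  move=> hF hG; apply: (@le_trans _ _ (stab (Av P i F') (Av P i G') + Exp (fun w => `|Dif P i G' w|))).
    rewrite -[X in _ + X]mul1r.
    apply: (@Exp_Av_le i (fun w => St (F' w) (G' w))
      (fun w => St (Av P i F' w) (Av P i G' w))
      (fun w => `|Dif P i G' w|)) => w; rewrite mul1r /Av.
    have uF := Ex_range (probP i) (fun a => hF (upd w a)).
    have := Ex_lipschitz (probP i) St_lip St_supp (fun a => h01 _ (hF (upd w a)))
      (fun a => h01 _ (hG (upd w a))) (o01 _ uF).
    rewrite -!/(Av P i _ w) => h; apply: le_trans h _; rewrite lerD2l.
    rewrite (_ : (fun a => `|G' (upd w a) - _|) = fun a => `|Dif P i G' (upd w a)|)//.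
    by apply/funext => a; rewrite /Dif /co !Av_upd.
  by rewrite lerD2l; exact: Exp_norm_le.
move=> hF hG; rewrite minEle; case: ifP => _; last exact: H.
rewrite (_ : (fun w => St (F w) (G w)) = fun w => St (G w) (F w)); last first.
  by apply/funext => w; rewrite St_sym.
rewrite (_ : (fun w => St (Av P i F w) (Av P i G w)) =
    fun w => St (Av P i G w) (Av P i F w)); last first.
  by apply/funext => w; rewrite St_sym.
exact: H.
Qed.

End CoordinateStep.

Section ProductStability.
Context {R : realType}.

Lemma exists_small_factor (x y : R) : 0 < x -> 0 <= y -> exists2 t, 0 < t & y * t <= x.
Proof.
move=> x0 y0; have y1 : 0 < y + 1 by lra.
exists (x / (y + 1)); first exact: divr_gt0.
by rewrite mulrCA ger_pMr// ler_pdivrMr// mul1r; lra.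
Qed.

Lemma mulr_perturb (d x y x1 y1 : R) : 0 <= x <= 1 -> 0 <= y1 <= 1 ->
  `|x1 - x| <= d -> `|y1 - y| <= d -> x * y <= x1 * y1 + 2 * d.
Proof.
move=> /andP[x0 x_le1] /andP[y10 y1_le1]; rewrite !ler_norml => /andP[h1 h2] /andP[h3 h4].
have d0 : 0 <= d by lra.
have k1 : x * (y - y1) <= x * d by rewrite ler_wpM2l//; lra.
have k2 : (x - x1) * y1 <= d * y1 by rewrite ler_wpM2r//; lra.
have k3 : x * d <= 1 * d by rewrite ler_wpM2r.
have k4 : d * y1 <= d * 1 by rewrite ler_wpM2l.
by lra.
Qed.

(** Of [Gamma_upper] only the five properties assumed for [St] are used. When an influence of the
    smoothed functions exceeds [t ^+ 2], the Lipschitz cost [t'] is charged to the influences as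
    [t' / t ^+ 2 * (IF i + IG i)], whose sum over [i] is at most [2 K t' / t ^+ 2]. Hence [t'] is
    chosen after [t], and [tau] is [t' ^+ 2]. *)
Lemma product_stability_bound (eps alpha rho d C : R) :
  0 < eps -> 0 < alpha -> 0 <= rho < 1 -> 0 < d <= 2^-1 -> 0 <= C ->
  exists tau : R, 0 < tau /\
  forall (I J : finType) (T : I -> J -> finType)
    (P : forall i, {dffun forall j, T i j} -> R),
  (forall i, is_prob (P i)) -> (forall i x, 0 < P i x -> alpha <= P i x) ->
  (forall i j, correlation2 (P i) (~: [set j]) [set j] <= rho) ->
  forall (j l : J) (F G : {dffun forall i, {dffun forall j, T i j}} -> R)
    (rho' : R) (St : R -> R -> R),
  j != l -> (forall w, 0 <= F w <= 1) -> (forall w, 0 <= G w <= 1) ->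
  (forall i, coord_depends i [set j] F) -> (forall i, coord_depends i [set l] G) ->
  0 <= rho' -> (forall i, correlation2 (P i) [set j] [set l] <= rho') ->
  taylor_bound St rho' d C -> lipschitz1 St -> supporting_lines St ->
  (forall x y, St x y = St y x) ->
  (forall x y, 0 <= x <= 1 -> 0 <= y <= 1 -> x * y <= St x y) ->
  (forall i, Num.min (nrm2 (Ex (prod_prob P)) (Dif P i F))
                     (nrm2 (Ex (prod_prob P)) (Dif P i G)) <= tau) ->
  Ex (prod_prob P) (fun w => F w * G w) <=
  St (Ex (prod_prob P) F) (Ex (prod_prob P) G) + 4 * d + eps.
Proof.
move=> eps0 alpha0 rho01 /andP[d0 d12] C0.
(* Budget: [eps / 8] for smoothing each function, and [eps / 4] for each of the [H] sums, the [M]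
   sums and the coordinates of large influence. The rescaling into [[d, 1 - d]] costs [2 * d] on
   either side. *)
have e0 : 0 < eps / 8 by lra.
have eps4 : 0 < eps / 4 by lra.
have [b [m [b0 b1 hb hm]]] := smoothing_parameter rho01 e0.
have b01 : 0 < b < 1 by rewrite b0.
have bb01 : 0 <= b * b <= 1 by rewrite mulr_ge0 ?mulr_ile1 ?ltW.
have [dl dl0 Hdl] := exists_small_factor eps4 (mulr_ge0 (ler0n R 4) C0).
have [M0 [M00 HM0]] := third_moment_bound alpha0 b0 b1 dl0.
have [t t0 Ht] := exists_small_factor eps4 (mulr_ge0 (mulr_ge0 (ler0n R 4) C0) M00).
have bb2 : 0 < 1 - (b * b) ^+ 2.
  rewrite subr_gt0 expr_lt1//; last by case/andP: bb01.
  by rewrite (lt_trans _ b1)// gtr_pMl.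
pose K := (1 - (b * b) ^+ 2)^-1; have K0 : 0 < K by rewrite invr_gt0.
have k20 : 0 <= 2 * K / t ^+ 2 by rewrite divr_ge0 ?mulr_ge0 ?sqr_ge0// ltW.
have [t' t'0 Ht'] := exists_small_factor eps4 k20.
exists (t' ^+ 2); split; first by rewrite exprn_gt0.
move=> I J T P probP atomP corP j l F G rho' St jl F01 G01 dF dG r'0 corP' taylor lip supp sym ge_mul hmin.
set Exp := Ex (prod_prob P); have posE : pos_functional Exp := Exp_pos probP.
have pP := prod_prob_is_prob probP.
(* The Taylor bound holds only away from the ends of [[0, 1]]; the rescaling that achieves this does
   not increase influences. *)
have scale h : (forall w, 0 <= h w <= 1) ->
    [/\ forall w, d <= d + (1 - 2 * d) * h w <= 1 - d,
        forall w, `|d + (1 - 2 * d) * h w - h w| <= d,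
        Exp (fun w => d + (1 - 2 * d) * h w) = d + (1 - 2 * d) * Exp h
      & forall i, nrm2 Exp (Dif P i (fun w => d + (1 - 2 * d) * h w)) <= nrm2 Exp (Dif P i h)].
  move=> h01; have c0 : 0 <= 1 - 2 * d by lra.
  split=> [w|w||i].
  - have /andP[h0 h1] := h01 w; apply/andP; split.
      by rewrite lerDl mulr_ge0.
    have : (1 - 2 * d) * h w <= (1 - 2 * d) * 1 by rewrite ler_wpM2l.
    by lra.
  - have /andP[h0 h1] := h01 w.
    have k1 : 0 <= d * h w by rewrite mulr_ge0// ltW.
    have k2 : d * h w <= d * 1 by rewrite ler_wpM2l// ltW.
    by rewrite ler_norml; apply/andP; split; lra.
  - by rewrite (posfD posE) (posfZ posE) /Exp Ex_cst.
  - rewrite (_ : Dif P i _ = fun w => (1 - 2 * d) * Dif P i h w); last first.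
      have := Dif_linear P i (1 - 2 * d) h (fun=> d).
      rewrite (_ : (fun w => (1 - 2 * d) * h w + d) = fun w => d + (1 - 2 * d) * h w).
        move=> ->; apply/funext => w; rewrite [Dif P i (fun=> d)](_ : _ = fun=> 0) ?addr0//.
        by apply/funext => x; rewrite /Dif /co Av_cst// subrr.
      by apply/funext => w; rewrite addrC.
    apply: (posf_le posE) => w; rewrite exprMn ler_piMl ?sqr_ge0//.
    by rewrite expr_le1//; lra.
have [F1d F1c F1E F1I] := scale F F01; have [G1d G1c G1E G1I] := scale G G01.
set F1 := fun w => d + (1 - 2 * d) * F w in F1d F1c F1E F1I.
set G1 := fun w => d + (1 - 2 * d) * G w in G1d G1c G1E G1I.
have d01 z : d <= z <= 1 - d -> 0 <= z <= 1.
  move=> /andP[z0 z1]; rewrite (le_trans (ltW d0) z0) (le_trans z1)//.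
  by rewrite gerBl ltW.
have n1 z : 0 <= z <= 1 -> `|z| <= 1 by move=> /andP[z0 z1]; rewrite ger0_norm.
have n1d z : d <= z <= 1 - d -> `|z| <= 1 by move=> /d01/n1.
have dF1 i : coord_depends i [set j] F1 by move=> w x y xy; rewrite /F1 (dF i w x y xy).
have dG1 i : coord_depends i [set l] G1 by move=> w x y xy; rewrite /G1 (dG i w x y xy).
pose Fs := noise P (b * b) F1; pose Gs := noise P (b * b) G1.
have Fsd w : d <= Fs w <= 1 - d by exact: noises_range.
have Gsd w : d <= Gs w <= 1 - d by exact: noises_range.
have dFs i : coord_depends i [set j] Fs by exact: noises_coord_depends.
have dGs i : coord_depends i [set l] Gs by exact: noises_coord_depends.
have corb i j' : correlation2 (P i) (~: [set j']) [set j'] <= (b * b) ^+ m.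
  exact: le_trans (corP i j') hb.
have sub1 : [set l] \subset ~: [set j] by rewrite finset.sub1set !inE eq_sym.
have sub2 : [set j] \subset ~: [set l] by rewrite finset.sub1set !inE.
have s0 : Exp (fun w => F w * G w) <= Exp (fun w => F1 w * G1 w) + 2 * d.
  rewrite -[2 * d](Ex_cst _ pP) -(posfD posE); apply: (posf_le posE) => w.
  exact: mulr_perturb (F01 w) (d01 _ (G1d w)) (F1c w) (G1c w).
have s1 := smoothing_error probP b01 (ltW e0) hm (fun i => corb i j) dF1
  (fun i => coord_dependsW sub1 (dG1 i)) (fun w => n1d _ (F1d w)) (fun w => n1d _ (G1d w)).
have s2 := smoothing_error probP b01 (ltW e0) hm (fun i => corb i l) dG1
  (fun i => coord_dependsW sub2 (dFs i)) (fun w => n1d _ (G1d w)) (fun w => n1d _ (Fsd w)).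
have s3 : Exp (fun w => Gs w * Fs w) <= Exp (fun w => St (Fs w) (Gs w)).
  by apply: (posf_le posE) => w; rewrite mulrC; apply: ge_mul; exact: d01.
have sw : (fun w => Fs w * G1 w) = fun w => G1 w * Fs w by apply/funext => w; rewrite mulrC.
have [MF [HF [MF0 HF0 MFs HFs HMF]]] := HM0 I _ P probP atomP F1 (fun w => n1d _ (F1d w)).
have [MG [HG [MG0 HG0 MGs HGs HMG]]] := HM0 I _ P probP atomP G1 (fun w => n1d _ (G1d w)).
pose IF i := nrm2 Exp (Dif P i Fs); pose IG i := nrm2 Exp (Dif P i Gs).
have IF0 i : 0 <= IF i by exact: nrm2_ge0.
have IG0 i : 0 <= IG i by exact: nrm2_ge0.
pose er i := C * (2 * t * (MF i + MG i) + 2 * (HF i + HG i)) + t' / t ^+ 2 * (IF i + IG i).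
have t2 : 0 < t ^+ 2 by rewrite exprn_gt0.
have infl h h1 r i : nrm2 Exp (Dif P i h1) <= nrm2 Exp (Dif P i h) ->
    nrm2 Exp (Dif P i (avs P r (noise P (b * b) h1))) <= nrm2 Exp (Dif P i (noise P (b * b) h1)) /\
    nrm2 Exp (Dif P i (noise P (b * b) h1)) <= nrm2 Exp (Dif P i h).
  move=> hh; split; first by rewrite Dif_avs_comm; exact: nrm_avs_le.
  by apply: le_trans hh; rewrite Dif_noises_comm; exact: nrm_noises_le.
have step i (r : seq I) : Exp (fun w => St (avs P r Fs w) (avs P r Gs w)) <=
    Exp (fun w => St (avs P (i :: r) Fs w) (avs P (i :: r) Gs w)) + er i.
  have rFd := avs_range probP r Fsd; have rGd := avs_range probP r Gsd.
  have [iF1 iF2] := infl F F1 r i (F1I i); have [iG1 iG2] := infl G G1 r i (G1I i).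
  rewrite -/Fs -/(IF i) in iF1 iF2; rewrite -/Gs -/(IG i) in iG1 iG2.
  have [/andP[lF lG]|] := boolP ((IF i <= t ^+ 2) && (IG i <= t ^+ 2)).
    have sq h : nrm2 Exp h <= t ^+ 2 -> Num.sqrt (nrm2 Exp h) <= t.
      by move=> hh; rewrite -[leRHS]ger0_norm ?(ltW t0)// -sqrtr_sqr ler_sqrt ?sqr_ge0.
    have DF1 w : `|Dif P i (avs P r Fs) w| <= 1.
      by apply: Dif_norm_le1 => // ?; exact: d01.
    have DG1 w : `|Dif P i (avs P r Gs) w| <= 1.
      by apply: Dif_norm_le1 => // ?; exact: d01.
    have tF := sq _ (le_trans iF1 lF); have tG := sq _ (le_trans iG1 lG).
    have mono (x M H z : R) : z <= x * M + H -> x <= t -> 0 <= M -> z <= t * M + H.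
      by move=> zx xt hM; apply: le_trans zx _; rewrite lerD2r ler_wpM2r.
    have dFr : coord_depends i [set j] (avs P r Fs) by exact: avs_coord_depends.
    have dGr : coord_depends i [set l] (avs P r Gs) by exact: avs_coord_depends.
    have hst := stability_step_taylor probP r'0 taylor rFd rGd dFr dGr (corP' i).
    apply: le_trans hst _.
    rewrite -!/(avs P (i :: r) _) lerD2l /er.
    apply: (@le_trans _ _ (C * (2 * t * (MF i + MG i) + 2 * (HF i + HG i)))); last first.
      by rewrite lerDl mulr_ge0 ?addr_ge0// divr_ge0 ?ltW.
    rewrite ler_wpM2l//.
    have q1 := mono _ _ _ _ (HMF i _ r DF1) tF (MF0 i).
    have q2 := mono _ _ _ _ (HMG i _ r DF1) tF (MG0 i).
    have q3 := mono _ _ _ _ (HMF i _ r DG1) tG (MF0 i).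
    have q4 := mono _ _ _ _ (HMG i _ r DG1) tG (MG0 i).
    apply: le_trans (lerD (lerD (lerD q1 q2) q3) q4) _.
    by rewrite le_eqVlt; apply/orP; left; apply/eqP; ring.
  rewrite negb_and -!ltNge => big.
  have hst := stability_step_lipschitz probP lip supp sym i d0 rFd rGd.
  apply: le_trans hst _.
  rewrite -!/(avs P (i :: r) _) lerD2l /er.
  have tI : t ^+ 2 <= IF i + IG i.
    by case/orP: big => /ltW hI; apply: le_trans hI _; rewrite ?lerDl ?lerDr.
  apply: (@le_trans _ _ (t' / t ^+ 2 * (IF i + IG i))); last first.
    by rewrite lerDr mulr_ge0// addr_ge0 ?mulr_ge0 ?addr_ge0// ltW.
  apply: (@le_trans _ _ t'); last first.
    by rewrite mulrAC ler_pdivlMr// ler_wpM2l// ltW.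
  rewrite -[leRHS]ger0_norm ?(ltW t'0)// -sqrtr_sqr ler_sqrt ?sqr_ge0//.
  apply: le_trans (hmin i); rewrite le_min !ge_min.
  by rewrite (le_trans iF1 iF2) (le_trans iG1 iG2) orbT.
have tel := telescope_seq (enum I) step.
have fin h : avs P (enum I) (noise P (b * b) h) = fun=> Exp h.
  by rewrite avs_enum// /noise Exp_noises.
have finF : avs P (enum I) Fs = fun=> Exp F1 by exact: fin.
have finG : avs P (enum I) Gs = fun=> Exp G1 by exact: fin.
have cst : Exp (fun=> St (Exp F1) (Exp G1)) = St (Exp F1) (Exp G1) by exact: Ex_cst.
rewrite finF finG cst big_enum/= in tel.
have totI h : (forall w, d <= h w <= 1 - d) -> \sum_i nrm2 Exp (Dif P i (noise P (b * b) h)) <= K.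
  move=> hd; have := total_influence_noises probP (enum I) h bb01.
  rewrite big_enum/= -/(noise P (b * b) h) -/Exp => hh.
  have h1 : nrm2 Exp h <= 1 by apply: nrm_le1 => // w; exact: n1d.
  have h2 : 0 <= nrm2 Exp (noise P (b * b) h) by exact: nrm2_ge0.
  rewrite /K -[_^-1]mul1r ler_pdivlMr// mulrC; apply: le_trans hh _.
  by rewrite lerBlDr (le_trans h1)// lerDl.
have sI : \sum_i IF i + \sum_i IG i <= 2 * K.
  by rewrite mulr_natl mulr2n; apply: lerD; exact: totI.
have sum_er : \sum_i er i <= 3 * (eps / 4).
  rewrite /er big_split/= -!mulr_sumr !big_split/= -!mulr_sumr !big_split/=.
  have u1 : t' / t ^+ 2 * (\sum_i IF i + \sum_i IG i) <= t' / t ^+ 2 * (2 * K).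
    by rewrite ler_wpM2l// divr_ge0// ltW.
  have u2 : C * (2 * t * (\sum_i MF i + \sum_i MG i) + 2 * (\sum_i HF i + \sum_i HG i)) <=
      C * (2 * t * (M0 + M0) + 2 * (dl + dl)).
    by rewrite ler_wpM2l// lerD// ler_wpM2l ?mulr_ge0 ?(ltW t0)// lerD.
  have u3 : t' / t ^+ 2 * (2 * K) = 2 * K / t ^+ 2 * t' by ring.
  by lra.
have St1 : St (Exp F1) (Exp G1) <= St (Exp F) (Exp G) + 2 * d.
  have cl h h1 : (forall w, `|h1 w - h w| <= d) -> `|Exp h1 - Exp h| <= d.
    move=> hh; rewrite -(posfB posE); apply: le_trans (posf_norm posE _) _.
    by rewrite -[leRHS](Ex_cst _ pP); exact: (posf_le posE).
  have ra h : (forall w, 0 <= h w <= 1) -> 0 <= Exp h <= 1 by exact: Ex_range.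
  have := lip _ _ _ _ (ra _ F01) (ra _ G01) (ra _ (fun w => d01 _ (F1d w))) (ra _ (fun w => d01 _ (G1d w))).
  have := cl _ _ F1c; have := cl _ _ G1c; rewrite -/F1 -/G1.
  by lra.
move: s1 s2; rewrite -/Fs -/Gs -/Exp sw !ler_norml => /andP[_ s1] /andP[_ s2].
move: (Exp (fun w => F w * G w)) (Exp (fun w => F1 w * G1 w)) (Exp (fun w => G1 w * Fs w))
  (Exp (fun w => Gs w * Fs w)) (Exp (fun w => St (Fs w) (Gs w))) (St (Exp F1) (Exp G1))
  (St (Exp F) (Exp G)) (\sum_i er i) s0 s1 s2 s3 tel sum_er St1 => *.
by lra.
Qed.

End ProductStability.

(** * Bounds by Gaussian stability *)

Section GaussianBound.
Context {R : realType}.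
Local Opaque Gamma_upper Gamma_lower.

(** [tau] must not depend on [rho'], which may be as large as 1. The threshold [rho1] depends on
    [eps] alone and makes the Taylor constant uniform over [rho' <= rho1]. *)
Lemma gaussian_upper_bound (eps alpha rho : R) :
  0 < eps -> 0 < alpha -> 0 <= rho < 1 ->
  exists tau : R, 0 < tau /\
  forall (I J : finType) (T : I -> J -> finType)
    (P : forall i, {dffun forall j, T i j} -> R),
  (forall i, is_prob (P i)) -> (forall i x, 0 < P i x -> alpha <= P i x) ->
  (forall i j, correlation2 (P i) (~: [set j]) [set j] <= rho) ->
  forall (j l : J) (F G : {dffun forall i, {dffun forall j, T i j}} -> R) (rho' : R),
  j != l -> (forall w, 0 <= F w <= 1) -> (forall w, 0 <= G w <= 1) ->
  (forall i, coord_depends i [set j] F) -> (forall i, coord_depends i [set l] G) ->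
  0 <= rho' <= 1 -> (forall i, correlation2 (P i) [set j] [set l] <= rho') ->
  (forall i, Num.min (nrm2 (Ex (prod_prob P)) (Dif P i F))
                     (nrm2 (Ex (prod_prob P)) (Dif P i G)) <= tau) ->
  Ex (prod_prob P) (fun w => F w * G w) <=
  Gamma_upper rho' (Ex (prod_prob P) F) (Ex (prod_prob P) G) + eps.
Proof.
move=> eps0 alpha0 rho01.
have [rho1 [rho1_01 near1]] := Gamma_upper_near1 eps0.
have [d d0 Hd] : exists2 d, 0 < d <= 2^-1 & 4 * d <= eps / 2.
  exists (Num.min 2^-1 (eps / 8)); last first.
    have : Num.min 2^-1 (eps / 8) <= eps / 8 by rewrite ge_min lexx orbT.
    by lra.
  by rewrite lt_min ge_min lexx invr_gt0 ltr0n divr_gt0.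
have d0' : 0 < d by case/andP: d0.
have [C [C0 taylor]] := Gamma_upper_taylor rho1_01 d0'.
have eps2 : 0 < eps / 2 by exact: divr_gt0.
have [tau [tau0 Htau]] := product_stability_bound eps2 alpha0 rho01 d0 C0.
exists tau; split=> // I J T P probP atomP corP j l F G rho' jl F01 G01 dF dG /andP[r'0 r'1] corP' hmin.
have posE := Exp_pos probP.
have EF := Ex_range (prod_prob_is_prob probP) F01.
have EG := Ex_range (prod_prob_is_prob probP) G01.
have [r'rho1|/ltW rho1r'] := leP rho' rho1; last first.
  have := near1 rho' _ _ _ EF EG; rewrite rho1r' r'1 lerBlDr => /(_ isT); apply: le_trans.
  rewrite le_min; apply/andP; split; apply: (posf_le posE) => w.
    by have /andP[? ?] := F01 w; have /andP[? ?] := G01 w; rewrite ler_piMr.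
  by have /andP[? ?] := F01 w; have /andP[? ?] := G01 w; rewrite ler_piMl.
have r'01 : 0 <= rho' < 1 by rewrite r'0 (le_lt_trans r'rho1)//; case/andP: rho1_01.
have r'in : 0 <= rho' <= rho1 by rewrite r'0.
have tay : taylor_bound (Gamma_upper rho') rho' d C by move=> x y; exact: taylor.
have lip : lipschitz1 (Gamma_upper rho') by move=> x y x' y'; exact: Gamma_upper_lipschitz.
have supp : supporting_lines (Gamma_upper rho') by move=> x y; exact: Gamma_upper_tangent.
have sym x y : Gamma_upper rho' x y = Gamma_upper rho' y x by exact: Gamma_upper_sym.
have ge_mul x y : 0 <= x <= 1 -> 0 <= y <= 1 -> x * y <= Gamma_upper rho' x y.
  exact: Gamma_upper_ge_mul.
have := Htau I J T P probP atomP corP j l F G rho' (Gamma_upper rho') jl F01 G01 dF dG r'0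
  corP' tay lip supp sym ge_mul hmin.
move=> h; apply: le_trans h _; rewrite -addrA lerD2l.
by move: Hd; clear; lra.
Qed.

Lemma gaussian_stability_bounds (eps alpha rho : R) :
  0 < eps -> 0 < alpha -> 0 <= rho < 1 ->
  exists tau : R, 0 < tau /\
  forall (I J : finType) (T : I -> J -> finType)
    (P : forall i, {dffun forall j, T i j} -> R),
  (forall i, is_prob (P i)) -> (forall i x, 0 < P i x -> alpha <= P i x) ->
  (forall i j, correlation2 (P i) (~: [set j]) [set j] <= rho) ->
  forall (j l : J) (F G : {dffun forall i, {dffun forall j, T i j}} -> R) (rho' : R),
  j != l -> (forall w, 0 <= F w <= 1) -> (forall w, 0 <= G w <= 1) ->
  (forall i, coord_depends i [set j] F) -> (forall i, coord_depends i [set l] G) ->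
  0 <= rho' <= 1 -> (forall i, correlation2 (P i) [set j] [set l] <= rho') ->
  (forall i, Num.min (nrm2 (Ex (prod_prob P)) (Dif P i F))
                     (nrm2 (Ex (prod_prob P)) (Dif P i G)) <= tau) ->
  Gamma_lower rho' (Ex (prod_prob P) F) (Ex (prod_prob P) G) - eps <=
  Ex (prod_prob P) (fun w => F w * G w) <=
  Gamma_upper rho' (Ex (prod_prob P) F) (Ex (prod_prob P) G) + eps.
Proof.
move=> eps0 alpha0 rho01.
have [tau [tau0 H]] := gaussian_upper_bound eps0 alpha0 rho01.
exists tau; split=> // I J T P probP atomP corP j l F G rho' jl F01 G01 dF dG r'01 corP' hmin.
have posE := Exp_pos probP; have pP := prod_prob_is_prob probP.
rewrite (H I J T P probP atomP corP j l)// andbT.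
have G'01 w : 0 <= 1 - G w <= 1.
  by have /andP[g0 g1] := G01 w; rewrite subr_ge0 g1 gerBl.
have dG' i : coord_depends i [set l] (fun w => 1 - G w).
  by move=> w x y xy; rewrite (dG i w x y xy).
have DG' i : nrm2 (Ex (prod_prob P)) (Dif P i (fun w => 1 - G w)) =
    nrm2 (Ex (prod_prob P)) (Dif P i G).
  rewrite (linear_opB _ _ (Dif_linear P i)) [Dif P i (fun=> 1)](_ : _ = fun=> 0).
    by rewrite /nrm2; congr Ex; apply/funext => w; rewrite sub0r sqrrN.
  by apply/funext => w; rewrite /Dif /co Av_cst// subrr.
have hmin' i : Num.min (nrm2 (Ex (prod_prob P)) (Dif P i F))
    (nrm2 (Ex (prod_prob P)) (Dif P i (fun w => 1 - G w))) <= tau by rewrite DG'.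
have h1 := H I J T P probP atomP corP j l F (fun w => 1 - G w) rho' jl F01 G'01 dF dG' r'01 corP' hmin'.
rewrite (posfB posE) (Ex_cst _ pP) in h1.
rewrite (_ : (fun w => F w * (1 - G w)) = fun w => F w - F w * G w) in h1; last first.
  by apply/funext => w; rewrite mulrBr mulr1.
rewrite (posfB posE) in h1.
have h2 := Gamma_lower_le (Ex (prod_prob P) G) r'01 (Ex_range pP F01).
rewrite lerBlDr; apply: le_trans h2 _.
move: (Ex _ F) (Gamma_upper _ _ _) (Ex _ (fun w => F w * G w)) h1; clear => x U y h1.
by lra.
Qed.

End GaussianBound.

Lemma correlation2_le_correlation (R : realType) (J : finType) (T : J -> finType)
    (P : {dffun forall j, T j} -> R) j :
  correlation2 P (~: [set j]) [set j] <= correlation P.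
Proof. exact: (@le_bigmax _ R J 0 (fun j => correlation2 P (~: [set j]) [set j]) j). Qed.

Theorem proposition1p15 (R : realType) (k : nat) (eps alpha rho : R)
    (hk : (2 <= k)%N) (heps : 0 < eps) (halpha : 0 < alpha)
    (hrho0 : 0 <= rho) (hrho1 : rho < 1) :
  exists tau : R, 0 < tau /\
    forall (n : nat) (Omega : 'I_n -> 'I_k -> finType)
      (P : forall i : 'I_n, {dffun forall j : 'I_k, Omega i j} -> R),
    (forall i, is_prob (P i)) ->
    (forall i w, 0 < P i w -> alpha <= P i w) ->
    (forall i, correlation (P i) <= rho) ->
    forall f : (forall j : 'I_k, {dffun forall i : 'I_n, Omega i j} -> R),
    (forall j x, 0 <= f j x <= 1) ->
    let E := Ex (prod_prob P) in
    let F := fun (j : 'I_k) w => f j (coordinates j w) in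
    let Inf := fun (i : 'I_n) (j : 'I_k) => influence (fun l : 'I_n => marginal (P l) j) i (f j) in
    (forall (j1 j2 : 'I_k) (rho' : R),
       k = 2%N -> nat_of_ord j1 = 0%N -> nat_of_ord j2 = 1%N ->
       0 <= rho' <= 1 ->
       (forall i, correlation2 (P i) [set j1] [set j2] <= rho') ->
       \big[Num.max/0]_(i < n) Num.min (Inf i j1) (Inf i j2) <= tau ->
       Gamma_lower rho' (E (F j1)) (E (F j2)) - eps
         <= E (fun w => F j1 w * F j2 w)
         <= Gamma_upper rho' (E (F j1)) (E (F j2)) + eps)
    /\
    (forall s : nat,
       (forall i (j j' : 'I_k), j != j' ->
          correlation2 (P i) [set j] [set j'] = 0) ->
       (forall i, wise_independent (P i) s) ->
       (forall i, (#|[set j : 'I_k | (tau < Inf i j)%R]| <= s)%N) ->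
       \prod_j E (F j) - eps
         <= E (fun w => \prod_j F j w)
         <= \prod_j E (F j) + eps).
Proof.
have hrho : 0 <= rho < 1 by rewrite hrho0.
have [tau1 [tau10 H1]] := gaussian_stability_bounds heps halpha hrho.
have [tau2 [tau20 H2]] := wise_independent_product_bound k heps halpha hrho0 hrho1.
exists (Num.min tau1 tau2); split; first by rewrite lt_min tau10.
move=> n Omega P probP atomP corP f f01 E F Inf.
have corP' i j : correlation2 (P i) (~: [set j]) [set j] <= rho.
  exact: le_trans (correlation2_le_correlation (P i) j) (corP i).
have F01 j w : 0 <= F j w <= 1 by exact: f01.
have dF i j : coord_depends i [set j] (F j) by exact: coordinates_coord_depends.
have InfE i j : Inf i j = nrm2 E (Dif P i (F j)) by exact: influence_coordinates.
split=> [j1 j2 rho' _ j10 j21 rho'01 corP1 hmax|s cor0 indP hcard].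
  have j12 : j1 != j2 by rewrite -val_eqE /= j10 j21.
  apply: (H1 'I_n 'I_k Omega P probP atomP corP' j1 j2 (F j1) (F j2) rho') => // i.
  rewrite -!InfE.
  apply: (@le_trans _ _ (Num.min tau1 tau2)); last by rewrite ge_min lexx.
  by apply: le_trans hmax; exact: (le_bigmax 0 (fun i => Num.min (Inf i j1) (Inf i j2)) i).
(* Lowering the threshold from [tau2] to the minimum can only enlarge the set of influential
   functions. *)
have hcard2 i : (#|[set j : 'I_k | (tau2 < nrm2 E (Dif P i (F j)))%R]| <= s)%N.
  apply: leq_trans (hcard i); apply: subset_leq_card; apply/fintype.subsetP => j.
  by rewrite !inE InfE; apply: le_lt_trans; rewrite ge_min lexx orbT.
have cor0' i j l : j != l -> correlation2 (P i) [set j] [set l] = 0 by exact: cor0.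
have := H2 'I_n Omega P probP atomP corP' F s F01 dF cor0' indP hcard2.
by rewrite ler_distl.
Qed.
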